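(* Let $W\subset\mathbb{R}^d$ be a bounded measurable set with $\lambda_d(W)=1$. For $t>0$ let $\eta_t$ be a Poisson process on $\mathbb{R}^d$ with intensity measure $t\lambda_d$, and define $$ \xi_t=\frac12\sum_{(x,y)\in\eta_{t,\neq}^2}\mathbf{1}\Big\{\frac{x+y}2\in W\Big\}\,\delta_{2^{-1}t^2k_d\|x-y\|^d},\qquad Y_t=\min_{(x,y)\in\eta_{t,\neq}^2:\ \frac{x+y}2\in W}2^{-1}t^2k_d\|x-y\|^d. $$ Let $\gamma$ be a Poisson process on $[0,\infty)$ whose intensity measure is the restriction of the Lebesgue measure to $[0,\infty)$. Then for all $t>0$, all $u\ge0$ and all measurable $B\subset[0,u]$, $$ d_{TV}(\xi_t(B),\gamma(B))\le(1\wedge u)\frac{8u}{t} $$ and $$ 0\le\mathbb{P}(Y_t>u)-e^{-u}\le\frac{81}{t}. $$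
   Context: $\lambda_d$ is Lebesgue measure on $\mathbb{R}^d$, $k_d$ is the volume of the $d$-dimensional unit ball, $\|\cdot\|$ is the Euclidean norm, $\delta_z$ is the Dirac measure at $z$, and $a\wedge b=\min\{a,b\}$. $\eta_{t,\neq}^2$ is the set of ordered pairs of distinct points of $\eta_t$. For $\mathbb{N}_0$-valued random variables $X,X'$, $d_{TV}(X,X')=\sup_{A\subset\mathbb{N}_0}|\mathbb{P}(X\in A)-\mathbb{P}(X'\in A)|$. *)

(* Defs.v *)
From HB Require Import structures.
From mathcomp Require Import all_boot all_order all_algebra.
From mathcomp Require Import all_classical all_reals all_analysis.
From mathcomp Require Import measurable_realfun.

Set Implicit Arguments.
Unset Strict Implicit.
Unset Printing Implicit Defensive.
Import Order.TTheory GRing.Theory Num.Theory.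
Import numFieldNormedType.Exports.

Local Open Scope classical_set_scope.
Local Open Scope ring_scope.

(* R^d is [d.-tuple R], which the library equips with the product (hence the
   Borel) sigma-algebra. *)

Section lebesgue_tuple.
Context {R : realType}.

Definition cons_pair d (p : measurableTypeR R * d.-tuple R) : d.+1.-tuple R :=
  [tuple of p.1 :: p.2].

Lemma measurable_cons_pair d : measurable_fun setT (@cons_pair d).
Proof. by apply: measurable_cons => //; exact: measurable_fst. Qed.

Section step.
Context d (mu : {sigma_finite_measure set (d.-tuple R) -> \bar R}).

Definition lebesgue_step : set (d.+1.-tuple R) -> \bar R :=
  pushforward (@lebesgue_measure R \x mu)%E (@cons_pair d).

Let step0 : lebesgue_step set0 = 0%E.
Proof. by rewrite /lebesgue_step /pushforward preimage_set0 measure0. Qed.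

Let step_ge0 A : (0 <= lebesgue_step A)%E.
Proof. exact: (measure_ge0 (@lebesgue_measure R \x mu)%E). Qed.

Let measurable_preimage_cons (A : set (d.+1.-tuple R)) :
  measurable A -> measurable (@cons_pair d @^-1` A).
Proof.
by move=> mA; rewrite -[X in measurable X]setTI; exact: measurable_cons_pair.
Qed.

Let step_sigma_additive : semi_sigma_additive lebesgue_step.
Proof.
move=> F mF tF mUF; rewrite /lebesgue_step /pushforward preimage_bigcup.
apply: measure_semi_sigma_additive.
- by move=> n; exact: measurable_preimage_cons.
- apply/trivIsetP => i j _ _ ij; rewrite -preimage_setI.
  by move/trivIsetP : tF => /(_ _ _ _ _ ij) ->//; rewrite preimage_set0.
- by rewrite -preimage_bigcup; exact: measurable_preimage_cons.
Qed.

HB.instance Definition _ := isMeasure.Build _ _ _ lebesgue_step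
  step0 step_ge0 step_sigma_additive.

Lemma lebesgue_stepX (A : set R) (B : set (d.-tuple R)) :
  measurable A -> measurable B ->
  lebesgue_step [set x | A (thead x) /\ B [tuple of behead x]] =
  (lebesgue_measure A * mu B)%E.
Proof.
move=> mA mB; rewrite /lebesgue_step /pushforward -product_measure1E//.
congr product_measure1; apply/seteqP; split => -[a b] /=;
  by rewrite theadE (_ : [tuple of _] = b)//; apply/val_inj.
Qed.

Let step_sigma_finite : sigma_finite setT lebesgue_step.
Proof.
have /sigma_finiteP[F [TF ndF Foo]] := sigma_finiteT (@lebesgue_measure R).
have /sigma_finiteP[G [TG ndG Goo]] := sigma_finiteT mu.
exists (fun n => [set x | F n (thead x) /\ G n [tuple of behead x]]).
  apply/esym/seteqP; split => // x _.
  have [n _ Fn] : (\bigcup_n F n) (thead x) by rewrite -TF.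
  have [k _ Gk] : (\bigcup_n G n) [tuple of behead x] by rewrite -TG.
  exists (maxn n k) => //; split.
    by move: Fn; exact/subsetPset/ndF/leq_maxl.
  by move: Gk; exact/subsetPset/ndG/leq_maxr.
move=> n; have [mFn Fnoo] := Foo n; have [mGn Gnoo] := Goo n; split.
  apply: measurableI; rewrite -[X in measurable X]setTI.
    exact: (@measurable_tnth _ R).
  exact: measurable_behead.
by rewrite lebesgue_stepX// lte_mul_pinfty// ge0_fin_numE.
Qed.

HB.instance Definition _ := Measure_isSigmaFinite.Build _ _ _ lebesgue_step
  step_sigma_finite.

End step.

Fixpoint lebesgue_tuple d : {sigma_finite_measure set (d.-tuple R) -> \bar R} :=
  if d is d'.+1 then lebesgue_step (lebesgue_tuple d') else \d_[tuple].

Lemma lebesgue_tuple_box d (A : 'I_d -> set R) :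
  (forall i, measurable (A i)) ->
  lebesgue_tuple d [set x | forall i, A i (tnth x i)] =
  (\prod_(i < d) lebesgue_measure (A i))%E.
Proof.
elim: d A => [|d ih] A mA.
  by rewrite big_ord0/= diracE mem_set//= => -[].
rewrite big_ord_recl -ih// -lebesgue_stepX//; last first.
  rewrite [X in measurable X](_ : _ =
    \bigcap_(i in [set: 'I_d]) (@tnth _ R ^~ i @^-1` A (lift ord0 i))).
    apply: fin_bigcap_measurable => // i _; rewrite -[X in measurable X]setTI.
    by apply: (@measurable_tnth _ R); first exact: measurableT.
  by apply/seteqP; split => x /= Ax i; [move=> _|]; exact: Ax.
congr lebesgue_step; apply/seteqP; split => x /=.
  move=> Ax; split=> [|i]; first exact: Ax.
  by move: (Ax (lift ord0 i)); rewrite {1}(tuple_eta x) tnthS.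
move=> [A0 Ai] i; case: (unliftP ord0 i) => [j|] -> //.
by rewrite (tuple_eta x) tnthS; exact: Ai.
Qed.

End lebesgue_tuple.
Arguments lebesgue_tuple {R} d.

Section euclidean.
Context {R : realType} {d : nat}.
Implicit Types (x y : d.-tuple R) (A : set (d.-tuple R)).

Definition sub_tuple x y : d.-tuple R := [tuple tnth x i - tnth y i | i < d].

Definition midpoint x y : d.-tuple R :=
  [tuple (tnth x i + tnth y i) / 2 | i < d].

Definition eucl_norm x : R := Num.sqrt (\sum_(i < d) tnth x i ^+ 2).

Definition eucl_bounded A := exists M : R, forall x, A x -> eucl_norm x <= M.

End euclidean.

Definition unit_ball_volume (R : realType) (d : nat) : R :=
  fine (lebesgue_tuple d [set x : d.-tuple R | eucl_norm x <= 1]).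

Section point_process.
Context {dO dT : measure_display} {Omega : measurableType dO}
  {T : measurableType dT} {R : realType}.

(* A random measure on T is a kernel from Omega to T: the measurability of
   w |-> eta w A is part of the structure. The covering F does not depend on
   w; locally finite point processes are a special case. *)
Record point_process (eta : R.-ker Omega ~> T) : Prop := PointProcess {
  point_process_counting : forall w A, measurable A ->
    eta w A = +oo%E \/ exists n : nat, eta w A = n%:R%:E ;
  point_process_sigma_finite : exists F : (set T)^nat,
    [/\ forall n, measurable (F n), \bigcup_n F n = setT &
        forall w n, (eta w (F n) < +oo)%E] }.

(* As S i may be setT, the full product rule covers all subfamilies. *)
Definition independent_family (P : probability Omega R) (I : finType)
    (X : I -> Omega -> \bar R) :=
  forall S : I -> set (\bar R), (forall i, measurable (S i)) ->
    P (\bigcap_(i in [set: I]) (X i @^-1` S i)) =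
    (\prod_(i : I) P (X i @^-1` S i))%E.

(* The nat argument of poisson_prob is a dummy. It is used rather than
   poisson_pmf because the latter is not a mass function at rate 0. *)
Record poisson_process (P : probability Omega R)
    (mu : {measure set T -> \bar R}) (eta : R.-ker Omega ~> T) : Prop :=
  PoissonProcess {
  poisson_process_point_process : point_process eta ;
  poisson_process_fin : forall A (n : nat), measurable A ->
    (mu A < +oo)%E ->
    P [set w | eta w A = n%:R%:E] = poisson_prob (fine (mu A)) 0%N [set n] ;
  poisson_process_inf : forall A, measurable A -> mu A = +oo%E ->
    P [set w | eta w A = +oo%E] = 1%E ;
  poisson_process_indep : forall m (A : 'I_m -> set T),
    (forall i, measurable (A i)) -> trivIset setT A ->
    independent_family P (fun i w => eta w (A i)) }.

(* The points of a counting measure are its atoms; multiplicities are ignored. *)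
Definition distinct_pairs (m : {measure set T -> \bar R}) : set (T * T) :=
  [set p | [/\ (0 < m [set p.1])%E, (0 < m [set p.2])%E & p.1 <> p.2]].

End point_process.

Section total_variation.
Context {d1 d2 : measure_display} {Omega1 : measurableType d1}
  {Omega2 : measurableType d2} {R : realType}.

(* For nat-valued X1 and X2, embedded in \bar R as counting measures are. *)
Definition dTV (P1 : probability Omega1 R) (X1 : Omega1 -> \bar R)
    (P2 : probability Omega2 R) (X2 : Omega2 -> \bar R) : \bar R :=
  ereal_sup [set `|P1 [set w | exists2 n : nat, A n & X1 w = n%:R%:E]
                 - P2 [set w | exists2 n : nat, A n & X2 w = n%:R%:E]|%E
            | A in [set: set nat]].

End total_variation.

Section statistics.
Context {R : realType} {d : nat}.
Variables (t : R) (W : set (d.-tuple R)).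
Implicit Types (m : {measure set (d.-tuple R) -> \bar R}) (B : set R).

Definition scaled_distance (x y : d.-tuple R) : R :=
  2^-1 * t ^+ 2 * unit_ball_volume R d * eucl_norm (sub_tuple x y) ^+ d.

Definition xi m B : \bar R :=
  (2^-1%:E * \esum_(p in distinct_pairs m)
     ((\1_W (midpoint p.1 p.2))%:E * \d_(scaled_distance p.1 p.2) B))%E.

(* The infimum over no pair is +oo. *)
Definition Ymin m : \bar R :=
  ereal_inf [set (scaled_distance p.1 p.2)%:E
            | p in distinct_pairs m `&` [set p | W (midpoint p.1 p.2)]].

End statistics.

(* Main.v *)
(* The pairs with midpoint in W and scaled distance at most u lie in a bounded
   box V. Approximate the symmetric set G of these pairs, in (mu x mu)-measure
   with mu = t * Lebesgue on V, by a union of products of cells of a finite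
   partition of V. Outside an event of small probability no cell contains two
   points, and xi_t(B) is the number of edges spanned by the occupied cells,
   i.e. sum_{i<j} g_ij N_i N_j with independent Poisson variables N_i and a
   graph g. For this sum the discrete Mecke formula E[N_i F(N)] = l_i E[F(N+e_i)]
   gives both estimates.
   - Chen-Stein: the solution of the Stein equation has slope at most
     min(1, 1/b), which bounds the distance to Poisson(b) by min(1, 1/b) times
     the expected overlap of two edges, in the limit (4u/t) b.
   - Void probability: G(s) = E[s^X] satisfies G' >= (lam - C) G on [0, 1], with
     lam the mean number of edges and C their overlap, so
     P(X = 0) <= exp(-lam + C), in the limit exp(-b + (4u/t) b), while the
     lower bound exp(-b) is the Chen-Stein estimate for the complement of {0},
     whose Stein solution is monotone, so that the overlap term drops out.
   Translation invariance and scaling of Lebesgue measure give b = lambda(B) and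
   the section bound mu(G_x) <= 2u/t. Finally {Y_t > u} is the increasing union
   of the events {xi_t([0, u + 1/n]) = 0}; the void bounds yield 81/t when
   u <= t/8, and monotonicity in u covers the remaining range. *)

Require Import Defs.
From mathcomp Require Import all_boot all_order all_algebra.
From mathcomp Require Import all_classical all_reals all_analysis.
From mathcomp Require Import measurable_realfun.
From mathcomp Require Import ring lra zify.

Set Implicit Arguments.
Unset Strict Implicit.
Unset Printing Implicit Defensive.
Import Order.TTheory GRing.Theory Num.Theory.
Import numFieldNormedType.Exports.

Local Open Scope classical_set_scope.
Local Open Scope ring_scope.

(** The Poisson process is known only through its counts on disjoint sets, so every estimate is
    first proved for a finite vector of counts; it survives refinement of the partition because the
    partition enters only through the edge mean, the overlap and the mass of the diagonal cells.
    Three obstacles shape the rest. Expectations are sums in [0, +oo]: this avoids summability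
    questions but forbids subtraction, hence nonnegative, shifted forms of the identities. The
    comparisons bound P(A) only from above, for arbitrary A; lower bounds come from the complement
    of A. The points of a counting measure must be constructed: a countable separating family
    (half-spaces with rational bounds) yields the atoms, the measurability of pair counts and
    partitions with small diagonal blocks. As to constants, the argument gives min(1, u) 4u/t, so
    8u/t has a factor 2 to spare. For u <= t/8 the error of the void probability is at most 32/t,
    and at t/8 the whole bound is at most 16/t, both below 81/t. *)

Section esum_extra.
Local Open Scope ereal_scope.
Context {R : realType} {T : choiceType}.
Implicit Types (I : set T) (a : T -> \bar R).

Lemma esumZl I a (c : R) : (0 <= c)%R -> (forall i, 0 <= a i) ->
  \esum_(i in I) (c%:E * a i) = c%:E * \esum_(i in I) a i.
Proof.
have le_esumZ (b : T -> \bar R) (e : R) : (0 <= e)%R ->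
    (forall i, 0 <= b i) ->
    \esum_(i in I) (e%:E * b i) <= e%:E * \esum_(i in I) b i.
  move=> e0 b0; rewrite ge_ereal_sup//= => _ [X [finX XI]] <-.
  rewrite -ge0_mule_fsumr//; apply: lee_wpmul2l; first by rewrite lee_fin.
  by apply: esum_ge; exists X.
move=> c0 a0; apply/eqP; rewrite eq_le le_esumZ//=.
have [<-|cN0] := eqVneq 0%R c.
  by rewrite mul0e esum_ge0// => i _; rewrite mul0e.
have {c0 cN0} c0 : (0 < c)%R by rewrite lt_neqAle cN0.
have ca0 i : 0 <= c%:E * a i by rewrite mule_ge0// lee_fin ltW.
(* The reverse inequality is the one just proved, for the factor [c^-1] and the summands
   [c%:E * a i]. *)
have := le_esumZ _ c^-1%R _ ca0; rewrite invr_ge0 (ltW c0) => /(_ isT) h.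
rewrite -(@lee_pmul2l _ c^-1%:E) ?lte_fin ?invr_gt0//.
apply: (le_trans _ h).
rewrite muleA -EFinM mulVf ?gt_eqF// mul1e; apply: le_esum => i _.
by rewrite muleA -EFinM mulVf ?gt_eqF// mul1e.
Qed.

End esum_extra.

(** * Independent Poisson coordinates and the discrete Mecke formula *)

Section poisson_vector.
Context {R : realType} {m : nat}.
Implicit Types (l : 'I_m -> R) (v : {ffun 'I_m -> nat}) (i j k : 'I_m).

Definition poisson_weight (r : R) (n : nat) : R := r ^+ n / n`!%:R * expR (- r).

Lemma poisson_weight_ge0 r n : 0 <= r -> 0 <= poisson_weight r n.
Proof. by move=> r0; rewrite !mulr_ge0 ?exprn_ge0 ?invr_ge0 ?expR_ge0. Qed.

Lemma poisson_weightS r n :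
  n.+1%:R * poisson_weight r n.+1 = r * poisson_weight r n.
Proof.
rewrite /poisson_weight factS natrM exprS; field.
by rewrite !pnatr_eq0 -lt0n fact_gt0 /=.
Qed.

Definition vector_weight l v : R := \prod_(i < m) poisson_weight (l i) (v i).

Definition vector_incr v i : {ffun 'I_m -> nat} := [ffun j => v j + (j == i)]%N.

Lemma vector_incr_inj i : injective (vector_incr ^~ i).
Proof.
move=> v w /ffunP vw; apply/ffunP => j.
by have := vw j; rewrite !ffunE => /addIn.
Qed.

Lemma vector_incrE v i : vector_incr v i i = (v i).+1.
Proof. by rewrite ffunE eqxx addn1. Qed.

Lemma vector_incrNE v i j : j != i -> vector_incr v i j = v j.
Proof. by rewrite ffunE => /negbTE ->; rewrite addn0. Qed.

Lemma vector_weight_incr l v i :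
  (vector_incr v i i)%:R * vector_weight l (vector_incr v i) =
  l i * vector_weight l v.
Proof.
rewrite /vector_weight (bigD1 i)//= [in RHS](bigD1 i)//= vector_incrE.
rewrite [LHS]mulrA poisson_weightS -[LHS]mulrA.
by congr (_ * (_ * _)); apply: eq_bigr => j ji; rewrite vector_incrNE.
Qed.

(** The expectation of F(N) for independent N_i with Poisson(l_i) law. Values in [0, +oo] make
    linearity unconditional for nonnegative F. *)
Definition vector_esum l (F : {ffun 'I_m -> nat} -> \bar R) : \bar R :=
  (\esum_(v in [set: {ffun 'I_m -> nat}]) ((vector_weight l v)%:E * F v))%E.

Context (l : 'I_m -> R) (l_ge0 : forall i, 0 <= l i).

Lemma vector_weight_ge0 v : 0 <= vector_weight l v.
Proof. by apply: prodr_ge0 => i _; exact: poisson_weight_ge0. Qed.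
Hint Resolve vector_weight_ge0 : core.

Local Open Scope ereal_scope.
Local Notation E := (vector_esum l).
Implicit Types F G : {ffun 'I_m -> nat} -> \bar R.

Lemma vector_esum_ge0 F : (forall v, 0 <= F v) -> 0 <= E F.
Proof. by move=> F0; apply: esum_ge0 => v _; rewrite mule_ge0// lee_fin. Qed.

Lemma le_vector_esum F G : (forall v, F v <= G v) -> E F <= E G.
Proof. by move=> FG; apply: le_esum => v _; rewrite lee_wpmul2l// lee_fin. Qed.

Lemma eq_vector_esum F G : F =1 G -> E F = E G.
Proof. by move=> FG; apply: eq_esum => v _; rewrite FG. Qed.

Lemma vector_esumD F G : (forall v, 0 <= F v) -> (forall v, 0 <= G v) ->
  E (fun v => F v + G v) = E F + E G.
Proof.
move=> F0 G0; rewrite -esumD; last 2 first.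
- by move=> v _; rewrite mule_ge0// lee_fin.
- by move=> v _; rewrite mule_ge0// lee_fin.
by apply: eq_esum => v _; rewrite ge0_muleDr.
Qed.

Lemma vector_esumZ F (c : R) : (0 <= c)%R -> (forall v, 0 <= F v) ->
  E (fun v => c%:E * F v) = c%:E * E F.
Proof.
move=> c0 F0; rewrite -esumZl//; last by move=> v; rewrite mule_ge0// lee_fin.
by apply: eq_esum => v _; rewrite muleCA.
Qed.

Lemma vector_esum_sum (I : choiceType) (r : seq I) (P : pred I)
    (H : I -> {ffun 'I_m -> nat} -> \bar R) : (forall e v, 0 <= H e v) ->
  E (fun v => \sum_(e <- r | P e) H e v) = \sum_(e <- r | P e) E (H e).
Proof.
move=> H0; rewrite -esum_sum; last by move=> v e _ _; rewrite mule_ge0// lee_fin.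
by apply: eq_esum => v _; rewrite ge0_sume_distrr.
Qed.

(** Coordinatewise this is n p(n) = r p(n-1). The map v -> v + e_i is a bijection onto the vectors
    with v_i > 0, and the remaining vectors contribute 0 on the left. *)
Lemma vector_mecke F i : (forall v, 0 <= F v) ->
  E (fun v => (v i)%:R%:E * F v) = (l i)%:E * E (fun v => F (vector_incr v i)).
Proof.
move=> F0; rewrite -vector_esumZ//.
rewrite /vector_esum (esumID ((vector_incr ^~ i) @` setT)); last first.
  by move=> v _; rewrite !mule_ge0// lee_fin.
rewrite setTI [X in _ + X]esum1 ?adde0.
  rewrite esum_image; last by move=> v w _ _; exact: vector_incr_inj.
  apply: eq_esum => v _; rewrite !muleA -!EFinM; congr (_%:E * _).
  by rewrite mulrC vector_weight_incr mulrC.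
move=> v [_ /= vi]; suff -> : v i = 0%N by rewrite mul0e mule0.
apply/eqP; rewrite -leqn0 leqNgt; apply/negP => v0; apply: vi.
exists [ffun j => v j - (j == i)]%N => //; apply/ffunP => j; rewrite !ffunE.
by have [->|] := eqVneq j i; rewrite ?subnK// subn0 addn0.
Qed.

End poisson_vector.

(** * Edges spanned by the counts and their expectations *)

Section edge_count.
Context {R : realType} {m : nat} (g : rel 'I_m).
Hypotheses (g_sym : symmetric g) (g_irr : irreflexive g).
Implicit Types (v : {ffun 'I_m -> nat}) (i j k : 'I_m) (p : 'I_m * 'I_m).

Definition is_edge p := (p.1 < p.2)%N && g p.1 p.2.

Definition edge_count v : nat := \sum_(p | is_edge p) v p.1 * v p.2.

Definition weighted_degree v i : nat := \sum_(k | g i k) v k.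

(** An edge is stored once, smaller endpoint first. A neighbour k of i therefore occurs in exactly
    one of (i, k) and (k, i), depending on the order of i and k; k = i is excluded by
    irreflexivity. *)
Lemma edge_sum_incident (V : nmodType) (F : 'I_m -> V) i :
  \sum_(p | is_edge p) (F p.2 *+ (p.1 == i) + F p.1 *+ (p.2 == i)) =
  \sum_(k | g i k) F k.
Proof.
rewrite big_split/= !(big_mkcond is_edge)/=.
rewrite -(pair_bigA _ (fun a b => if is_edge (a, b) then F b *+ (a == i) else 0)).
rewrite -(pair_bigA _ (fun a b => if is_edge (a, b) then F a *+ (b == i) else 0)).
rewrite exchange_big/= -big_split/= [in RHS]big_mkcond.
apply: eq_bigr => k _; rewrite (bigD1 i)//= big1 ?addr0; last first.
  by move=> j /negbTE ->; rewrite mulr0n; case: ifP.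
rewrite (bigD1 i)//= big1 ?addr0; last first.
  by move=> j /negbTE ->; rewrite mulr0n; case: ifP.
rewrite eqxx mulr1n /is_edge/= (g_sym k i).
have [ik|ki|/val_inj ->] := ltngtP i k; rewrite /= ?addr0 ?add0r//.
by rewrite g_irr.
Qed.

Lemma edge_count_incr v i :
  edge_count (vector_incr v i) = (edge_count v + weighted_degree v i)%N.
Proof.
rewrite /weighted_degree -(@edge_sum_incident nat).
rewrite /edge_count -big_split/=; apply: eq_bigr => -[a b] /andP[/= ab _].
rewrite !ffunE; case: (eqVneq a i) => [ai|ai]; case: (eqVneq b i) => [bi|bi];
  rewrite ?mulr1n ?mulr0n /=; rewrite ?addn0 ?addn1.
- by move: ab; rewrite ai bi ltnn.
- by rewrite addr0 mulSn [LHS]addnC.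
- by rewrite add0r mulnS [LHS]addnC.
- by rewrite ?addr0 ?addn0.
Qed.

Lemma weighted_degree_incr v i j :
  weighted_degree (vector_incr v i) j = (weighted_degree v j + g j i)%N.
Proof.
rewrite /weighted_degree big_mkcond/= [in RHS]big_mkcond/=.
rewrite (bigD1 i)//= [in RHS](bigD1 i)//= vector_incrE addnAC; congr addn.
  by case: ifP; rewrite ?addn0// addn1.
by apply: eq_bigr => k ki; rewrite vector_incrNE.
Qed.

(** The successor is the edge formed by the two added points themselves. *)
Lemma edge_count_incr2 v i j : g i j ->
  edge_count (vector_incr (vector_incr v j) i) =
  (edge_count v + (weighted_degree v i + weighted_degree v j)).+1.
Proof.
move=> ij; rewrite edge_count_incr edge_count_incr weighted_degree_incr ij.
by lia.
Qed.

End edge_count.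

Section edge_expectation.
Context {R : realType} {m : nat} (g : rel 'I_m).
Hypotheses (g_sym : symmetric g) (g_irr : irreflexive g).
Context (l : 'I_m -> R) (l_ge0 : forall i, 0 <= l i).
Hypothesis weight_total : vector_esum l (fun=> 1%E) = 1%E.
Implicit Types (v : {ffun 'I_m -> nat}) (i j k : 'I_m) (p : 'I_m * 'I_m).

Definition edge_mean : R := \sum_(p | is_edge g p) l p.1 * l p.2.

Definition mean_degree i : R := \sum_(k | g i k) l k.

(** The sum over edges ij of l_i l_j times the expected number of old edges gained when one point is
    added at i and one at j. It measures the distance of the edge count from a sum of independent
    variables. *)
Definition edge_overlap : R :=
  \sum_(p | is_edge g p) l p.1 * l p.2 * (mean_degree p.1 + mean_degree p.2).

Local Open Scope ereal_scope.
Local Notation E := (vector_esum l).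
Local Notation X := (edge_count g).
Implicit Types F G : {ffun 'I_m -> nat} -> \bar R.

Lemma vector_esum_cst (c : R) : (0 <= c)%R -> E (fun=> c%:E) = c%:E.
Proof.
move=> c0; rewrite -[RHS]mule1 -weight_total -vector_esumZ//.
  by apply: eq_vector_esum => v /=; rewrite mule1.
Qed.

Lemma vector_esum_coord i : E (fun v => (v i)%:R%:E) = (l i)%:E.
Proof.
have := vector_mecke l_ge0 i (fun=> lee01); rewrite weight_total mule1 => <-.
by apply: eq_vector_esum => v /=; rewrite mule1.
Qed.

Lemma vector_mecke2 F i j : (forall v, 0 <= F v) -> i != j ->
  E (fun v => (v i * v j)%:R%:E * F v) =
  (l i * l j)%:E * E (fun v => F (vector_incr (vector_incr v j) i)).
Proof.
move=> F0 ij.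
have vF0 v : 0 <= (v j)%:R%:E * F v by rewrite mule_ge0// lee_fin.
transitivity (E (fun v => (v i)%:R%:E * ((v j)%:R%:E * F v))).
  by apply: eq_vector_esum => v; rewrite natrM EFinM muleA.
rewrite (vector_mecke l_ge0 i vF0) EFinM -muleA; congr (_ * _).
rewrite -(vector_mecke l_ge0 j (fun v => F0 (vector_incr v i))).
by apply: eq_vector_esum => v; rewrite vector_incrNE// eq_sym.
Qed.

(** Weighting by the edge count amounts to planting one edge, chosen with weight l_i l_j: the
    size-biased coupling on which both the Stein bound and the void bound rest. *)
Lemma edge_mecke F : (forall v, 0 <= F v) ->
  E (fun v => (X v)%:R%:E * F v) =
  \sum_(p | is_edge g p) (l p.1 * l p.2)%:E *
    E (fun v => F (vector_incr (vector_incr v p.2) p.1)).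
Proof.
move=> F0; under eq_vector_esum.
  move=> v; rewrite natr_sum -sumEFin ge0_sume_distrl; last first.
    by move=> p _; rewrite lee_fin.
  over.
rewrite vector_esum_sum//; last by move=> p v; rewrite mule_ge0// lee_fin.
apply: eq_bigr => -[i j] /andP[/= ij gij]; rewrite vector_mecke2//.
by rewrite neq_ltn ij.
Qed.

Lemma vector_esum_degree i :
  E (fun v => (weighted_degree g v i)%:R%:E) = (mean_degree i)%:E.
Proof.
under eq_vector_esum do rewrite natr_sum -sumEFin.
rewrite vector_esum_sum//.
by rewrite /mean_degree -sumEFin; apply: eq_bigr => k _; exact: vector_esum_coord.
Qed.

Lemma vector_esum_edge_count : E (fun v => (X v)%:R%:E) = edge_mean%:E.
Proof.
transitivity (E (fun v => (X v)%:R%:E * 1)).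
  by apply: eq_vector_esum => v; rewrite mule1.
rewrite (@edge_mecke (fun=> 1))// /edge_mean -sumEFin.
by apply: eq_bigr => p _; rewrite weight_total mule1.
Qed.

End edge_expectation.

(** * Chen-Stein bound for the edge count *)

Section edge_approximation.
Context {R : realType} {m : nat} (g : rel 'I_m).
Hypotheses (g_sym : symmetric g) (g_irr : irreflexive g).
Context (l : 'I_m -> R) (l_ge0 : forall i, 0 <= l i).
Hypothesis weight_total : vector_esum l (fun=> 1%E) = 1%E.
Implicit Types (v : {ffun 'I_m -> nat}) (i j : 'I_m) (p : 'I_m * 'I_m).

Local Notation E := (vector_esum l).
Local Notation X := (edge_count g).
Local Notation lam := (edge_mean g l).
Local Notation C := (edge_overlap g l).
Let Z v p := (weighted_degree g v p.1 + weighted_degree g v p.2)%N.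

Let edge_weight_ge0 p : 0 <= l p.1 * l p.2.
Proof. by rewrite mulr_ge0. Qed.

Let mean_degree_ge0 i : 0 <= mean_degree g l i.
Proof. by rewrite sumr_ge0. Qed.

Let EZ p : E (fun v => (Z v p)%:R%:E) = (mean_degree g l p.1 + mean_degree g l p.2)%:E.
Proof.
rewrite EFinD -!vector_esum_degree// -vector_esumD//.
by apply: eq_vector_esum => v; rewrite natrD EFinD.
Qed.

Let edge_mecke' (f : nat -> R) : (forall k, 0 <= f k) ->
  E (fun v => ((X v)%:R * f (X v))%:E) =
  (\sum_(p | is_edge g p) (l p.1 * l p.2)%:E * E (fun v => (f (X v + Z v p).+1)%:E))%E.
Proof.
move=> f0; under eq_vector_esum do rewrite EFinM.
rewrite edge_mecke//; last by move=> v; rewrite lee_fin ?f0.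
apply: eq_bigr => p /andP[_ gp]; congr (_ * _)%E.
by apply: eq_vector_esum => v; rewrite edge_count_incr2.
Qed.

Let bounded_fin (F : {ffun 'I_m -> nat} -> R) (c : R) :
  (forall v, 0 <= F v <= c) -> E (fun v => (F v)%:E) \is a fin_num.
Proof.
move=> Fc; rewrite ge0_fin_numE; last first.
  by apply: vector_esum_ge0 => // v; rewrite lee_fin; case/andP: (Fc v).
have c0 : 0 <= c.
  by case/andP: (Fc [ffun=> 0%N]); exact: le_trans.
apply: (@le_lt_trans _ _ (E (fun=> c%:E))).
  by apply: le_vector_esum => // v; rewrite lee_fin; case/andP: (Fc v).
by rewrite vector_esum_cst// ltry.
Qed.

Section stein.
Context (A : set nat) (f : nat -> R) (L q c c' kappa : R).
Hypotheses (f_bounded : forall k, 0 <= f k <= c) (c'_ge0 : 0 <= c')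
  (kappa_ge0 : 0 <= kappa) (L_ge0 : 0 <= L) (q_ge0 : 0 <= q).
(* The Stein equation, shifted so that both sides are nonnegative. *)
Hypothesis f_stein : forall k,
  \1_A k + k%:R * f k + c' * L = q + c' * k%:R + L * f k.+1.
Hypothesis f_slope : forall k, f k.+1 <= f k.+2 + kappa.

Let f_ge0 k : 0 <= f k. Proof. by case/andP: (f_bounded k). Qed.

Let f_slopeD k n : f k.+1 <= f (k + n).+1 + kappa * n%:R.
Proof.
elim: n => [|n ih]; first by rewrite addn0 mulr0 addr0.
apply: (le_trans ih); rewrite addnS -natr1 mulrDr mulr1 (addrC (_ * _)) addrA.
by rewrite lerD2r.
Qed.

(** Take expectations in the Stein equation. By [edge_mecke], E[X f(X)] is the sum of l_i l_j
    E[f(X + Z + 1)], where Z is the number of extra edges; replacing Z by 0 costs [kappa] E[Z], in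
    total [kappa * C]. The rate L need not equal the edge mean: as 0 <= f <= c, the discrepancy
    costs c |lam - L|, and the shift costs c' |lam - L|. *)
Lemma edge_count_stein :
  (E (fun v => (\1_A (X v))%:E) <=
   (q + kappa * C + (c + c') * `|lam - L|)%:E)%E.
Proof.
have c0 : 0 <= c by apply: le_trans (f_ge0 0) _; case/andP: (f_bounded 0).
have Pfin : E (fun v => (\1_A (X v))%:E) \is a fin_num.
  by apply: (@bounded_fin _ 1) => v; rewrite indicE; case: (_ \in _); rewrite ?lexx ?ler01.
set S := E (fun v => ((X v)%:R * f (X v))%:E).
set U := E (fun v => (f (X v).+1)%:E).
have Ufin : U \is a fin_num by apply: (@bounded_fin _ c) => v.
have Sfin : S \is a fin_num.
  rewrite ge0_fin_numE; last first.
    by apply: vector_esum_ge0 => // v; rewrite lee_fin mulr_ge0.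
  apply: (@le_lt_trans _ _ (E (fun v => c%:E * (X v)%:R%:E))%E).
    apply: le_vector_esum => // v; rewrite -EFinM lee_fin mulrC ler_wpM2r//.
    by case/andP: (f_bounded (X v)).
  by rewrite vector_esumZ// vector_esum_edge_count// -EFinM ltry.
(* All terms of the shifted equation are nonnegative, so the expectation splits without any
   integrability argument. *)
have eqE : (E (fun v => (\1_A (X v))%:E) + S + (c' * L)%:E =
    q%:E + c'%:E * lam%:E + L%:E * U)%E.
  rewrite -(vector_esum_cst l_ge0 weight_total (mulr_ge0 c'_ge0 L_ge0)).
  rewrite -(vector_esum_cst l_ge0 weight_total q_ge0).
  rewrite -vector_esum_edge_count// -!vector_esumZ//; last by move=> v; rewrite lee_fin ?f0.
  have cL0 := mulr_ge0 c'_ge0 L_ge0.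
  have XF0 v : (0 <= ((X v)%:R * f (X v))%:E)%E by rewrite lee_fin mulr_ge0.
  have I0 v : (0 <= (\1_A (X v))%:E :> \bar R)%E by rewrite lee_fin.
  have LF0 v : (0 <= (L * f (X v).+1)%:E)%E by rewrite lee_fin mulr_ge0.
  have cX0 v : (0 <= (c' * (X v)%:R)%:E)%E by rewrite lee_fin mulr_ge0.
  rewrite /S -!vector_esumD//.
  - by apply: eq_vector_esum => v; rewrite -!EFinM -!EFinD f_stein.
  - by move=> v; rewrite -EFinM -EFinD lee_fin addr_ge0// mulr_ge0.
  - by move=> v; rewrite -EFinD lee_fin addr_ge0// mulr_ge0.
have leE : (lam%:E * U <= S + kappa%:E * C%:E)%E.
  rewrite /edge_mean -sumEFin ge0_sume_distrl; last by move=> p _; rewrite lee_fin.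
  rewrite /S edge_mecke'// /edge_overlap -sumEFin ge0_sume_distrr; last first.
    by move=> p _; rewrite lee_fin mulr_ge0// addr_ge0.
  rewrite -big_split/=; apply: lee_sum => p _.
  rewrite [X in (_ + _ * X)%E]EFinM muleCA -ge0_muleDr; last 2 first.
  - by apply: vector_esum_ge0 => // v; rewrite lee_fin.
  - by rewrite mule_ge0// lee_fin addr_ge0.
  apply: lee_wpmul2l; first by rewrite lee_fin.
  rewrite -EZ -vector_esumZ// -vector_esumD//; last 2 first.
  - by move=> v; rewrite lee_fin.
  - by move=> v; rewrite -EFinM lee_fin mulr_ge0.
  by apply: le_vector_esum => // v; rewrite -EFinM -EFinD lee_fin f_slopeD.
have Uc : (U <= c%:E)%E.
  rewrite -(vector_esum_cst l_ge0 weight_total c0).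
  by apply: le_vector_esum => // v; rewrite lee_fin; case/andP: (f_bounded (X v).+1).
have U0 : (0 <= U)%E by apply: vector_esum_ge0 => // v; rewrite lee_fin.
move: eqE leE Uc U0; rewrite -(fineK Ufin) -(fineK Sfin) -(fineK Pfin).
move: (fine U) (fine S) (fine _) => u s x.
rewrite -!EFinM -!EFinD => -[eqE]; rewrite !lee_fin => leE uc u0.
have L1 : L * u <= lam * u + c * `|lam - L|.
  rewrite -lerBlDl -mulrBl (mulrC c) distrC.
  apply: (@le_trans _ _ (`|L - lam| * u)); first by rewrite ler_wpM2r// ler_norm.
  by rewrite ler_wpM2l.
have L2 : c' * lam - c' * L <= c' * `|lam - L|.
  by rewrite -mulrBr ler_wpM2l// ler_norm.
by rewrite mulrDl; lra.
Qed.

End stein.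

End edge_approximation.

(** * Void probability of the edge count *)

Lemma ler_harmonic (R : realType) (x y c : R) :
  (forall n, x <= y + c / n.+1%:R) -> x <= y.
Proof.
move=> h; apply/ler_addgt0Pr => e e0; have [c0|c0] := lerP c 0.
  apply: (le_trans (h 0%N)); rewrite lerD2l divr1.
  exact: le_trans c0 (ltW e0).
have ce0 : 0 <= c / e by rewrite divr_ge0// ltW.
apply: (le_trans (h (Num.trunc (c / e)))); rewrite lerD2l.
by rewrite ler_pdivrMr// mulrC -ler_pdivrMr// ltW// truncnS_gt.
Qed.

(** A quantitative form of (1 + a/N)^N -> exp(a). Since 1/(1 + a/N) = 1 - a/(N + a) <= exp(-a/(N +
    a)), one gets x exp(a) <= exp(a^2/N), and then x exp(a) (1 - a^2/N) <= 1 by exp(-y) >= 1 - y.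
    The error is of order 1/N and is removed by [ler_harmonic]. *)
Lemma le_expRN_of_powers (R : realType) (x a : R) : 0 <= a ->
  (forall n, x * (1 + a / n.+1%:R) ^+ n.+1 <= 1) -> x <= expR (- a).
Proof.
move=> a0 h.
rewrite -(@ler_pM2r _ (expR a)) ?expR_gt0// -expRD addNr expR0.
have [x0|x0] := lerP x 0.
  by apply: (@le_trans _ _ 0) => //; rewrite mulr_le0_ge0 ?expR_ge0.
apply: (@ler_harmonic _ _ _ (x * expR a * a ^+ 2)) => n.
have N0 : 0 < n.+1%:R :> R by rewrite ltr0n.
have key : x <= expR (- (a / (n.+1%:R + a)) * n.+1%:R).
  rewrite expRM_natr.
  apply: (@le_trans _ _ ((1 + a / n.+1%:R)^-1 ^+ n.+1)).
    rewrite exprVn -[leRHS]mul1r ler_pdivlMr ?exprn_gt0//.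
    by rewrite ltr_pwDl// divr_ge0// ltW.
  rewrite lerXn2r ?nnegrE ?invr_ge0 ?expR_ge0//.
    by rewrite addr_ge0// divr_ge0// ltW.
  apply: le_trans (expR_ge1Dx _).
  move: N0; move: (n.+1%:R) => N N0; have Na0 : 0 < N + a by rewrite ltr_pwDl.
  rewrite le_eqVlt; apply/orP; left; apply/eqP.
  by field; rewrite ?(gt_eqF N0) ?(gt_eqF Na0).
move: N0 key; move: (n.+1%:R) => N N0 key; have Na0 : 0 < N + a by rewrite ltr_pwDl.
have e1 : x * expR a <= expR (a ^+ 2 / N).
  rewrite -ler_pdivlMr ?expR_gt0// -expRN -expRD.
  apply: (le_trans key); rewrite ler_expR -subr_ge0.
  rewrite [leRHS](_ : _ = a ^+ 3 / (N * (N + a))).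
    by apply: divr_ge0; rewrite ?exprn_ge0//; apply: mulr_ge0; exact: ltW.
  by field; rewrite ?(gt_eqF N0) ?(gt_eqF Na0).
rewrite -lerBlDr [leLHS](_ : _ = x * expR a * (1 - a ^+ 2 / N)); last by ring.
apply: (@le_trans _ _ (x * expR a * expR (- (a ^+ 2 / N)))).
  rewrite ler_wpM2l ?expR_ge1Dx//.
  by rewrite mulr_ge0 ?expR_ge0 ?(ltW x0).
by rewrite expRN ler_pdivrMr ?expR_gt0// mul1r.
Qed.

Section edge_void.
Context {R : realType} {m : nat} (g : rel 'I_m).
Hypotheses (g_sym : symmetric g) (g_irr : irreflexive g).
Context (l : 'I_m -> R) (l_ge0 : forall i, 0 <= l i).
Hypothesis weight_total : vector_esum l (fun=> 1%E) = 1%E.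
Implicit Types (v : {ffun 'I_m -> nat}) (i j : 'I_m) (p : 'I_m * 'I_m).

Local Notation E := (vector_esum l).
Local Notation X := (edge_count g).
Local Notation lam := (edge_mean g l).
Local Notation C := (edge_overlap g l).
Let Z v p := (weighted_degree g v p.1 + weighted_degree g v p.2)%N.
Let G (s : R) := E (fun v => (s ^+ X v)%:E).
(** The termwise derivative of the generating function; at X = 0 the predecessor is harmless because
    of the factor 0. Differentiability of G is never proved: [convexity] supplies the tangent
    inequality instead. *)
Let G' (s : R) := E (fun v => ((X v)%:R * s ^+ (X v).-1)%:E).

Let edge_weight_ge0 p : 0 <= l p.1 * l p.2.
Proof. by rewrite mulr_ge0. Qed.

Let powE_ge0 (s : R) k : 0 <= s -> (0 <= (s ^+ k)%:E :> \bar R)%E.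
Proof. by move=> s0; rewrite lee_fin exprn_ge0. Qed.

(** Negative correlation: by Mecke, weighting with N_k adds a point at k, which can only increase X
    and hence decrease s^X. *)
Let degree_power (s : R) i : 0 <= s <= 1 ->
  (E (fun v => ((weighted_degree g v i)%:R * s ^+ X v)%:E) <=
  (mean_degree g l i)%:E * G s)%E.
Proof.
move=> /andP[s0 s1]; under eq_vector_esum.
  move=> v; rewrite EFinM natr_sum -sumEFin ge0_sume_distrl; last first.
    by move=> k _; rewrite lee_fin.
  over.
rewrite vector_esum_sum//; last by move=> k v; rewrite mule_ge0 ?powE_ge0// lee_fin.
rewrite /mean_degree -sumEFin ge0_sume_distrl; last by move=> k _; rewrite lee_fin.
apply: lee_sum => k _; rewrite (vector_mecke l_ge0 k (fun v => powE_ge0 (X v) s0)).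
apply: lee_wpmul2l; first by rewrite lee_fin.
apply: le_vector_esum => // v; rewrite lee_fin edge_count_incr// exprD.
by rewrite ler_piMr ?exprn_ge0// exprn_ile1.
Qed.

(** G' equals the sum of l_i l_j E[s^(X + Z)]. For a natural number Z one has 1 <= s^Z + Z, hence
    s^X <= s^(X + Z) + Z s^X, and [degree_power] bounds the expectation of the last term. *)
Let derivative_bound (s : R) : 0 <= s <= 1 -> (lam%:E * G s <= G' s + C%:E * G s)%E.
Proof.
move=> s01; have /andP[s0 s1] := s01.
have md0 i : 0 <= mean_degree g l i by rewrite sumr_ge0.
have G0 : (0 <= G s)%E by apply: vector_esum_ge0 => // v; rewrite powE_ge0.
rewrite /edge_mean -sumEFin ge0_sume_distrl; last by move=> p _; rewrite lee_fin.
rewrite /G'; under [in X in (_ <= X + _)%E]eq_vector_esum do rewrite EFinM.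
rewrite edge_mecke//; last by move=> v; rewrite powE_ge0.
rewrite /edge_overlap -sumEFin ge0_sume_distrl; last first.
  by move=> p _; rewrite lee_fin mulr_ge0// addr_ge0.
rewrite -big_split/=; apply: lee_sum => p /andP[_ gp].
rewrite [X in (_ + X * _)%E]EFinM -muleA -ge0_muleDr; last 2 first.
- by apply: vector_esum_ge0 => // v; rewrite powE_ge0.
- by rewrite mule_ge0// lee_fin addr_ge0.
apply: lee_wpmul2l; first by rewrite lee_fin.
apply: (@le_trans _ _ (E (fun v => (s ^+ (X v + Z v p))%:E) +
   (E (fun v => ((weighted_degree g v p.1)%:R * s ^+ X v)%:E) +
    E (fun v => ((weighted_degree g v p.2)%:R * s ^+ X v)%:E)))%E); last first.
  apply: leeD.
    by apply: le_vector_esum => // v; rewrite edge_count_incr2.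
  rewrite EFinD ge0_muleDl ?lee_fin//.
  by apply: leeD; exact: degree_power.
have dX0 i v : (0 <= ((weighted_degree g v i)%:R * s ^+ X v)%:E)%E.
  by rewrite lee_fin mulr_ge0// exprn_ge0.
rewrite -vector_esumD// -vector_esumD//; last 2 first.
- by move=> v; rewrite powE_ge0.
- by move=> v; rewrite adde_ge0.
apply: le_vector_esum => // v; rewrite -!EFinD lee_fin exprD -mulrDl -natrD.
rewrite /Z; move: (_ + _)%N => [|n].
  by rewrite mulr1 mul0r addr0.
rewrite ler_wpDl ?mulr_ge0 ?exprn_ge0//.
by rewrite ler_peMl ?exprn_ge0// ler1n.
Qed.

Let convexity (s h : R) : 0 <= s -> 0 <= h -> (G s + h%:E * G' s <= G (s + h)%R)%E.
Proof.
move=> s0 h0; have X'0 v : (0 <= ((X v)%:R * s ^+ (X v).-1)%:E :> \bar R)%E.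
  by rewrite lee_fin mulr_ge0// exprn_ge0.
rewrite -vector_esumZ// -vector_esumD//; last 2 first.
- by move=> v; rewrite powE_ge0.
- by move=> v; rewrite mule_ge0.
apply: le_vector_esum => // v; rewrite -EFinM -EFinD lee_fin.
elim: (X v) => [|[|n] ih]; first by rewrite mul0r mulr0 addr0.
  by rewrite expr0 mulr1 mulr1.
rewrite exprS [leRHS]exprS.
apply: (@le_trans _ _ ((s + h) * (s ^+ n.+1 + h * (n.+1%:R * s ^+ n.+1.-1)))); last first.
  by rewrite ler_wpM2l// addr_ge0.
rewrite /= -natr1 !exprS -subr_ge0.
rewrite [leRHS](_ : _ = h * h * n.+1%:R * s ^+ n); last by ring.
by rewrite !mulr_ge0// exprn_ge0.
Qed.

(** An Euler scheme replaces the differential inequality: with a = lam - C, convexity and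
    [derivative_bound] give G(s + h) >= (1 + a h) G(s). Then n + 1 steps of length 1/(n + 1) lead
    from G(0) = P(X = 0) to G(1) = 1. For a < 0 the bound exceeds 1. *)
Lemma edge_count_eq0_le :
  (E (fun v => ((X v == 0%N)%:R)%:E) <= (expR (- (lam - C)))%:E)%E.
Proof.
set P0 := E _; have P0E : P0 = G 0.
  by apply: eq_vector_esum => v; rewrite expr0n.
have Gfin (s : R) : 0 <= s <= 1 -> G s \is a fin_num.
  move=> /andP[s0 s1]; rewrite ge0_fin_numE; last first.
    by apply: vector_esum_ge0 => // v; rewrite powE_ge0.
  apply: (@le_lt_trans _ _ (E (fun=> 1%E))); last by rewrite weight_total ltry.
  by apply: le_vector_esum => // v; rewrite lee_fin exprn_ile1.
have [a0|/ltW a0] := lerP 0 (lam - C); last first.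
  apply: (@le_trans _ _ 1%E); last by rewrite lee_fin -expR0 ler_expR oppr_ge0.
  rewrite -weight_total; apply: le_vector_esum => // v.
  by rewrite lee_fin lern1; case: eqP.
have P0fin : P0 \is a fin_num by rewrite P0E Gfin// lexx ler01.
rewrite -(fineK P0fin) lee_fin; apply: le_expRN_of_powers => // n.
have step (s h : R) : 0 <= s -> 0 <= h -> s + h <= 1 ->
    fine (G s) * (1 + (lam - C) * h) <= fine (G (s + h)).
  move=> s0 h0 sh1.
  have s1 : 0 <= s <= 1 by rewrite s0/=; apply: le_trans sh1; rewrite lerDl.
  have sh01 : 0 <= s + h <= 1 by rewrite addr_ge0.
  have := convexity s0 h0; have := derivative_bound s1.
  (* Nothing excludes G' s = +oo beforehand; for h > 0 it would make G (s + h) infinite by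
     convexity, a contradiction. *)
  have [h00|hN0] := eqVneq h 0; first by rewrite h00 mulr0 !addr0 mulr1.
  have {hN0} h0' : 0 < h by rewrite lt_neqAle eq_sym hN0.
  have G's0 : (0 <= G' s)%E.
    by apply: vector_esum_ge0 => // v; rewrite lee_fin mulr_ge0// exprn_ge0.
  move: (fineK (Gfin _ s1)) (fineK (Gfin _ sh01)).
  move: (fine (G s)) (fine (G (s + h))) => x y <- <-.
  case: (G' s) G's0 => [r|_ _|//]; last by rewrite gt0_muley ?lte_fin.
  move=> _; rewrite -!EFinM -!EFinD !lee_fin => H1 H2.
  apply: le_trans H2; rewrite mulrDr mulr1 lerD2l.
  rewrite (_ : x * _ = h * ((lam - C) * x)); last by ring.
  by rewrite ler_wpM2l// mulrBl lerBlDr.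
have iter k : (k <= n.+1)%N ->
    fine P0 * (1 + (lam - C) / n.+1%:R) ^+ k <= fine (G (k%:R / n.+1%:R)).
  elim: k => [|k ih] kn; first by rewrite mulr1 mul0r P0E.
  rewrite exprSr mulrA.
  apply: (@le_trans _ _ (fine (G (k%:R / n.+1%:R)) * (1 + (lam - C) / n.+1%:R))).
    by rewrite ler_wpM2r ?ih ?(ltnW kn)// addr_ge0// divr_ge0.
  have kE : k.+1%:R / n.+1%:R = k%:R / n.+1%:R + n.+1%:R^-1 :> R.
    by rewrite -[k.+1]addn1 natrD mulrDl mul1r.
  rewrite kE step ?divr_ge0 ?invr_ge0// -kE.
  by rewrite ler_pdivrMr ?ltr0n// mul1r ler_nat.
apply: (le_trans (iter n.+1 (leqnn _))).
rewrite divff ?pnatr_eq0// /G; under eq_vector_esum do rewrite expr1n.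
by rewrite weight_total.
Qed.

End edge_void.

(** * The Stein equation of the Poisson law *)

Lemma poisson_prob_weight (R : realType) (L : R) (A : set nat) : 0 < L ->
  poisson_prob L 0 A = (\esum_(k in A) (poisson_weight L k)%:E)%E.
Proof.
by move=> L0; rewrite /poisson_prob L0; apply: eq_esum => k _; rewrite /poisson_pmf L0.
Qed.

Lemma poisson_prob1 (R : realType) (L : R) (n : nat) : 0 <= L ->
  poisson_prob L 0 [set n] = (poisson_weight L n)%:E.
Proof.
rewrite le_eqVlt => /orP[/eqP <-|L0].
  rewrite /poisson_prob ltxx diracE /poisson_weight oppr0 expR0 mulr1 expr0n.
  case: n => [|n]; rewrite /= ?divr1 ?mul0r.
    by rewrite mem_set.
  by rewrite memNset.
rewrite poisson_prob_weight// esum_set1// lee_fin poisson_weight_ge0//.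
exact: ltW.
Qed.

Section stein_solution.
Context {R : realType} (L : R) (L_gt0 : 0 < L) (A : set nat).

Local Notation w := (poisson_weight L).
Let alpha k : R := \sum_(i < k.+1) \1_A i * w i.
Let S k : R := \sum_(i < k.+1) w i.
Let q : R := fine (poisson_prob L 0 A).

Let w_gt0 k : 0 < w k.
Proof. by rewrite !mulr_gt0 ?exprn_gt0 ?expR_gt0 ?invr_gt0 ?ltr0n ?fact_gt0. Qed.

Let w_ge0 k : 0 <= w k. Proof. exact: ltW. Qed.

Let wS k : L * w k = k.+1%:R * w k.+1. Proof. by rewrite poisson_weightS. Qed.

Let SS k : S k.+1 = S k + w k.+1. Proof. by rewrite /S big_ord_recr. Qed.

Let S0 : S 0 = w 0. Proof. by rewrite /S big_ord1. Qed.

Let alphaS k : alpha k.+1 = alpha k + \1_A k.+1 * w k.+1.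
Proof. by rewrite /alpha big_ord_recr. Qed.

Let indic01 k : 0 <= (\1_A k : R) <= 1.
Proof. by rewrite indicE; case: (_ \in _); rewrite lexx ler01. Qed.

Let S_ge0 k : 0 <= S k. Proof. exact: sumr_ge0. Qed.

Let alpha_ge0 k : 0 <= alpha k.
Proof.
by apply: sumr_ge0 => i _; rewrite mulr_ge0//; case/andP: (indic01 i).
Qed.

Let alpha_le k : alpha k <= S k.
Proof.
apply: ler_sum => i _; rewrite -[leRHS]mul1r ler_wpM2r//.
Qed.

Let prob_I (B : set nat) k :
  poisson_prob L 0 (B `&` `I_k.+1) = (\sum_(i < k.+1) \1_B i * w i)%:E.
Proof.
rewrite poisson_prob_weight// esum_mkcondl esum_fset//; last first.
  by move=> i _; case: ifP => //; rewrite lee_fin.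
rewrite -fsbig_ord.
rewrite -sumEFin; apply: eq_bigr => i _.
by rewrite indicE; case: (_ \in _); rewrite ?mul1r ?mul0r.
Qed.

(** Beyond k, the set A has mass at least 0 and at most the whole Poisson tail 1 - S k. *)
Let q_bounds k : alpha k <= q <= alpha k + (1 - S k).
Proof.
have finB B : poisson_prob L 0 B \is a fin_num by exact: fin_num_measure.
have mI (B : set nat) : measurable B by [].
have wE (B C : set nat) : poisson_prob L 0 (B `&` C) + poisson_prob L 0 (B `&` ~` C) =
    poisson_prob L 0 B.
  by rewrite -measureU//= -?setIUr ?setUv ?setIT// setIACA setICr !setI0.
have qE : (q%:E = (alpha k)%:E + poisson_prob L 0 (A `&` ~` `I_k.+1))%E.
  by rewrite -prob_I wE fineK.
have SE : (1 = (S k)%:E + poisson_prob L 0 (~` `I_k.+1))%E.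
  have := wE setT `I_k.+1; rewrite probability_setT => <-.
  rewrite prob_I setTI; congr (_%:E + _)%E.
  by apply: eq_bigr => i _; rewrite indicE in_setT mul1r.
have le_AC : (poisson_prob L 0 (A `&` ~` `I_k.+1) <= poisson_prob L 0 (~` `I_k.+1))%E.
  by apply: le_measure; rewrite ?inE//; exact: subIsetr.
have := fine_ge0 (measure_ge0 (poisson_prob L 0) (A `&` ~` `I_k.+1)).
move: le_AC qE SE.
rewrite -(fineK (finB (A `&` _))) -(fineK (finB (~` _))).
rewrite -!EFinD !lee_fin => le_AC [->] [->] ge0.
by rewrite lerDl ge0/= addrAC subrr add0r lerD2l.
Qed.

(** Termwise: L w_j = (j + 1) w_(j+1) <= (k + 1) w_(j+1) for j <= k. *)
Let overlap_bound k : L * S k <= k.+1%:R * (S k.+1 - w 0).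
Proof.
elim: k => [|k ih]; first by rewrite SS S0 addrAC subrr add0r wS.
rewrite SS mulrDr wS (SS k.+1) addrAC mulrDr lerD2r.
apply: le_trans ih _; rewrite ler_wpM2r ?ler_nat// subr_ge0.
by rewrite /S big_ord_recl lerDl sumr_ge0.
Qed.

Let S_le1 k : S k <= 1.
Proof. by case/andP: (q_bounds k) => h /(le_trans h); rewrite lerDl subr_ge0. Qed.

(** Up to the shift, the Stein solution at k + 1 is alpha_k b_k - (q - alpha_k) a_k. All its
    properties follow from [a] increasing and [b] decreasing. *)
Let a k := S k / (L * w k).
Let b k := (1 - S k) / (L * w k).
Let B := b 0.

Let Lw_gt0 k : 0 < L * w k. Proof. exact: mulr_gt0. Qed.

Let b_ge0 k : 0 <= b k.
Proof. by rewrite divr_ge0 ?subr_ge0 ?S_le1 ?(ltW (Lw_gt0 k)). Qed.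

Let S_cvg1 (e : R) : 0 < e -> exists n, 1 - e <= S n.
Proof.
move=> e0.
have : (\sum_(k <oo) (w k)%:E = 1)%E.
  by rewrite nneseries_esumT// -poisson_prob_weight// probability_setT.
rewrite (cvg_lim _ (ereal_nondecreasing_cvgn _))//; last first.
  by apply: ereal_nondecreasing_series => k _; rewrite lee_fin.
move=> sup1; have := ub_ereal_sup_adherent e0;
    move/(_ (range (fun n => \sum_(0 <= k < n) (w k)%:E)%E)).
rewrite sup1 => /(_ isT) [_ [n _ <-]]; rewrite sumEFin -EFinB lte_fin big_mkord => h.
exists n; apply: (le_trans (ltW h)).
by rewrite /S big_ord_recr/= lerDl.
Qed.

(** The counterpart of [overlap_bound] on the tail: L w_j = (j + 1) w_(j+1) >= (k + 1) w_(j+1) for j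
    > k. It is proved for finite pieces of the tail, whose mass exhausts the tail by [S_cvg1]. *)
Let tail_bound k : k.+1%:R * (1 - S k.+1) <= L * (1 - S k).
Proof.
have part n : k.+1%:R * (S (k + n).+1 - S k.+1) <= L * (S (k + n) - S k).
  elim: n => [|n ih]; first by rewrite addn0 !subrr !mulr0.
  rewrite !addnS [in leLHS]SS [in leRHS]SS ![_ + _ - _]addrAC mulrDr [leRHS]mulrDr.
  rewrite lerD// wS ler_wpM2r// ler_nat; lia.
apply/ler_addgt0Pr => e e0.
have [n Sn] := S_cvg1 (divr_gt0 e0 (ltr0Sn R k)).
have S_nd i j : (i <= j)%N -> S i <= S j.
  by move=> /subnK <-; elim: (j - i)%N => // c ih; rewrite addSn SS ler_wpDr.
have {}Sn : 1 - e / k.+1%:R <= S (k + n).+1.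
  by apply: le_trans Sn (S_nd _ _ _); lia.
apply: (@le_trans _ _ (k.+1%:R * (S (k + n).+1 + e / k.+1%:R - S k.+1))).
  by rewrite ler_wpM2l// lerD2r -lerBlDr.
rewrite [_ + _ - _]addrAC mulrDr lerD//; last by rewrite mulrC divfK// pnatr_eq0.
by apply: le_trans (part n) _; rewrite ler_wpM2l ?(ltW L_gt0)// lerD2r S_le1.
Qed.

Let b_decr k : b k.+1 <= b k.
Proof.
rewrite ler_pdivrMr// mulrAC ler_pdivlMr// -(ler_pM2l (ltr0Sn R k)).
rewrite (_ : _ * (_ * (L * w k)) = (k.+1%:R * (1 - S k.+1)) * (L * w k)); last by ring.
rewrite (_ : _ * (_ * (L * w k.+1)) = (L * (1 - S k)) * (k.+1%:R * w k.+1)); last by ring.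
by rewrite -wS ler_wpM2r ?tail_bound// ltW.
Qed.

Let a_incr k : a k <= a k.+1.
Proof.
rewrite ler_pdivrMr// mulrAC ler_pdivlMr// -(ler_pM2l (ltr0Sn R k)).
rewrite (_ : _ * (_ * (L * w k.+1)) = (L * S k) * (k.+1%:R * w k.+1)); last by ring.
rewrite (_ : _ * (_ * (L * w k)) = (k.+1%:R * S k.+1) * (L * w k)); last by ring.
rewrite -wS ler_wpM2r ?(ltW (Lw_gt0 _))//.
by apply: le_trans (overlap_bound k) _; rewrite ler_wpM2l// gerBl.
Qed.

(* The solution of the Stein equation at [k.+1], shifted by [B]; its value at
   [0] is irrelevant. *)
Let f k : R := if k is k'.+1 then (alpha k' - q * S k') / (L * w k') + B else B.

Let f_eq k : L * f k.+1 = (alpha k - q * S k) / w k + L * B.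
Proof.
by rewrite /= mulrDr; congr (_ + _); field; rewrite !gt_eqF.
Qed.

Lemma stein_eq k : \1_A k + k%:R * f k + B * L = q + B * k%:R + L * f k.+1.
Proof.
rewrite f_eq; case: k => [|k].
  have -> : alpha 0 = \1_A 0%N * w 0 by rewrite /alpha big_ord1.
  by rewrite S0; field; rewrite gt_eqF.
rewrite [k.+1%:R * _](_ : _ = (alpha k - q * S k) / w k.+1 + B * k.+1%:R).
  by rewrite alphaS SS; field; rewrite gt_eqF.
rewrite /= mulrDr [B * _]mulrC; congr (_ + _).
rewrite (_ : w k.+1 = L * w k / k.+1%:R).
  by field; rewrite !gt_eqF//=; rewrite -natr1 in_setT.
by rewrite wS mulrAC divff ?mul1r// pnatr_eq0.
Qed.

(** The inequalities alpha <= S and alpha <= q <= alpha + 1 - S give |alpha - q S| <= 1 - S. Thus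
    the unshifted solution is at most b_k <= b_0 = B in absolute value, which is why B is the
    shift. *)
Let f_bounded k : 0 <= f k <= 2 * B.
Proof.
have B0 : 0 <= B by exact: b_ge0.
have two : 2 * B = B + B by rewrite mulr_natl mulr2n.
case: k => [|k]; first by rewrite /= B0 two lerDr B0.
have bB n : b n <= B by elim: n => // n ih; apply: le_trans ih; exact: b_decr.
have /andP[q1 q2] := q_bounds k.
suff : `|(alpha k - q * S k) / (L * w k)| <= b k.
  move=> /le_trans -/(_ _ (bB k)); rewrite ler_norml /= two lerD2r => /andP[h ->].
  by rewrite andbT -lerBlDr sub0r.
rewrite normrM [X in _ * X]gtr0_norm ?invr_gt0// ler_wpM2r ?invr_ge0 ?(ltW (Lw_gt0 k))//.
have h1 := S_ge0 k; have h2 := S_le1 k; have h3 := alpha_ge0 k; have h4 := alpha_le k.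
rewrite ler_norml; apply/andP; split; nra.
Qed.

(** The right-hand side is the value for A = complement of {k + 1}, the extremal set: there alpha_k
    = S_k, q - alpha_(k+1) = 1 - S_(k+1), and the term carrying the indicator of k + 1, which only
    lowers the difference, vanishes. *)
Let f_increment k : f k.+1 - f k.+2 <= S k * (b k - b k.+1) + (1 - S k.+1) * (a k.+1 - a k).
Proof.
have ab n : (alpha n - q * S n) / (L * w n) = alpha n * b n - (q - alpha n) * a n.
  by rewrite /a /b; field; rewrite !gt_eqF.
have /andP[q1 q2] := q_bounds k.+1.
have /andP[i0 i1] := indic01 k.+1.
rewrite /= opprD addrACA subrr addr0 !ab alphaS.
have := b_decr k; have := a_incr k; rewrite -subr_ge0 => ha; rewrite -subr_ge0 => hb.
have h1 := alpha_le k; have h2 := b_ge0 k.+1.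
have h3 : 0 <= a k by rewrite divr_ge0 ?S_ge0 ?(ltW (Lw_gt0 k)).
move: q2; rewrite alphaS; set I := \1_A k.+1 * w k.+1 => q2.
have I0 : 0 <= I by rewrite mulr_ge0.
rewrite [leLHS](_ : _ = alpha k * (b k - b k.+1) + (q - alpha k - I) * (a k.+1 - a k)
  - I * (b k.+1 + a k)); last by ring.
apply: (@le_trans _ _ (alpha k * (b k - b k.+1) + (q - alpha k - I) * (a k.+1 - a k))).
  by rewrite gerBl mulr_ge0// addr_ge0.
rewrite lerD// ler_wpM2r// -subr_ge0; lra.
Qed.

(** The extremal value of [f_increment] simplifies to (1 - S_(k+1))/L + S_k/(k + 1), which is at
    most (1 - w_0)/L by [overlap_bound]. Since w_0 = exp(-L) >= 1 - L, this is at most both 1 and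
    1/L. *)
Let f_slope k : f k.+1 <= f k.+2 + Num.min 1 L^-1.
Proof.
rewrite -lerBlDl; apply: (le_trans (f_increment k)).
rewrite [leLHS](_ : _ = w k.+1 * (b k.+1 + a k)); last first.
  by rewrite /a /b SS; field; rewrite !gt_eqF.
apply: (@le_trans _ _ ((1 - w 0) / L)).
  rewrite (_ : w k.+1 * _ = (1 - S k.+1) / L + (L * S k) / k.+1%:R / L); last first.
    have wE : L * w k / k.+1%:R = w k.+1 by rewrite wS mulrAC divff ?mul1r// pnatr_eq0.
    have -> : a k = L * S k / k.+1%:R / L / w k.+1.
      by rewrite /a -wE; field; rewrite !gt_eqF//=; rewrite nat1r.
    by rewrite /b; field; rewrite !gt_eqF.
  rewrite -mulrDl ler_wpM2r ?invr_ge0 ?(ltW L_gt0)//.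
  have := overlap_bound k; rewrite -ler_pdivrMl ?ltr0n// [leLHS]mulrC.
  move: (_ / _) => x; lra.
have w0 : w 0 = expR (- L) by rewrite /poisson_weight expr0 fact0 divr1 mul1r.
rewrite le_min ler_pdivrMr// mul1r; apply/andP; split.
  by have := expR_ge1Dx (- L); rewrite w0; lra.
by rewrite -[leRHS]mul1r ler_wpM2r ?invr_ge0 ?(ltW L_gt0)// gerBl.
Qed.

(** In the last clause the formula collapses to f (n + 1) = B - w_0 b_n, increasing because b
    decreases. This permits a Stein bound with slope constant 0, hence a lower bound for the void
    probability without error term. *)
Lemma stein_solution : exists (f : nat -> R) (c c' : R),
  [/\ forall k, 0 <= f k <= c, 0 <= c',
      forall k, \1_A k + k%:R * f k + c' * L =
        fine (poisson_prob L 0 A) + c' * k%:R + L * f k.+1,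
      forall k, f k.+1 <= f k.+2 + Num.min 1 L^-1 &
      A = ~` [set 0%N] -> forall k, f k.+1 <= f k.+2].
Proof.
exists f, (2 * B), B; split; [exact: f_bounded|exact: b_ge0|exact: stein_eq|exact: f_slope|].
move=> A0 k; have alphaE n : alpha n = S n - w 0.
  rewrite /alpha /S !big_ord_recl/= A0 indicE memNset ?mul0r ?add0r; last by apply.
  rewrite [RHS]addrAC subrr add0r; apply: eq_bigr => i _.
  by rewrite indicE mem_set ?mul1r.
have qE : q = 1 - w 0.
  have m0 : measurable [set 0%N] by [].
  have := probability_setC (poisson_prob L 0) m0.
  by rewrite /= poisson_prob1 ?ltW// -EFinB /q A0 => ->.
have fE n : f n.+1 = - w 0 * b n + B.
  by rewrite /= alphaE qE /b; congr (_ + _); field; rewrite !gt_eqF.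
by rewrite !fE lerD2r !mulNr lerN2 ler_wpM2l.
Qed.

End stein_solution.

(** * Approximation of sets of pairs by products of cells *)

Lemma rectangle_induction d1 d2 (T1 : measurableType d1) (T2 : measurableType d2)
    (P : set (T1 * T2) -> Prop) :
  (forall A B, measurable A -> measurable B -> P (A `*` B)) ->
  (forall S, measurable S -> P S -> P (~` S)) ->
  (forall F : (set (T1 * T2))^nat, (forall n, measurable (F n)) ->
    trivIset setT F -> (forall n, P (F n)) -> P (\bigcup_n F n)) ->
  forall S, measurable S -> P S.
Proof.
move=> PX PC PU S; rewrite measurable_prod_measurableType; move: S.
apply: dynkin_induction => //.
- by rewrite measurable_prod_measurableType.
- move=> X Y [X1 mX1 [X2 mX2 <-{X}]] [Y1 mY1 [Y2 mY2 <-{Y}]].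
  exists (X1 `&` Y1); first exact: measurableI.
  by exists (X2 `&` Y2); [exact: measurableI|rewrite setXI].
- by rewrite -setXTT; exact: PX.
- by move=> _ [A mA [B mB <-]]; exact: PX.
Qed.

Section labelling.
Context d (T : measurableType d).

(** A finite measurable partition, encoded by the map from a point to the name of its cell.
    Refinement is pairing of labels, and a union of products of cells is a relation on labels. *)
Definition labelling (L : finType) (c : T -> L) :=
  forall i, measurable (c @^-1` [set i]).

Definition block (L : finType) (c : T -> L) (r : rel L) : set (T * T) :=
  [set p | r (c p.1) (c p.2)].

Lemma labelling_measurable (L : finType) (c : T -> L) (D : set L) :
  labelling c -> measurable (c @^-1` D).
Proof.
move=> mc; rewrite (_ : _ @^-1` _ = \bigcup_(i in D) c @^-1` [set i]).
  by apply: fin_bigcup_measurable.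
by apply/seteqP; split => [x Dx|x [i Di /= cx]]; [exists (c x)|rewrite /= cx].
Qed.

Lemma labelling_comp (L K : finType) (c : T -> L) (f : L -> K) :
  labelling c -> labelling (f \o c).
Proof. by move=> mc i; rewrite comp_preimage; exact: labelling_measurable. Qed.

Lemma labelling_pair (L K : finType) (c : T -> L) (c' : T -> K) :
  labelling c -> labelling c' -> labelling (fun x => (c x, c' x)).
Proof.
move=> mc mc' [i j]; rewrite (_ : _ @^-1` _ =
  c @^-1` [set i] `&` c' @^-1` [set j]); first exact: measurableI.
by apply/seteqP; split => [x [<- <-]|x [/= -> ->]].
Qed.

Lemma blockE (L : finType) (c : T -> L) (r : rel L) : block c r =
  \bigcup_(ij in [set ij | r ij.1 ij.2])
    ((c @^-1` [set ij.1]) `*` (c @^-1` [set ij.2])).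
Proof.
apply/seteqP; split => [p rp|p [[i j] /= rij [ci cj]]].
  by exists (c p.1, c p.2).
by rewrite /block /= ci cj.
Qed.

Lemma measurable_block (L : finType) (c : T -> L) (r : rel L) :
  labelling c -> measurable (block c r).
Proof.
move=> mc; rewrite blockE; apply: fin_bigcup_measurable => // ij _.
exact: measurableX.
Qed.

End labelling.

Section block_approximation.
Context d (T : measurableType d) (R : realType).
Context (mu : {finite_measure set T -> \bar R}).
Local Open Scope ereal_scope.

Definition product_sq : {measure set (T * T) -> \bar R} := (mu \x mu)%E.
Local Notation rho := product_sq.

Lemma product_sqE A B : measurable A -> measurable B -> rho (A `*` B) = mu A * mu B.
Proof. exact: product_measure1E. Qed.

Lemma product_sq_fin A : measurable A -> rho A \is a fin_num.
Proof.
move=> mA; rewrite ge0_fin_numE//.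
apply: (@le_lt_trans _ _ (rho setT)); first by rewrite le_measure ?inE.
rewrite -setXTT product_sqE//.
by rewrite ltey_eq fin_numM ?fin_num_measure.
Qed.

Definition block_approximable (G : set (T * T)) := forall e : R, (0 < e)%R ->
  exists (L : finType) (c : T -> L) (r : rel L),
    labelling c /\ rho (G `+` block c r) < e%:E.

Let measurableY (A B : set (T * T)) : measurable A -> measurable B -> measurable (A `+` B).
Proof. by move=> mA mB; apply: measurableU; exact: measurableD. Qed.

Lemma block_approximableC G : block_approximable G -> block_approximable (~` G).
Proof.
move=> aG e /aG [L [c [r [mc Gc]]]]; exists L, c, (fun i j => ~~ r i j).
split => //; rewrite (_ : _ `+` _ = G `+` block c r)//.
rewrite /block; apply/seteqP; split => p /=; case: (r _ _) => /=;
  by have [Gp|Gp] := pselect (G p); intuition.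
Qed.

Lemma block_approximableU G H : measurable G -> measurable H ->
  block_approximable G -> block_approximable H -> block_approximable (G `|` H).
Proof.
move=> mG mH aG aH e e0.
have e20 : (0 < e / 2)%R by rewrite divr_gt0.
have [L [c [r [mc Gc]]]] := aG _ e20; have [K [b [s [mb Hb]]]] := aH _ e20.
exists (L * K)%type, (fun x => (c x, b x)), (fun i j => r i.1 j.1 || s i.2 j.2).
have mcb := labelling_pair mc mb; split => //.
have m1 := measurableY mG (measurable_block r mc).
have m2 := measurableY mH (measurable_block s mb).
apply: (@le_lt_trans _ _ (rho ((G `+` block c r) `|` (H `+` block b s)))).
  rewrite le_measure ?inE//.
  - by apply: measurableY; [exact: measurableU|exact: measurable_block].
  - exact: measurableU.
  rewrite /block => p /= [[[Gp|Hp] /negP]|[/orP[rp|sp] /not_orP[nG nH]]].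
  - by rewrite negb_or => /andP[/negP ? _]; left; left.
  - by rewrite negb_or => /andP[_ /negP ?]; right; left.
  - by left; right.
  - by right; right.
apply: (le_lt_trans (measureU2 _ _ _)) => //.
by rewrite (splitr e) EFinD lteD.
Qed.

Lemma block_approximable_bigcup (F : (set (T * T))^nat) :
  (forall n, measurable (F n)) -> (forall n, block_approximable (F n)) ->
  block_approximable (\bigcup_n F n).
Proof.
move=> mF aF e e0.
have e20 : (0 < e / 2)%R by rewrite divr_gt0.
pose U n := \big[setU/set0]_(i < n) F i.
have mU n : measurable (U n) by apply: bigsetU_measurable.
have UE : \bigcup_n U n = \bigcup_n F n.
  apply/seteqP; split => [p [n _]|p [n _ Fp]]; first exact: bigsetU_bigcup.
  by exists n.+1 => //; rewrite /U big_ord_recr; right.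
have aU n : block_approximable (U n).
  elim: n => [|n ih]; last first.
    by rewrite /U big_ord_recr; apply: block_approximableU => //; exact: (mU n).
  rewrite /U big_ord0 => x x0; exists unit, (fun=> tt), (fun _ _ => false).
  split; first by case; rewrite preimage_cst mem_set.
  by rewrite set0Y (_ : block _ _ = set0) ?measure0// /block; apply/seteqP; split.
have mbF : measurable (\bigcup_n F n) by exact: bigcup_measurable.
have [n rn] : exists n, rho ((\bigcup_n F n) `\` U n) < (e / 2)%:E.
  have cv : rho ((\bigcup_n F n) `\` U n) @[n --> \oo] -->
      rho (\bigcap_n ((\bigcup_n F n) `\` U n)).
    apply: nonincreasing_cvg_mu => //.
    - by rewrite ltey_eq product_sq_fin//; exact: measurableD.
    - by move=> n; exact: measurableD.
    - by apply: bigcap_measurable => // n _; exact: measurableD.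
    - move=> a b ab; apply/subsetPset; apply: setDS.
      exact: subset_bigsetU.
  move: cv; rewrite (_ : \bigcap_n _ = set0) ?measure0; last first.
    apply/seteqP; split => // p h; have [Fp _] := h 0%N I.
    by move: Fp; rewrite -UE => -[k _ Uk]; have [_] := h k I.
  have e2' : 0 < (e / 2)%:E by rewrite lte_fin.
  move=> /(_ _ (open_ereal_lt' e2')) [N _ /(_ N (leqnn N)) h].
  by exists N.
have [L [c [r [mc Uc]]]] := aU n _ e20; exists L, c, r; split => //.
have m1 := measurableY (mU n) (measurable_block r mc).
have m2 := measurableD mbF (mU n).
apply: (@le_lt_trans _ _ (rho (((\bigcup_n F n) `\` U n) `|` (U n `+` block c r)))).
  rewrite le_measure ?inE//.
  - by apply: measurableY => //; exact: measurable_block.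
  - exact: measurableU.
  move=> p [[Fp nr]|[rp nF]].
    by have [Up|nU] := pselect (U n p); [right; left|left].
  right; right; split => // Up; apply: nF; rewrite -UE; by exists n.
apply: (le_lt_trans (measureU2 _ _ _)) => //.
by rewrite (splitr e) EFinD lteD.
Qed.

(** A rectangle is itself a block for the two membership labels. Complements negate the relation,
    finite unions use the common refinement, and countable unions are cut off by continuity from
    above, the measure being finite. *)
Lemma measurable_block_approximable G : measurable G -> block_approximable G.
Proof.
move: G; apply: rectangle_induction.
- move=> A B mA mB e e0.
  exists (bool * bool)%type, (fun x => (x \in A, x \in B)), (fun i j => i.1 && j.2).
  have mi C : measurable C -> labelling (fun x : T => x \in C).
    move=> mC b; rewrite (_ : _ @^-1` _ = if b then C else ~` C).
      by case: b => //; exact: measurableC.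
    apply/seteqP; split => x /=; case: b => /=.
    - by move/set_mem.
    - by move/negbT; rewrite notin_setE.
    - exact: mem_set.
    - exact: memNset.
  split; first exact: labelling_pair (mi _ mA) (mi _ mB).
  rewrite (_ : block _ _ = A `*` B) ?setYK ?measure0//.
  apply/seteqP; split => -[x y]; rewrite /block /=.
    by case/andP => /set_mem ? /set_mem ?.
  by case=> ? ?; rewrite !mem_set.
- by move=> S mS; exact: block_approximableC.
- by move=> F mF _; exact: block_approximable_bigcup.
Qed.

End block_approximation.

Section symmetric_block_approximation.
Context d (T : measurableType d) (R : realType).
Context (mu : {finite_measure set T -> \bar R}).
Context (sep : nat -> set T).
Hypothesis sep_measurable : forall k, measurable (sep k).
Hypothesis sep_separates : forall x y, (forall k, sep k x <-> sep k y) -> x = y.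
Local Open Scope ereal_scope.
Local Notation rho := (product_sq mu).

(** The cells of a nested sequence of partitions that eventually separates any two points, so that
    their diagonal blocks decrease to the diagonal. *)
Definition sep_label n (x : T) : {ffun 'I_n -> bool} := [ffun k : 'I_n => x \in sep k].

Lemma labelling_sep n : labelling (sep_label n).
Proof.
move=> f; rewrite (_ : _ @^-1` _ =
    \bigcap_(k in [set: 'I_n]) (if f k then sep k else ~` sep k)).
  apply: fin_bigcap_measurable => // k _; case: (f k) => //; exact: measurableC.
apply/seteqP; split => [x /= <- k _|x h].
  rewrite ffunE; case: ifPn; first by move/set_mem.
  by rewrite notin_setE.
apply/ffunP => k; rewrite ffunE; have := h k I; case: (f k) => /= h'.
  exact: mem_set.
exact: memNset.
Qed.

Lemma sep_label_nincr n m x y : (n <= m)%N ->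
  sep_label m x = sep_label m y -> sep_label n x = sep_label n y.
Proof.
move=> nm /ffunP h; apply/ffunP => k; have := h (widen_ord nm k).
by rewrite !ffunE.
Qed.

Lemma sep_label_inj x y : (forall n, sep_label n x = sep_label n y) -> x = y.
Proof.
move=> h; apply: sep_separates => k; have /ffunP /(_ ord_max) := h k.+1.
by rewrite !ffunE /= => e; split => /mem_set; [rewrite e|rewrite -e] => /set_mem.
Qed.

Definition diagonal : set (T * T) := [set p | p.1 = p.2].

Lemma diagonalE : diagonal = \bigcap_n block (sep_label n) eq_op.
Proof.
apply/seteqP; split => [[x y] /= xy n _|[x y] h].
  by rewrite /block /= [x]xy.
by apply: sep_label_inj => n; apply/eqP; exact: h.
Qed.

Lemma measurable_diagonal : measurable diagonal.
Proof.
rewrite diagonalE; apply: bigcap_measurable => // n _.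
by apply: measurable_block; exact: labelling_sep.
Qed.

Lemma measurable_set1_of_sep (x : T) : measurable [set x].
Proof.
rewrite (_ : [set x] = \bigcap_n (sep_label n @^-1` [set sep_label n x])).
  by apply: bigcap_measurable => // n _; exact: labelling_sep.
apply/seteqP; split => [y /= -> n _//|y h]; apply: sep_label_inj => n; exact: h.
Qed.

Hypothesis mu_atomless : forall x, mu [set x] = 0.

Lemma diagonal_null : rho diagonal = 0.
Proof.
rewrite /product_sq /product_measure1 /=; apply: integral0_eq => x _ /=.
rewrite (_ : xsection _ _ = [set x]) ?mu_atomless//.
by apply/seteqP; split => y; rewrite /xsection /= inE /diagonal/=.
Qed.

(** The diagonal is null because [mu] has no atoms; continuity from above transfers this to the
    decreasing diagonal blocks. *)
Lemma diagonal_block_small (e : R) : (0 < e)%R ->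
  exists n, rho (block (sep_label n) eq_op) < e%:E.
Proof.
move=> e0.
have mB n : measurable (block (sep_label n) eq_op).
  by apply: measurable_block; exact: labelling_sep.
have : rho (block (sep_label n) eq_op) @[n --> \oo] --> rho (\bigcap_n block (sep_label n) eq_op).
  apply: nonincreasing_cvg_mu => //.
  - by rewrite ltey_eq product_sq_fin.
  - by apply: bigcap_measurable.
  - move=> n m nm; apply/subsetPset => -[x y] /eqP xy; apply/eqP.
    exact: sep_label_nincr xy.
rewrite -diagonalE diagonal_null => cv.
have e0' : 0 < e%:E by rewrite lte_fin.
have [N _ /(_ N (leqnn N)) h] := cv _ (open_ereal_lt' e0').
by exists N.
Qed.

Lemma product_sq_swap H : measurable H -> rho (swap_pair @^-1` H) = rho H.
Proof.
move: H; suff h : forall H, measurable H ->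
    measurable (swap_pair @^-1` H) /\ rho (swap_pair @^-1` H) = rho H.
  by move=> H /h [].
apply: rectangle_induction.
- move=> A B mA mB.
  rewrite (_ : _ @^-1` _ = B `*` A); last by apply/seteqP; split => -[x y] [? ?].
  by split; [exact: measurableX|rewrite !product_sqE// muleC].
- move=> S mS [mS' ES].
  have -> : swap_pair @^-1` (~` S) = setT `\` (swap_pair @^-1` S) by rewrite setTD.
  split; first exact: measurableD.
  have finT : rho setT < +oo by rewrite ltey_eq product_sq_fin.
  rewrite -(setTD S) (measureD measurableT mS' finT) (measureD measurableT mS finT).
  have ES' : rho (setT `&` swap_pair @^-1` S) = rho (setT `&` S) by rewrite !setTI.
  exact: (congr1 (fun z => rho setT - z) ES').
- move=> F mF tF FE; rewrite preimage_bigcup.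
  have mF' n : measurable (swap_pair @^-1` F n) by case: (FE n).
  split; first exact: bigcup_measurable.
  rewrite !measure_bigcup//; first by apply: eq_eseriesr => n _; case: (FE n).
  apply/trivIsetP => i j _ _ ij; rewrite -preimage_setI.
  by move/trivIsetP : tF => /(_ _ _ I I ij) ->; rewrite preimage_set0.
Qed.

(** Refining an approximating partition by [sep_label] makes the diagonal block small at no cost.
    Symmetrizing the relation and removing its diagonal change the block only inside the error set,
    its mirror image and the diagonal block: three errors of e/4. *)
Lemma symmetric_block_approximation G : measurable G ->
  (forall x y, G (x, y) -> G (y, x)) -> forall e : R, (0 < e)%R ->
  exists m (c : T -> 'I_m) (r : rel 'I_m),
    [/\ labelling c, symmetric r, irreflexive r,
        rho (G `+` block c r) < e%:E & rho (block c eq_op) < e%:E].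
Proof.
move=> mG Gsym e e0.
have e40 : (0 < e / 4)%R by rewrite divr_gt0.
have [L [c [r [mc Gc]]]] := measurable_block_approximable mu mG e40.
have [n bn] := diagonal_block_small e40.
set b := sep_label n in bn.
have mb : labelling b by exact: labelling_sep.
pose c' x := (c x, b x).
pose r' i j := [&& r i.1 j.1, r j.1 i.1 & i != j :> L * {ffun 'I_n -> bool}].
have mc' : labelling c' by exact: labelling_pair.
have mY (A B : set (T * T)) : measurable A -> measurable B -> measurable (A `+` B).
  by move=> mA mB; apply: measurableU; exact: measurableD.
have mbr : measurable (block c r) by exact: measurable_block.
have mbb : measurable (block b eq_op) by exact: measurable_block.
have mS : measurable (swap_pair @^-1` (G `+` block c r)).
  rewrite -[X in measurable X]setTI;
      apply: (measurable_fun_pair measurable_snd measurable_fst) => //; exact: mY.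
exists #|{: L * {ffun 'I_n -> bool}}|, (enum_rank \o c'),
  (fun i j => r' (enum_val i) (enum_val j)).
have bE s : block (enum_rank \o c') (fun i j => s (enum_val i) (enum_val j)) = block c' s.
  by rewrite /block; apply/seteqP; split => p /=; rewrite !enum_rankK.
split.
- exact: labelling_comp.
- by move=> i j; rewrite /r' andbCA eq_sym.
- by move=> i; rewrite /r' eqxx !andbF.
- rewrite bE; apply: (@le_lt_trans _ _ (rho ((G `+` block c r) `|`
      (swap_pair @^-1` (G `+` block c r)) `|` block b eq_op))).
    rewrite le_measure ?inE//.
    + by apply: mY => //; exact: measurable_block.
    + by apply: measurableU => //; apply: measurableU => //; exact: mY.
    (* A pair of G is missed if the relation fails, if its transpose fails (then the swapped pair,
       also in G, is in the error set), or if both points share a cell. *)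
    move=> [x y] [[Gxy nr]|[/and3P[rxy _ _] nG]]; last by left; left; right.
    have [rxy|/negP nrxy] := boolP (r (c x) (c y)); last by left; left; left.
    have [ryx|/negP nryx] := boolP (r (c y) (c x)); last first.
      by left; right; left; split => //; exact: Gsym.
    right; apply/eqP; apply: contrapT => /eqP bxy; apply: nr.
    rewrite /block /r' /= rxy ryx /=; apply/eqP => -[_ /eqP].
    exact/negP.
  have ma := mY _ _ mG mbr.
  apply: (le_lt_trans (measureU2 _ _ _)) => //; first exact: measurableU.
  apply: (@lt_le_trans _ _ ((e / 4 + e / 4)%:E + (e / 4)%:E)).
    rewrite lteD//; apply: (le_lt_trans (measureU2 _ _ _)) => //.
    rewrite EFinD lteD//.
    by rewrite [ltLHS](_ : _ = rho (G `+` block c r))//; exact: product_sq_swap ma.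
  by rewrite -EFinD lee_fin; lra.
- apply: (@le_lt_trans _ _ (rho (block b eq_op))).
    rewrite le_measure ?inE//.
      by apply: measurable_block; exact: labelling_comp.
    by move=> [x y] /eqP /enum_rank_inj [_ bxy]; apply/eqP.
  by apply: (lt_le_trans bn); rewrite lee_fin; lra.
Qed.

End symmetric_block_approximation.

Arguments diagonal {d T}.

(** * Points of a counting measure and measurability of pair counts *)

Section counting_measure_atoms.
Context d (T : measurableType d) (R : realType).
Context (sep : nat -> set T).
Hypothesis sep_measurable : forall k, measurable (sep k).
Hypothesis sep_separates : forall x y, (forall k, sep k x <-> sep k y) -> x = y.

Section one_measure.
Context (m : {measure set T -> \bar R}).
Hypothesis m_counting : forall A, measurable A ->
  m A = +oo%E \/ exists n : nat, m A = n%:R%:E.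
Local Open Scope ereal_scope.

Lemma counting_ge1 A : measurable A -> m A != 0 -> 1 <= m A.
Proof.
move=> mA; case: (m_counting mA) => [->|[[|n] ->]]; rewrite ?leey//.
  by rewrite eqxx.
by move=> _; rewrite lee_fin ler1n.
Qed.

(* The cells of a nested sequence that decides membership in each [sep k] can be
   chosen of positive mass; they shrink to a single point. *)
Lemma counting_atom V : measurable V -> m V < +oo -> m V != 0 ->
  exists2 x, V x & m [set x] != 0.
Proof.
move=> mV Voo V0.
pose step k (E : set T) := if m (E `&` sep k) != 0 then E `&` sep k else E `\` sep k.
pose fix E (k : nat) : set T := if k is k'.+1 then step k' (E k') else V.
have mE k : measurable (E k) /\ m (E k) != 0.
  elim: k => [//|k [mEk Ek0]] /=; rewrite /step; case: ifPn => [h|].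
    by split => //; exact: measurableI.
  rewrite negbK => /eqP h; split; first exact: measurableD.
  apply: contra Ek0 => /eqP h'.
  rewrite -[X in _ == X]adde0 -[X in _ == X + _]h' -[X in _ == _ + X]h.
  exact/eqP/measureDI.
have Enincr n k : (n <= k)%N -> E k `<=` E n.
  elim: k => [|k ih]; first by rewrite leqn0 => /eqP ->.
  rewrite leq_eqVlt => /predU1P[->//|/ih]; apply: subset_trans.
  by rewrite /= /step; case: ifP => _ x [].
have mI : measurable (\bigcap_k E k).
  by apply: bigcap_measurable => // k _; have [] := mE k.
have I1 : 1 <= m (\bigcap_k E k).
  have cv : (m \o E) n @[n --> \oo] --> m (\bigcap_k E k).
    apply: nonincreasing_cvg_mu => //; first by move=> k; have [] := mE k.
    by move=> n k nk; apply/subsetPset; exact: Enincr.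
  apply: (cvge_to_ge cv); apply: nearW => k /=.
  by have [? ?] := mE k; exact: counting_ge1.
have [x Ix] : exists x, (\bigcap_k E k) x.
  apply/set0P; apply/eqP => I0; move: I1; rewrite I0 measure0.
  by rewrite lee_fin ler10.
exists x; first exact: (Ix 0%N I).
rewrite (_ : [set x] = \bigcap_k E k).
  by apply/eqP => I0; move: I1; rewrite I0 lee_fin ler10.
apply/seteqP; split => [_ -> //|y Iy]; apply: sep_separates => k.
have := Iy k.+1 I; have := Ix k.+1 I; rewrite /= /step; case: ifP => _ [_ h1] [_ h2].
  by split.
by split.
Qed.

(** Strong induction on the mass of V: split off one atom with its full multiplicity k + 1, which
    strictly lowers the remaining mass. *)
Lemma counting_measure_seq V : measurable V -> m V < +oo ->
  exists s : seq T, (forall x, x \in s -> V x) /\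
    forall A, measurable A -> m (A `&` V) = (count (fun x => x \in A) s)%:R%:E.
Proof.
move=> mV Voo; case: (m_counting mV) => [V1|[n]]; first by move: Voo; rewrite V1.
elim/ltn_ind: n V mV Voo => n ih V mV Voo Vn.
case: n => [|n] in ih Vn *.
  exists [::]; split => // A mA; apply/eqP; rewrite /= eq_le measure_ge0 andbT.
  by rewrite -Vn le_measure ?inE//; exact: measurableI.
have [x Vx mx0] : exists2 x, V x & m [set x] != 0.
  apply: counting_atom => //; rewrite Vn; apply/eqP => -[] /eqP.
  by rewrite pnatr_eq0.
have m1 : measurable [set x] := measurable_set1_of_sep sep_measurable sep_separates x.
have mD : measurable (V `\` [set x]) by exact: measurableD.
have xV : [set x] `<=` V by move=> _ ->.
have splitV A : measurable A -> m (A `&` V) = m (A `&` [set x]) + m (A `&` (V `\` [set x])).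
  move=> mA; rewrite -measureU//.
  - by rewrite -setIUr setDUK.
  - exact: measurableI.
  - exact: measurableI.
  - by rewrite setIACA setDE [X in _ `&` X]setICA setICr !setI0.
have [k mxk] : exists k : nat, m [set x] = k.+1%:R%:E.
  case: (m_counting m1) => [xoo|[[|k] xk]]; last by exists k.
    suff : m [set x] < +oo by rewrite xoo.
    by apply: le_lt_trans Voo; rewrite le_measure ?inE.
  by move: mx0; rewrite xk eqxx.
have [j mDj] : exists j : nat, m (V `\` [set x]) = j%:R%:E.
  case: (m_counting mD) => [Doo|//].
  suff : m (V `\` [set x]) < +oo by rewrite Doo.
  by apply: le_lt_trans Voo; rewrite le_measure ?inE.
have jn : (j < n.+1)%N.
  have := splitV setT measurableT; rewrite !setTI Vn mxk mDj -EFinD -natrD => -[] /eqP.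
  rewrite eqr_nat => /eqP ->; lia.
have Doo : m (V `\` [set x]) < +oo by rewrite mDj ltry.
have [s [sD sE]] := ih j jn _ mD Doo mDj.
exists (nseq k.+1 x ++ s); split => [y|A mA].
  by rewrite mem_cat => /orP[|/sD []//]; rewrite mem_nseq => /eqP ->.
rewrite splitV// sE// count_cat natrD EFinD; congr (_ + _).
rewrite count_nseq; have [xA|xA] := boolP (x \in A).
  by rewrite mul1n -mxk setIidr// => _ ->; exact: set_mem.
rewrite mul0n (_ : A `&` [set x] = set0) ?measure0//.
apply/seteqP; split => // y [Ay /= yx]; move: xA; rewrite notin_setE; apply.
by rewrite -yx.
Qed.

End one_measure.

(** A list of the points in V with multiplicities. If V has infinite mass no such list exists and
    the default [[::]] is returned, so that counts stay measurable on all of Omega. *)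
Definition atoms (m : {measure set T -> \bar R}) (V : set T) : seq T :=
  xget [::] [set s : seq T | (forall x, x \in s -> V x) /\
    forall A, measurable A -> m (A `&` V) = (count (fun x => x \in A) s)%:R%:E].

(** Counts multiplicities and the diagonal, which makes it a measure in H determined by rectangles;
    measurability and moments are accessible through it. The quantity behind [xi] is
    [distinct_count], which ignores both. *)
Definition pair_count (s : seq T) (H : set (T * T)) : nat :=
  \sum_(x <- s) \sum_(y <- s) ((x, y) \in H).

Definition distinct_count (s : seq T) (G : set (T * T)) : nat :=
  count (fun p => (p.1 != p.2) && (p \in G)) [seq (x, y) | x <- undup s, y <- undup s].

Lemma pair_countX s A B :
  pair_count s (A `*` B) = (count (fun x => x \in A) s * count (fun x => x \in B) s)%N.
Proof.
have countE C : count (fun x => x \in C) s = (\sum_(x <- s) (x \in C))%N.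
  by rewrite -sum1_count big_mkcond; apply: eq_bigr => x _; case: (x \in C).
rewrite !countE big_distrlr /=; apply: eq_bigr => x _; apply: eq_bigr => y _.
by rewrite in_setX mulnb.
Qed.

Lemma pair_countC s H : (pair_count s (~` H) + pair_count s H = pair_count s setT)%N.
Proof.
rewrite /pair_count -big_split/=; apply: eq_bigr => x _.
rewrite -big_split/=; apply: eq_bigr => y _.
by rewrite in_setC in_setT; case: (_ \in H).
Qed.

Lemma pair_count_bigcup s (F : (set (T * T))^nat) :
  (forall n, measurable (F n)) -> trivIset setT F ->
  (pair_count s (\bigcup_n F n))%:R%:E =
  (\sum_(n <oo) (pair_count s (F n))%:R%:E)%E :> \bar R.
Proof.
move=> mF tF; have E H : (pair_count s H)%:R%:E =
    (\sum_(x <- s) \sum_(y <- s) (\1_H (x, y))%:E)%E :> \bar R.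
  rewrite /pair_count natr_sum -sumEFin; apply: eq_bigr => x _.
  by rewrite natr_sum -sumEFin; apply: eq_bigr => y _; rewrite indicE.
rewrite E; under eq_eseriesr do rewrite E.
rewrite nneseries_sum; last by move=> *; apply: sume_ge0 => *; rewrite lee_fin.
apply: eq_bigr => x _; rewrite nneseries_sum; last by move=> *; rewrite lee_fin.
apply: eq_bigr => y _;
have := @measure_bigcup _ R _ (dirac (x, y) : {measure set (T * T) -> \bar R}) setT F
    (fun n _ => mF n) tF.
move=> e; apply: (etrans e); apply: eq_eseriesl => n; exact: in_setT.
Qed.

Lemma atomsP (m : {measure set T -> \bar R}) V :
  (forall A, measurable A -> m A = +oo%E \/ exists n : nat, m A = n%:R%:E) ->
  measurable V -> (m V < +oo)%E -> (forall x, x \in atoms m V -> V x) /\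
    forall A, measurable A -> m (A `&` V) = (count (fun x => x \in A) (atoms m V))%:R%:E.
Proof.
move=> mc mV Voo; rewrite /atoms; case: xgetP => [s _ //|h].
by have [s sP] := counting_measure_seq mc mV Voo; case: (h s).
Qed.

Lemma atoms_infinite (m : {measure set T -> \bar R}) V : m V = +oo%E -> atoms m V = [::].
Proof.
move=> Voo; rewrite /atoms; case: xgetP => // s _ [_ /(_ setT measurableT)].
by rewrite setTI Voo.
Qed.

Lemma mem_atoms (m : {measure set T -> \bar R}) V x :
  (forall A, measurable A -> m A = +oo%E \/ exists n : nat, m A = n%:R%:E) ->
  measurable V -> (m V < +oo)%E -> V x -> (x \in atoms m V) = (0 < m [set x])%E.
Proof.
move=> mc mV Voo Vx; have [_ mE] := atomsP mc mV Voo.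
have m1 : measurable [set x] := measurable_set1_of_sep sep_measurable sep_separates x.
have -> : [set x] = [set x] `&` V by apply/esym/setIidl => _ ->.
rewrite mE// lte_fin ltr0n -has_count.
apply/idP/hasP => [xs|[y ys]]; first by exists x => //; exact: mem_set.
by move=> /set_mem <-.
Qed.

Lemma esum_distinct_pairs (m : {measure set T -> \bar R}) V (G : set (T * T)) :
  (forall A, measurable A -> m A = +oo%E \/ exists n : nat, m A = n%:R%:E) ->
  measurable V -> (m V < +oo)%E -> G `<=` V `*` V ->
  (\esum_(p in distinct_pairs m `&` G) 1 = (distinct_count (atoms m V) G)%:R%:E :> \bar R)%E.
Proof.
move=> mc mV Voo GV; set s := atoms m V.
pose L := [seq p <- [seq (x, y) | x <- undup s, y <- undup s] | (p.1 != p.2) && (p \in G)].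
have -> : distinct_pairs m `&` G = [set` L].
  apply/seteqP; split => [[x y] [[/= mx my xy] Gxy]|[x y] /=].
    have [Vx Vy] := GV _ Gxy.
    rewrite /= mem_filter /= mem_set// andbT; apply/andP; split; first exact/eqP.
    by apply: allpairs_f; rewrite mem_undup mem_atoms.
  rewrite mem_filter /= => /andP[/andP[/eqP xy /set_mem Gxy]] /allpairsP[[a b] /= [ha hb [xa yb]]].
  move: ha hb; rewrite -xa -yb !mem_undup => xs ys.
  have [Vx Vy] := GV _ Gxy.
  by split => //; split => //=; rewrite -(mem_atoms mc mV Voo).
have uL : uniq L.
  apply: filter_uniq; apply: allpairs_uniq; rewrite ?undup_uniq//.
  by move=> [? ?] [? ?].
rewrite esum_fset//.
rewrite -fsbig_seq//= /distinct_count -size_filter -/L.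
  by rewrite -[in RHS]sum1_size natr_sum -sumEFin.
exact: finite_seq.
Qed.

End counting_measure_atoms.

Section counting_kernel.
Context d (T : measurableType d) (R : realType) dO (Omega : measurableType dO).
Context (sep : nat -> set T).
Hypothesis sep_measurable : forall k, measurable (sep k).
Hypothesis sep_separates : forall x y, (forall k, sep k x <-> sep k y) -> x = y.
Context (eta : R.-ker Omega ~> T).
Hypothesis eta_counting : forall w A, measurable A ->
    eta w A = +oo%E \/ exists n : nat, eta w A = n%:R%:E.
Local Open Scope ereal_scope.

Let atomsP' w V := @atomsP _ T R sep sep_measurable sep_separates (eta w) V (eta_counting w).

Lemma measurable_pair_count V H : measurable V -> measurable H ->
  measurable_fun setT (fun w => (pair_count (atoms (eta w) V) H)%:R%:E : \bar R).
Proof.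
move=> mV; have mX A B : measurable A -> measurable B -> measurable_fun setT
    (fun w => (pair_count (atoms (eta w) V) (A `*` B))%:R%:E : \bar R).
  move=> mA mB; rewrite (_ : (fun _ => _) = (fun w => if eta w V < +oo then
      eta w (A `&` V) * eta w (B `&` V) else 0)).
    apply: measurable_fun_ifT => //.
    + apply: measurable_fun_lte => //; exact: measurable_kernel.
    + by apply: emeasurable_funM; apply: measurable_kernel; exact: measurableI.
  apply/funext => w; rewrite pair_countX; case: ifPn => [Voo|].
    have [_ sE] := atomsP' mV Voo; rewrite !sE// -EFinM natrM; congr ((_ * _)%:E).
  by rewrite ltNge negbK leye_eq => /eqP /atoms_infinite ->.
move: H; apply: rectangle_induction => //.
- move=> S mS mfS.
  rewrite (_ : (fun _ => _) = (fun w => (pair_count (atoms (eta w) V) (setT `*` setT))%:R%:E -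
      (pair_count (atoms (eta w) V) S)%:R%:E)); last first.
    apply/funext => w; rewrite setXTT -(pair_countC _ S) natrD EFinD addeK//.
  by apply: emeasurable_funB => //; exact: mX.
- move=> F mF tF mfF.
  under eq_fun do rewrite pair_count_bigcup//.
  rewrite (_ : (fun _ => _) = (fun w => \sum_(n <oo | n \in predT)
      (pair_count (atoms (eta w) V) (F n))%:R%:E)) //.
  exact: ge0_emeasurable_sum.
Qed.

Lemma sep_label_eventually_inj (s : seq T) :
  exists N, forall n, (N <= n)%N -> {in s &, injective (sep_label sep n)}.
Proof.
pose l := [seq (x, y) | x <- s, y <- s].
suff [N NP] : exists N, forall p, p \in l ->
    sep_label sep N p.1 = sep_label sep N p.2 -> p.1 = p.2.
  exists N => n Nn x y xs ys /(sep_label_nincr Nn) /(NP (x, y)); apply.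
  exact: allpairs_f.
elim: l => [|[x y] l [N NP]]; first by exists 0%N.
have [M MP] : exists M, sep_label sep M x = sep_label sep M y -> x = y.
  apply: contrapT => /forallNP h; apply: (h 0%N) => _.
  apply: (sep_label_inj sep_separates) => n; have /not_implyP[] := h n.
  by [].
exists (maxn N M) => p; rewrite inE => /orP[/eqP -> /=|pl].
  by move/(sep_label_nincr (leq_maxr N M)).
by move/(sep_label_nincr (leq_maxl N M)); exact: NP.
Qed.

(** The number of ordered pairs of different cells that carry a pair of points in G, a measurable
    function of [pair_count]s. Once the cells separate the finitely many points it equals
    [distinct_count], which is therefore a pointwise limit of measurable functions. *)
Definition separated_cells n (s : seq T) (G : set (T * T)) : nat :=
  #|[pred ij : {ffun 'I_n -> bool} * {ffun 'I_n -> bool} | (ij.1 != ij.2) &&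
     (0 < pair_count s (G `&` (sep_label sep n @^-1` [set ij.1]) `*`
                               (sep_label sep n @^-1` [set ij.2])))%N]|.

Lemma pair_count_gt0 (s : seq T) (H : set (T * T)) : (0 < pair_count s H)%N =
  has (fun p => p \in H) [seq (x, y) | x <- s, y <- s].
Proof.
rewrite /pair_count lt0n sum_nat_seq_neq0; apply/hasP/hasP.
  move=> [x xs /= ]; rewrite sum_nat_seq_neq0 => /hasP[y ys /=].
  by rewrite eqb0 negbK => xyH; exists (x, y) => //; exact: allpairs_f.
move=> [p /allpairsP[[x y] /= [xs ys ->]] xyH]; exists x => //=.
by rewrite sum_nat_seq_neq0; apply/hasP; exists y; rewrite //= xyH.
Qed.

Lemma separated_cellsE (s : seq T) (G : set (T * T)) n :
  {in s &, injective (sep_label sep n)} ->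
  separated_cells n s G = distinct_count s G.
Proof.
move=> inj; pose K := [seq p <- [seq (x, y) | x <- undup s, y <- undup s] |
   (p.1 != p.2) && (p \in G)].
pose f (p : T * T) := (sep_label sep n p.1, sep_label sep n p.2).
have KP p : (p \in K) = [&& p.1 != p.2, p \in G, p.1 \in s & p.2 \in s].
  rewrite mem_filter -andbA; congr [&& _, _ & _].
  apply/allpairsP/idP => [[[x y] /= [xs ys ->]]|/andP[p1 p2]].
    by move: xs ys; rewrite !mem_undup /= => -> ->.
  by exists p; rewrite !mem_undup; split => //; case: p {p1 p2}.
have injf : {in K &, injective f}.
  move=> [x y] [x' y']; rewrite !KP => /and4P[/= _ _ xs ys] /and4P[/= _ _ xs' ys'].
  by case=> /(inj _ _ xs xs') -> /(inj _ _ ys ys') ->.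
have uK : uniq K.
  apply: filter_uniq; apply: allpairs_uniq; rewrite ?undup_uniq//.
  by move=> [? ?] [? ?].
rewrite /distinct_count -size_filter -/K -(size_map f).
have /card_uniqP <- : uniq (map f K) by rewrite map_inj_in_uniq.
apply: eq_card => -[i j]; rewrite !inE/= pair_count_gt0.
apply/andP/mapP => [[ij /hasP[[x y] /allpairsP[[a b] /= [as_ bs [-> ->]]]]]|].
  rewrite in_setI => /andP[abG]; rewrite inE => -[/= ai bj].
  exists (a, b); last by rewrite /f /= ai bj.
  rewrite KP /= abG as_ bs !andbT; apply: contra ij => /eqP ab.
  by rewrite -ai -bj ab.
move=> [[x y]]; rewrite KP => /and4P[/= xy xyG xs ys] [-> ->]; split.
  by apply: contra xy => /eqP /(inj _ _ xs ys) ->.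
by apply/hasP; exists (x, y); [exact: allpairs_f|rewrite in_setI xyG inE].
Qed.

Lemma measurable_distinct_count V G : measurable V -> measurable G ->
  measurable_fun setT (fun w => (distinct_count (atoms (eta w) V) G)%:R%:E : \bar R).
Proof.
move=> mV mG.
apply: (@emeasurable_fun_cvg _ _ _ _
  (fun n w => (separated_cells n (atoms (eta w) V) G)%:R%:E)).
  move=> n; under eq_fun do rewrite /separated_cells -sum1_card big_mkcond natr_sum -sumEFin.
  apply: emeasurable_sum => -[i j] /=.
  have [ij|ij] := eqVneq i j.
    rewrite (_ : (fun _ => _) = cst 0); first exact: measurable_cst.
    by apply/funext => w; rewrite inE /= ij eqxx.
  rewrite (_ : (fun _ => _) = (fun w => mine 1 (pair_count (atoms (eta w) V)
      (G `&` (sep_label sep n @^-1` [set i]) `*` (sep_label sep n @^-1` [set j])))%:R%:E)).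
    apply: measurable_mine => //; apply: measurable_pair_count => //.
    by apply: measurableI => //; apply: measurableX; exact: labelling_sep.
  apply/funext => w; rewrite inE /= ij /=; case: (pair_count _ _) => [|k] /=.
    by rewrite min_r// lee_fin.
  by rewrite min_l// lee_fin ler1n.
move=> w _; have [N NP] := sep_label_eventually_inj (atoms (eta w) V).
apply: cvg_near_cst; exists N => // n /= Nn; rewrite separated_cellsE//.
exact: NP.
Qed.

(** The squares of the increasing sets V n exhaust the product space. Made disjoint, they split the
    sum into countably many counts, each living on a set of finite mass. *)
Lemma measurable_esum_distinct_pairs (F : (set T)^nat) G :
  (forall n, measurable (F n)) -> \bigcup_n F n = setT ->
  (forall w n, eta w (F n) < +oo) -> measurable G ->
  measurable_fun setT (fun w => \esum_(p in distinct_pairs (eta w) `&` G) (1 : \bar R)).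
Proof.
move=> mF FT Foo mG.
pose V n := \big[setU/set0]_(i < n) F i.
have mV n : measurable (V n) by apply: bigsetU_measurable.
have Voo n w : eta w (V n) < +oo.
  elim: n => [|n ih]; first by rewrite /V big_ord0 measure0.
  rewrite /V big_ord_recr /=; apply: (le_lt_trans (measureU2 _ _ _)) => //; first exact: mV.
  by apply: lte_add_pinfty; [exact: ih|exact: Foo].
pose S := seqD (fun n => V n `*` V n).
have mS n : measurable (S n).
  by rewrite /S; case: n => [|n] /=; [|apply: measurableD]; exact: measurableX.
have ndV : nondecreasing_seq (fun n => V n `*` V n).
  move=> n m nm; apply/subsetPset.
  have h : V n `<=` V m by exact: (@subset_bigsetU _ F).
  by move=> [x y] [/h ? /h ?].
have S_T : \bigcup_n S n = setT.
  rewrite eq_bigcup_seqD; apply/seteqP; split => // -[x y] _.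
  have [n _ Fx] : (\bigcup_n F n) x by rewrite FT.
  have [m _ Fy] : (\bigcup_n F n) y by rewrite FT.
  exists (maxn n m).+1 => //; split; rewrite /V /=.
    by apply: (@bigsetU_sup _ n _ F) Fx; rewrite ltnS leq_maxl.
  by apply: (@bigsetU_sup _ m _ F) Fy; rewrite ltnS leq_maxr.
have SV n : S n `<=` V n `*` V n by rewrite /S; case: n => [|n] //=; exact: subDsetl.
rewrite (_ : (fun _ => _) = (fun w => \sum_(n <oo | n \in predT)
    (distinct_count (atoms (eta w) (V n)) (G `&` S n))%:R%:E)); last first.
  apply/funext => w; rewrite -[in LHS](setIT (_ `&` G)) -S_T -setIA setI_bigcupr setI_bigcupr.
  rewrite nneseries_sum_bigcup//.
    apply: eq_eseriesr => n _.
    rewrite (@esum_distinct_pairs _ _ _ sep _ _ _ (V n))//.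
      exact: eta_counting.
    by move=> p [_ /SV].
  have := trivIset_seqD ndV; rewrite -/S => tS; apply/trivIsetP => i j _ _ ij.
  move/trivIsetP : tS => /(_ _ _ I I ij) Sij; apply/seteqP; split => // p.
  by move=> [[_ [_ Si]] [_ [_ Sj]]]; rewrite -Sij.
apply: ge0_emeasurable_sum => //.
by move=> n _; apply: measurable_distinct_count => //; exact: measurableI.
Qed.

End counting_kernel.

(** * Joint law of the Poisson counts in the cells *)

Section discrete_law.
Context dO (Omega : measurableType dO) (R : realType) (P : probability Omega R).
Context (I : countType) (ev : I -> set Omega).
Hypothesis ev_measurable : forall v, measurable (ev v).
Hypothesis ev_disjoint : trivIset setT ev.
Hypothesis ev_cover : P (\bigcup_v ev v) = 1%E.
Local Open Scope ereal_scope.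

Lemma integral_countable_law (f : Omega -> \bar R) (F : I -> \bar R) :
  measurable_fun setT f -> (forall w, 0 <= f w) ->
  (forall v w, ev v w -> f w = F v) ->
  \int[P]_w f w = \esum_(v in setT) (P (ev v) * F v).
Proof.
move=> mf f0 fF.
(* Enumerate the countable index type by its codes; integers that are no code receive the empty
   event. *)
pose E n := if @pickle_inv I n is Some v then ev v else set0.
have mE n : measurable (E n) by rewrite /E; case: pickle_inv.
have EU : \bigcup_n E n = \bigcup_v ev v.
  apply/seteqP; split => [w [n _]|w [v _ evw]].
    by rewrite /E; case: pickle_inv => // v evw; exists v.
  by exists (pickle v) => //; rewrite /E pickleK_inv.
have tE : trivIset setT E.
  apply/trivIsetP => i j _ _ ij; rewrite /E.
  case vi : pickle_inv => [v|]; last by rewrite set0I.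
  case uj : pickle_inv => [u|]; last by rewrite setI0.
  move/trivIsetP : ev_disjoint; apply => //; apply: contra ij => /eqP vu.
  have := @pickle_invK I i; have := @pickle_invK I j.
  by rewrite vi uj vu /= => -> /eqP; rewrite eq_sym.
have mU : measurable (\bigcup_n E n) by exact: bigcup_measurable.
have null : P (~` (\bigcup_n E n)) = 0.
  by rewrite probability_setC// EU ev_cover subee.
have -> : \int[P]_w f w = \int[P]_(w in \bigcup_n E n) f w.
  rewrite -[in LHS](setUv (\bigcup_n E n)) ge0_integral_setU//.
  - rewrite [X in _ + X]null_set_integral ?adde0//.
    + exact: measurableC.
    + exact: measurable_funTS.
  - exact: measurableC.
  - by rewrite setUv.
  - exact/disj_setPCl.
rewrite ge0_integral_bigcup//; last exact: measurable_funTS.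
have EE n : \int[P]_(w in E n) f w = if @pickle_inv I n is Some v then P (ev v) * F v else 0.
  rewrite /E; case: pickle_inv => [v|]; last by rewrite integral_set0.
  rewrite (eq_integral (cst (F v))); last by move=> w /set_mem; exact: fF.
  have [->|/set0P[w evw]] := eqVneq (ev v) set0.
    by rewrite integral_set0 measure0 mul0e.
  by rewrite integral_cst// muleC.
rewrite (eq_eseriesr (fun n _ => EE n)).
have PF0 v : 0 <= P (ev v) * F v.
  have [->|/set0P[w evw]] := eqVneq (ev v) set0; first by rewrite measure0 mul0e.
  by rewrite mule_ge0// -(fF v w).
rewrite nneseries_esumT; last by move=> n; case: pickle_inv.
rewrite (esumID ((@pickle I) @` setT)); last by move=> n _; case: pickle_inv.
rewrite setTI [X in _ + X]esum1 ?adde0.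
  rewrite esum_image; last by move=> u v _ _; exact: (pcan_inj pickleK).
  by apply: eq_esum => v _; rewrite pickleK_inv.
move=> n [_ /= nP]; have := @pickle_invK I n; case: pickle_inv => //= v vn.
by exfalso; apply: nP; exists v.
Qed.

End discrete_law.

Section block_sums.
Context d (T : measurableType d) (R : realType).
Context (mu : {finite_measure set T -> \bar R}) (m : nat) (c : T -> 'I_m).
Hypothesis mc : labelling c.
Local Notation rho := (product_sq mu).

Definition cell_mass i : R := fine (mu (c @^-1` [set i])).

Lemma cell_mass_ge0 i : 0 <= cell_mass i. Proof. exact: fine_ge0. Qed.

Lemma cell_massE i : mu (c @^-1` [set i]) = (cell_mass i)%:E.
Proof. by rewrite fineK// fin_num_measure. Qed.

Lemma block_mass (r : rel 'I_m) : rho (block c r) =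
  (\sum_(p | r p.1 p.2) cell_mass p.1 * cell_mass p.2)%:E.
Proof.
pose D := [pred p : 'I_m * 'I_m | r p.1 p.2].
rewrite blockE (_ : [set _ | _] = [set` enum D]); last first.
  by apply/seteqP; split => p /=; rewrite mem_enum inE.
rewrite measure_fin_bigcup//.
- rewrite -fsbig_seq ?enum_uniq//= big_enum_cond/= -sumEFin.
  apply: eq_big => [p|p _]; first by rewrite andbT.
  transitivity (mu (c @^-1` [set p.1]) * mu (c @^-1` [set p.2]))%E.
    exact: product_measure1E.
  by rewrite !cell_massE.
- apply/trivIsetP => -[i j] [i' j'] _ _ /= neq; apply/seteqP; split => // -[x y].
  by move=> [[/= -> ->] [/= i'E j'E]]; move: neq; rewrite i'E j'E eqxx.
- by move=> p _; exact: measurableX.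
Qed.

Lemma preimage_mass (D : pred 'I_m) :
  mu [set x | D (c x)] = (\sum_(i | D i) cell_mass i)%:E.
Proof.
rewrite (_ : [set x | _] = \bigcup_(i in [set` enum D]) (c @^-1` [set i])); last first.
  apply/seteqP; split => [x Dx|x [i /=]]; first by exists (c x); rewrite //= mem_enum.
  by rewrite mem_enum => Di ->.
rewrite measure_fin_bigcup//.
- rewrite -fsbig_seq ?enum_uniq//= big_enum_cond/= -sumEFin.
  by apply: eq_big => [i|i _]; rewrite ?andbT// cell_massE.
- apply/trivIsetP => i j _ _ /= neq; apply/seteqP; split => // x.
  by move=> [/= -> ji]; move: neq; rewrite ji eqxx.
Qed.

Lemma pair_count_block (s : seq T) (r : rel 'I_m) : pair_count s (block c r) =
  (\sum_(p | r p.1 p.2) count (fun x => c x == p.1) s * count (fun x => c x == p.2) s)%N.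
Proof.
have countE i : count (fun x => c x == i) s = (\sum_(x <- s) (c x == i))%N.
  by rewrite -sum1_count big_mkcond; apply: eq_bigr => x _; case: (c x == i).
under [RHS]eq_bigr do rewrite !countE big_distrlr/=.
rewrite exchange_big /pair_count; apply: eq_bigr => x _.
rewrite exchange_big/=; apply: eq_bigr => y _.
rewrite big_mkcond (bigD1 (c x, c y))//= big1 ?addn0; last first.
  move=> [i j] /= h; case: ifP => // _; move: h; rewrite xpair_eqE negb_and.
  by rewrite (eq_sym i) (eq_sym j) => /orP[/negbTE ->|/negbTE ->]; rewrite ?muln0.
by rewrite !eqxx muln1; case: ifPn => h; [rewrite mem_set|rewrite memNset//; apply/negP].
Qed.

End block_sums.

Section poisson_cells.
Context d (T : measurableType d) (R : realType) dO (Omega : measurableType dO).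
Context (sep : nat -> set T).
Hypothesis sep_measurable : forall k, measurable (sep k).
Hypothesis sep_separates : forall x y, (forall k, sep k x <-> sep k y) -> x = y.
Context (P : probability Omega R) (mu0 : {measure set T -> \bar R}) (eta : R.-ker Omega ~> T).
Hypothesis eta_poisson : poisson_process P mu0 eta.
Context (V : set T) (mV : measurable V) (Voo : (mu0 V < +oo)%E).
Context (mu : {finite_measure set T -> \bar R}).
Hypothesis muE : forall A, measurable A -> mu A = mu0 (A `&` V).

Let eta_counting w A : measurable A ->
  eta w A = +oo%E \/ exists n : nat, eta w A = n%:R%:E.
Proof.
by move=> mA; apply: (point_process_counting (poisson_process_point_process eta_poisson)).
Qed.

Lemma poisson_process_cell A n : measurable A ->
  P [set w | eta w (A `&` V) = n%:R%:E] = (poisson_weight (fine (mu A)) n)%:E.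
Proof.
move=> mA; have mAV : measurable (A `&` V) by exact: measurableI.
rewrite (poisson_process_fin eta_poisson)//; last first.
  by apply: le_lt_trans Voo; rewrite le_measure ?inE//; exact: subIsetr.
by rewrite -muE// poisson_prob1// fine_ge0.
Qed.

Lemma measurable_eta_eq A (x : \bar R) : measurable A ->
  measurable [set w | eta w A = x].
Proof.
move=> mA; rewrite -[X in measurable X]setTI.
by apply: (measurable_kernel eta A mA measurableT [set x]); exact: emeasurable_set1.
Qed.

Lemma measurable_eta_fin A : measurable A -> measurable [set w | (eta w A < +oo)%E].
Proof.
move=> mA; rewrite (_ : [set _ | _] = ~` [set w | eta w A = +oo%E]).
  by apply: measurableC; exact: measurable_eta_eq.
apply/seteqP; split => w /=; first by rewrite ltey => /eqP.
by rewrite ltey => /eqP.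
Qed.

(** The definition prescribes only the probabilities of finite counts; these sum to 1, so an
    infinite count has probability 0. *)
Lemma poisson_process_cell_fin A : measurable A ->
  P [set w | (eta w (A `&` V) < +oo)%E] = 1%E.
Proof.
move=> mA; have mAV : measurable (A `&` V) by exact: measurableI.
rewrite (_ : [set _ | _] = \bigcup_n [set w | eta w (A `&` V) = n%:R%:E]); last first.
  apply/seteqP; split => [w /= woo|w [n _ /= ->]]; last exact: ltry.
  case: (eta_counting w mAV) => [wE|[n wn]]; last by exists n.
  by move: woo; rewrite wE.
rewrite measure_bigcup//=; last 2 first.
- by move=> n _; exact: measurable_eta_eq.
- apply/trivIsetP => i j _ _ ij; apply/seteqP; split => // w [/= -> [] /eqP].
  by rewrite eqr_nat (negbTE ij).
rewrite (eq_eseriesr (fun n _ => poisson_process_cell n mA)).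
have r0 : 0 <= fine (mu A) by exact: fine_ge0.
rewrite (eq_eseriesr (fun n _ => esym (poisson_prob1 n r0))).
rewrite -(measure_bigcup (poisson_prob (fine (mu A)) 0%N :
    {measure set nat -> \bar R}) setT (fun n => [set n]))//.
- have := @probability_setT _ _ _ (poisson_prob (fine (mu A)) 0%N).
  by congr (poisson_prob _ _ _ = _); apply/seteqP; split => // n _; exists n.
- apply/trivIsetP => i j _ _ ij; apply/seteqP; split => // n [/= -> ji].
  by move: ij; rewrite ji eqxx.
Qed.

Section cells.
Context (m : nat) (c : T -> 'I_m) (mc : labelling c).
Local Notation l := (cell_mass mu c).

Definition cell_event (v : {ffun 'I_m -> nat}) : set Omega :=
  [set w | forall i, eta w (c @^-1` [set i] `&` V) = (v i)%:R%:E].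

Let mcell i : measurable (c @^-1` [set i] `&` V).
Proof. exact: measurableI. Qed.

Lemma cell_eventE v : cell_event v =
  \bigcap_(i in [set: 'I_m]) ((fun w => eta w (c @^-1` [set i] `&` V)) @^-1` [set (v i)%:R%:E]).
Proof. by apply/seteqP; split => w h i; [move=> _; exact: h|exact: h]. Qed.

Lemma measurable_cell_event v : measurable (cell_event v).
Proof.
by rewrite cell_eventE; apply: fin_bigcap_measurable => // i _; exact: measurable_eta_eq.
Qed.

Lemma trivIset_cell_event : trivIset setT cell_event.
Proof.
apply/trivIsetP => v u _ _ vu; apply/seteqP; split => // w [hv hu].
move: vu => /eqP; apply; apply/ffunP => i; have := hv i; rewrite (hu i) => -[] /eqP.
by rewrite eqr_nat => /eqP.
Qed.

Lemma cell_event_prob v : P (cell_event v) = (vector_weight l v)%:E.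
Proof.
rewrite cell_eventE.
have indep := poisson_process_indep eta_poisson mcell.
rewrite indep.
- rewrite /vector_weight -prodEFin; apply: eq_bigr => i _.
  exact: (poisson_process_cell (v i) (mc i)).
- apply/trivIsetP => i j _ _ ij; apply/seteqP; split => // x [[/= -> _] [/= ji _]].
  by move: ij; rewrite ji eqxx.
- by move=> i; exact: emeasurable_set1.
Qed.

Lemma cell_event_eta_fin w v : cell_event v w -> (eta w V < +oo)%E.
Proof.
move=> h; rewrite (_ : V = \bigcup_(i in [set: 'I_m]) (c @^-1` [set i] `&` V)).
  rewrite measure_fin_bigcup//.
  - rewrite fsbig_finite//=; apply: lte_sum_pinfty => i _; by rewrite h ltry.
  - exact: finite_finset.
  - apply/trivIsetP => i j _ _ ij; apply/seteqP; split => // x [[/= -> _] [/= ji _]].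
    by move: ij; rewrite ji eqxx.
apply/seteqP; split => [x Vx|x [i _ []//]].
by exists (c x).
Qed.

Lemma cell_event_cover : P (\bigcup_v cell_event v) = 1%E.
Proof.
rewrite -(poisson_process_cell_fin measurableT) setTI; congr (P _).
apply/seteqP; split => [w [v _ /cell_event_eta_fin]//|w /= Vw].
have /choice[v hv] : forall i, exists n : nat, eta w (c @^-1` [set i] `&` V) = n%:R%:E.
  move=> i; case: (eta_counting w (mcell i)) => // wE.
  suff : (eta w (c @^-1` [set i] `&` V) < +oo)%E by rewrite wE.
  by apply: le_lt_trans Vw; rewrite le_measure ?inE//; exact: subIsetr.
by exists [ffun i => v i] => // i; rewrite ffunE.
Qed.

Lemma cell_event_count w v i : cell_event v w ->
  count (fun x => c x == i) (atoms (eta w) V) = v i.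
Proof.
move=> h; have [_ sE] := atomsP sep_measurable sep_separates (@eta_counting w) mV
    (cell_event_eta_fin h).
have := h i; rewrite sE// => -[] /eqP; rewrite eqr_nat => /eqP <-.
apply: eq_count => x /=; apply/eqP/idP => [cx|/set_mem //].
by apply/mem_set.
Qed.

(** The normalization is read off from the cell events, which are disjoint and cover Omega almost
    surely, instead of multiplying exponential series. *)
Lemma vector_weight_total : vector_esum l (fun=> 1%E) = 1%E.
Proof.
have := @integral_countable_law _ _ _ P _ _ measurable_cell_event trivIset_cell_event
  cell_event_cover (cst 1%E) (cst 1%E) (measurable_cst _) (fun=> lee01) (fun _ _ _ => erefl).
rewrite (_ : (\int[P]_w _)%E = 1%E); last first.
  by rewrite integral_cst// mul1e; exact: probability_setT.
move=> e; apply: (etrans _ (esym e)).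
by apply: eq_esum => v _; rewrite cell_event_prob.
Qed.

Lemma integral_cells (f : Omega -> \bar R) (F : {ffun 'I_m -> nat} -> \bar R) :
  measurable_fun setT f -> (forall w, 0 <= f w)%E ->
  (forall v w, cell_event v w -> f w = F v) ->
  (\int[P]_w f w = vector_esum l F)%E.
Proof.
move=> mf f0 fF.
rewrite (@integral_countable_law _ _ _ P _ _ measurable_cell_event trivIset_cell_event
  cell_event_cover f F mf f0 fF).
by apply: eq_esum => v _; rewrite cell_event_prob.
Qed.

(** Mecke gives E[N_i N_j] = l_i l_j for i <> j and E[N_i^2] = l_i^2 + l_i; the extra l_i are the
    pairs formed by a point with itself. *)
Lemma integral_pair_count_block (r : rel 'I_m) :
  (\int[P]_w (pair_count (atoms (eta w) V) (block c r))%:R%:E =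
   product_sq mu (block c r) + mu [set x | block c r (x, x)])%E.
Proof.
rewrite (@integral_cells _ (fun v => (\sum_(p | r p.1 p.2) v p.1 * v p.2)%N%:R%:E)).
- under eq_vector_esum do rewrite natr_sum -sumEFin.
  rewrite vector_esum_sum//; last by move=> i; exact: cell_mass_ge0.
  rewrite block_mass// (preimage_mass mu mc (fun i => r i i)) -EFinD.
  have l0 : forall i, 0 <= l i by exact: cell_mass_ge0.
  transitivity (\sum_(p | r p.1 p.2) (l p.1 * l p.2 + (p.1 == p.2)%:R * l p.1)%:E)%E.
    apply: eq_bigr => -[i j] /= _; have [<-|ij] := eqVneq i j.
      under eq_vector_esum do rewrite natrM EFinM.
      rewrite (vector_mecke l0 i (F := fun v => (v i)%:R%:E))//.
      under eq_vector_esum do rewrite vector_incrE -natr1 EFinD.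
      rewrite vector_esumD// (vector_esum_coord l0 vector_weight_total).
      by rewrite vector_weight_total -EFinD -EFinM mulrDr mulr1 mul1r.
    under eq_vector_esum do rewrite -[X in X%:E]mulr1 EFinM.
    rewrite (vector_mecke2 l0 (F := fun=> 1%E))// vector_weight_total mule1.
    by rewrite mul0r addr0.
  rewrite sumEFin; congr EFin; rewrite big_split/=; congr (_ + _).
  rewrite big_mkcond -(pair_bigA _ (fun i j => if r i j then (i == j)%:R * l i else 0)).
  rewrite [RHS]big_mkcond; apply: eq_bigr => i _ /=.
  rewrite (bigD1 i)//= eqxx mul1r big1 ?addr0// => j ji.
  by rewrite eq_sym (negbTE ji) mul0r; case: ifP.
- apply: (measurable_pair_count sep_measurable sep_separates (@eta_counting)) => //.
  exact: measurable_block.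
- by move=> w; rewrite lee_fin.
- move=> v w vw; rewrite pair_count_block; congr (_%:R%:E).
  by apply: eq_bigr => p _; rewrite !(cell_event_count _ vw).
Qed.

End cells.

End poisson_cells.

(** * Expected number of pairs in a measurable set *)

Section pair_moment.
Context d (T : measurableType d) (R : realType) dO (Omega : measurableType dO).
Context (sep : nat -> set T).
Hypothesis sep_measurable : forall k, measurable (sep k).
Hypothesis sep_separates : forall x y, (forall k, sep k x <-> sep k y) -> x = y.
Context (P : probability Omega R) (mu0 : {measure set T -> \bar R}) (eta : R.-ker Omega ~> T).
Hypothesis eta_poisson : poisson_process P mu0 eta.
Context (V : set T) (mV : measurable V) (Voo : (mu0 V < +oo)%E).
Context (mu : {finite_measure set T -> \bar R}).
Hypothesis muE : forall A, measurable A -> mu A = mu0 (A `&` V).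
Local Open Scope ereal_scope.
Local Notation rho := (product_sq mu).

Let eta_counting w A : measurable A ->
  eta w A = +oo%E \/ exists n : nat, eta w A = n%:R%:E.
Proof.
by move=> mA; apply: (point_process_counting (poisson_process_point_process eta_poisson)).
Qed.

Let diag (H : set (T * T)) : set T := [set x | H (x, x)].

Let measurable_diag H : measurable H -> measurable (diag H).
Proof.
move=> mH; rewrite -[X in measurable X]setTI.
have mid : measurable_fun setT (fun x : T => (x, x)) by exact: measurable_fun_pair.
exact: mid.
Qed.

Let mpc H : measurable H ->
  measurable_fun setT (fun w => (pair_count (atoms (eta w) V) H)%:R%:E : \bar R).
Proof. exact: (measurable_pair_count sep_measurable sep_separates eta_counting mV). Qed.

(** Both sides are measures in H. A rectangle is a block for the four cells cut out by its two
    sides, and [rectangle_induction] does the rest. *)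
Lemma integral_pair_count H : measurable H ->
  \int[P]_w (pair_count (atoms (eta w) V) H)%:R%:E = rho H + mu (diag H).
Proof.
have moment_rect A B : measurable A -> measurable B ->
    \int[P]_w (pair_count (atoms (eta w) V) (A `*` B))%:R%:E =
    rho (A `*` B) + mu (diag (A `*` B)).
  move=> mA mB.
  pose c0 (x : T) := (x \in A, x \in B).
  have mi C : measurable C -> labelling (fun x : T => x \in C).
    move=> mC b; rewrite (_ : _ @^-1` _ = if b then C else ~` C).
      by case: b => //; exact: measurableC.
    apply/seteqP; split => x /=; case: b => /=.
    - by move/set_mem.
    - by move/negbT; rewrite notin_setE.
    - exact: mem_set.
    - exact: memNset.
  have mc : labelling (enum_rank \o c0).
    by apply: labelling_comp; exact: labelling_pair (mi _ mA) (mi _ mB).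
  have -> : A `*` B = block (enum_rank \o c0) (fun i j => (enum_val i).1 && (enum_val j).2).
    rewrite /block; apply/seteqP; split => -[x y] /=; rewrite !enum_rankK /=.
      by case=> ? ?; rewrite !mem_set.
    by case/andP => /set_mem ? /set_mem ?.
  exact: (integral_pair_count_block sep_measurable sep_separates eta_poisson mV Voo muE mc).
move: H; apply: rectangle_induction => //.
- move=> S mS ES.
  have fin1 : rho S + mu (diag S) \is a fin_num.
    by rewrite fin_numD product_sq_fin//= fin_num_measure//; exact: measurable_diag.
  have tot : \int[P]_w (pair_count (atoms (eta w) V) (~` S))%:R%:E + (rho S + mu (diag S)) =
      rho (~` S) + mu (diag (~` S)) + (rho S + mu (diag S)).
    rewrite -[in LHS]ES -ge0_integralD//.
    + under eq_integral do rewrite -EFinD -natrD pair_countC -setXTT.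
      rewrite moment_rect// addeACA; congr (_ + _).
        by rewrite -measureU ?setXTT ?setvU ?setICl//; exact: measurableC.
      rewrite -measureU ?setICl//.
      * congr (mu _); apply/seteqP; split => x // _.
        by have [] := pselect (S (x, x)); [right|left].
      * by apply: measurable_diag; exact: measurableC.
      * exact: measurable_diag.
    + by apply: mpc; exact: measurableC.
    + exact: mpc.
  have := congr1 (fun z => z - (rho S + mu (diag S))) tot.
  by rewrite !addeK.
- move=> F mF tF EF.
  under eq_integral do rewrite pair_count_bigcup//.
  rewrite integral_nneseries//; last by move=> n; exact: mpc.
  rewrite (eq_eseriesr (fun n _ => EF n)).
  rewrite nneseriesD//; congr (_ + _).
    have := @measure_bigcup _ R _ rho setT F (fun n _ => mF n) tF.
    by move=> ->; apply: eq_eseriesl => n; rewrite in_setT.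
  rewrite (_ : diag (\bigcup_n F n) = \bigcup_n diag (F n)); last first.
    by apply/seteqP; split => x /=.
  rewrite measure_bigcup//; first by apply: eq_eseriesl => n; rewrite in_setT.
    by move=> n _; exact: measurable_diag.
  apply/trivIsetP => i j _ _ ij; apply/seteqP; split => // x [Fi Fj].
  by move/trivIsetP : tF => /(_ _ _ I I ij) E0; have : set0 (x, x) by rewrite -E0.
Qed.

(** Markov's inequality; off the diagonal the second term of the expectation vanishes. This controls
    the pairs on which G and its block approximation differ. *)
Lemma pair_count_prob_le H : measurable H -> H `&` diagonal = set0 ->
  P [set w | (0 < pair_count (atoms (eta w) V) H)%N] <= rho H.
Proof.
move=> mH Hd; have mE : measurable [set w | (0 < pair_count (atoms (eta w) V) H)%N].
  rewrite (_ : [set _ | _] = [set w | (0 : \bar R) < (pair_count (atoms (eta w) V) H)%:R%:E]).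
    rewrite -[X in measurable X]setTI.
    apply: emeasurable_fun_o_infty => //; exact: mpc.
  by apply/seteqP; split => w /=; rewrite lte_fin ltr0n.
rewrite -[leRHS]adde0 -[X in _ <= _ + X](_ : mu (diag H) = 0); last first.
  rewrite (_ : diag H = set0) ?measure0//; apply/seteqP; split => // x Hx.
  by have : set0 (x, x) by rewrite -Hd.
rewrite -integral_pair_count// -[X in P X]setIT -integral_indic//.
apply: ge0_le_integral => //.
- by apply: measurableT_comp => //; exact: measurable_indic.
- exact: mpc.
- move=> w _; rewrite lee_fin indicE; have [/set_mem /= h|_] := boolP (w \in _).
    by rewrite ler1n.
  by rewrite ler0n.
Qed.

End pair_moment.

(** * Errors of the block approximation *)

Section symmetric_sums.
Context (m : nat) (r : rel 'I_m).
Hypotheses (r_sym : symmetric r) (r_irr : irreflexive r).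

Lemma symmetric_sum (W : nmodType) (F : 'I_m * 'I_m -> W) :
  (forall i j, F (i, j) = F (j, i)) ->
  \sum_(p | r p.1 p.2) F p = (\sum_(p | is_edge r p) F p) *+ 2.
Proof.
move=> FC; rewrite (bigID (fun p : 'I_m * 'I_m => (p.1 < p.2)%N))/= mulr2n; congr (_ + _).
  by apply: eq_bigl => p; rewrite /is_edge andbC.
rewrite (reindex_inj (h := @swap_pair 'I_m 'I_m)); last first.
  by move=> [? ?] [? ?] [-> ->].
apply: eq_big => [[i j]|[i j] _]; last exact: FC.
rewrite /is_edge /= r_sym; have [ij|ij|/val_inj ->] := ltngtP i j; rewrite ?andbT ?andbF//.
Qed.

(** With at most one point per cell the list has no repetition and pairs of points correspond to
    pairs of occupied cells. The doubling arises because [distinct_count] sees ordered pairs. *)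
Lemma distinct_count_edges d (T : measurableType d) (s : seq T) (c : T -> 'I_m)
    (G : set (T * T)) (v : {ffun 'I_m -> nat}) :
  (forall i, count (fun x => c x == i) s = v i) -> (forall i, v i <= 1)%N ->
  pair_count s ((G `+` block c r) `\` diagonal) = 0%N ->
  distinct_count s G = (edge_count r v).*2.
Proof.
move=> cv v1 H0.
have us : uniq s.
  apply: count_mem_uniq => x; rewrite -has_pred1 has_count.
  have : (count_mem x s <= 1)%N.
    apply: leq_trans (v1 (c x)); rewrite -cv; apply: sub_count => y /eqP ->.
    by rewrite /= eqxx.
  by case: (count_mem x s) => [|[]].
transitivity (\sum_(p | r p.1 p.2) v p.1 * v p.2)%N; last first.
  rewrite -addnn; apply: (symmetric_sum (F := fun p => v p.1 * v p.2)%N) => i j.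
  by rewrite /= mulnC.
transitivity (pair_count s (block c r)); last first.
  by rewrite pair_count_block; apply: eq_bigr => p _; rewrite !cv.
rewrite /distinct_count undup_id// -sum1_count big_mkcond/= big_allpairs.
rewrite /pair_count; apply: eq_big_seq => x xs; apply: eq_big_seq => y ys /=.
have nH : (x, y) \notin (G `+` block c r) `\` diagonal.
  have := pair_count_gt0 s ((G `+` block c r) `\` diagonal); rewrite H0 => /esym /negbT /hasPn.
  by apply; exact: allpairs_f.
move: nH; rewrite notin_setE => nH; have [xy|xy] := eqVneq x y.
  suff /negbTE -> : (x, y) \notin block c r by [].
  by rewrite notin_setE /block xy /= r_irr.
have [Gxy|Gxy] := pselect (G (x, y)); have [Bxy|Bxy] := pselect (block c r (x, y)).
- by rewrite !mem_set.
- by case: nH; split; [left|exact/eqP].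
- by case: nH; split; [right|exact/eqP].
- by rewrite !memNset.
Qed.

End symmetric_sums.

Section block_error.
Context d (T : measurableType d) (R : realType).
Context (mu : {finite_measure set T -> \bar R}) (m : nat) (c : T -> 'I_m).
Hypothesis mc : labelling c.
Context (r : rel 'I_m).
Hypotheses (r_sym : symmetric r) (r_irr : irreflexive r).
Context (G : set (T * T)) (mG : measurable G).
Context (D : R) (D_ge0 : 0 <= D).
Hypothesis G_section : forall x, (mu (xsection G x) <= D%:E)%E.
Context (e : R).
Local Notation rho := (product_sq mu).
Local Notation l := (cell_mass mu c).
Local Notation Delta := (G `+` block c r).
Hypotheses (G_block : (rho Delta < e%:E)%E) (diag_block : (rho (block c eq_op) < e%:E)%E).

Let mB : measurable (block c r). Proof. exact: measurable_block. Qed.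

Let mD : measurable Delta.
Proof. by apply: measurableU; exact: measurableD. Qed.

Let l0 i : 0 <= l i. Proof. exact: cell_mass_ge0. Qed.

Lemma sum_cell_mass_sq : \sum_i l i ^+ 2 <= e.
Proof.
move: diag_block; rewrite (block_mass mu mc) lte_fin => /ltW; apply: le_trans.
rewrite -(pair_big_dep xpredT (fun i j => i == j) (fun i j => l i * l j))/=.
rewrite le_eqVlt; apply/orP; left; apply/eqP/eq_bigr => i _.
by rewrite (big_pred1 i) ?expr2// => j; rewrite eq_sym.
Qed.

Lemma block_mean : rho (block c r) = (edge_mean r l *+ 2)%:E.
Proof.
rewrite (block_mass mu mc); congr EFin.
by apply: (symmetric_sum r_sym r_irr (F := fun p => l p.1 * l p.2)) => i j; rewrite mulrC.
Qed.

Lemma edge_mean_error : `|edge_mean r l - fine (rho G) / 2| <= e.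
Proof.
have le_of (A B C : set (T * T)) : measurable A -> measurable B -> measurable C ->
    A `<=` B `|` C -> (rho A <= rho B + rho C)%E.
  move=> mA mB' mC ABC; apply: le_trans (measureU2 _ _ _) => //.
  by rewrite le_measure ?inE//; exact: measurableU.
have h1 : (rho G <= rho (block c r) + rho Delta)%E.
  apply: le_of => // p Gp; have [?|?] := pselect (block c r p); [by left|].
  by right; left.
have h2 : (rho (block c r) <= rho G + rho Delta)%E.
  apply: le_of => // p Gp; have [?|?] := pselect (G p); [by left|].
  by right; right.
move: h1 h2 G_block (measure_ge0 rho Delta); rewrite block_mean.
rewrite -(fineK (product_sq_fin mu mD)) -(fineK (product_sq_fin mu mG)).
rewrite -!EFinD !lee_fin lte_fin mulr2n => h1 h2 h3 h4.
by rewrite ler_norml; apply/andP; split; lra.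
Qed.

Lemma row_mass i : (l i * mean_degree r l i)%:E =
  rho (block c r `&` ((c @^-1` [set i]) `*` setT)).
Proof.
rewrite (_ : _ `&` _ = block c (fun a b => (a == i) && r a b)).
  rewrite (block_mass mu mc) /mean_degree mulr_sumr; congr EFin.
  rewrite -(pair_big_dep xpredT (fun a b => (a == i) && r a b) (fun a b => l a * l b))/=.
  rewrite [RHS](bigD1 i)//= [X in _ = _ + X]big1 ?addr0.
    by apply: eq_bigl => j; rewrite eqxx.
  by move=> a /negbTE ai; apply: big_pred0 => b; rewrite ai.
apply/seteqP; split => -[x y]; rewrite /block /=.
  by move=> [rxy [<- _]]; rewrite eqxx.
by move=> /andP[/eqP -> ->].
Qed.

Lemma row_section i : (rho (G `&` ((c @^-1` [set i]) `*` setT)) <= (D * l i)%:E)%E.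
Proof.
have mi : measurable (c @^-1` [set i]) by exact: mc.
have -> : (D * l i)%:E = (\int[mu]_x (D%:E * (\1_(c @^-1` [set i]) x)%:E))%E.
  rewrite ge0_integralZl//.
  - by rewrite integral_indic// setIT EFinM; congr (_ * _)%E; exact/esym/cell_massE.
  - by apply: measurableT_comp => //; exact: measurable_indic.
rewrite /product_sq /product_measure1.
apply: ge0_le_integral => //.
- apply: measurable_fun_xsection.
  by apply: measurableI => //; exact: measurableX.
- by apply: measurable_funeM; apply: measurableT_comp => //; exact: measurable_indic.
- move=> x _ /=; rewrite indicE; have [/set_mem xi|xi] := boolP (x \in _).
    rewrite mule1; apply: le_trans (G_section x); rewrite le_measure ?inE//.
    + by apply: measurable_xsection; apply: measurableI => //; exact: measurableX.
    + exact: measurable_xsection.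
    + by move=> y; rewrite /xsection /= !inE => -[].
  rewrite mule0 (_ : xsection _ x = set0) ?measure0//.
  apply/seteqP; split => // y; rewrite /xsection /= inE => -[_ [/= cx _]].
  by move: xi; rewrite notin_setE; apply.
Qed.

Lemma row_error_sum : \sum_i fine (rho (Delta `&` ((c @^-1` [set i]) `*` setT))) <= e.
Proof.
have mi i : measurable (Delta `&` ((c @^-1` [set i]) `*` setT)).
  by apply: measurableI => //; exact: measurableX.
rewrite -lee_fin -sumEFin.
under eq_bigr do rewrite fineK ?product_sq_fin//.
apply: le_trans (ltW G_block).
rewrite [leRHS](_ : _ = rho (\bigcup_(i in [set` enum 'I_m])
    (Delta `&` ((c @^-1` [set i]) `*` setT)))).
  rewrite measure_fin_bigcup//.
  - by rewrite -fsbig_seq ?enum_uniq//= big_enum.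
  - apply/trivIsetP => i j _ _ ij; apply/seteqP; split => // -[x y] [[_ [/= -> _]] [_ [/= ji _]]].
    by move: ij; rewrite ji eqxx.
congr (rho _); apply/seteqP; split => [[x y] Dxy|p [i _ []//]].
by exists (c x) => //=; rewrite mem_enum.
Qed.

Lemma mean_degree_le i : mean_degree r l i <= fine (mu setT).
Proof.
rewrite -lee_fin fineK ?fin_num_measure// /mean_degree.
rewrite -(preimage_mass mu mc (r i)) le_measure ?inE//.
exact: (labelling_measurable (fun j => r i j) mc).
Qed.

(** Over ordered pairs both endpoints contribute equally, and summing l_j over the neighbours j of i
    produces the second factor of the mean degree. *)
Lemma edge_overlapE : edge_overlap r l = \sum_i l i * mean_degree r l i ^+ 2.
Proof.
pose F (p : 'I_m * 'I_m) := l p.1 * l p.2 * (mean_degree r l p.1 + mean_degree r l p.2).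
have h : \sum_(p | r p.1 p.2) F p = edge_overlap r l *+ 2.
  apply: (symmetric_sum r_sym r_irr (F := F)) => i j.
  by rewrite /F /= (mulrC (l i)) addrC.
have rowE i : \sum_(j | r i j) l i * l j * mean_degree r l i = l i * mean_degree r l i ^+ 2.
  by rewrite -mulr_suml -mulr_sumr -/(mean_degree r l i) expr2 mulrA.
apply: (@mulIf _ 2) => //; rewrite mulr_natr -h mulr_natr mulr2n.
rewrite /F; under eq_bigr do rewrite mulrDr; rewrite big_split/=; congr (_ + _).
  rewrite -(pair_big_dep xpredT (fun i j => r i j) (fun i j => l i * l j * mean_degree r l i))/=.
  by apply: eq_bigr => i _; rewrite rowE.
rewrite -(pair_big_dep xpredT (fun i j => r i j) (fun i j => l i * l j * mean_degree r l j))/=.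
rewrite (exchange_big_dep xpredT)//=; apply: eq_bigr => j _; rewrite -rowE.
by apply: eq_big => [i|i _]; [rewrite r_sym|rewrite (mulrC (l i))].
Qed.

(** A single mean degree need not be close to a section of G, only weighted averages are. So l_i
    deg_i, the mass of a row of the block, is compared with D l_i plus the error in that row;
    multiplying by the remaining deg_i, at most the total mass, and summing, the row errors add up
    to at most e. *)
Lemma edge_overlap_le :
  edge_overlap r l <= D * fine (rho G) + (D + fine (mu setT)) * e.
Proof.
pose err i := fine (rho (Delta `&` ((c @^-1` [set i]) `*` setT))).
have mR (A : set (T * T)) i : measurable A -> measurable (A `&` ((c @^-1` [set i]) `*` setT)).
  by move=> mA; apply: measurableI => //; exact: measurableX.
have row i : l i * mean_degree r l i <= D * l i + err i.
  rewrite -lee_fin row_mass EFinD /err fineK ?product_sq_fin//; last exact: mR.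
  apply: (le_trans _ (leeD2r _ (row_section i))).
  apply: (le_trans _ (measureU2 _ _ _)); [|exact: mR|exact: mR].
  rewrite le_measure ?inE//; first exact: mR.
    by apply: measurableU; exact: mR.
  move=> p [rp Vp]; have [Gp|nG] := pselect (G p); first by left.
  by right; split => //; right.
have deg0 i : 0 <= mean_degree r l i by rewrite sumr_ge0.
rewrite edge_overlapE.
apply: (@le_trans _ _ (\sum_i (D * l i + err i) * mean_degree r l i)).
  by apply: ler_sum => i _; rewrite expr2 mulrA ler_wpM2r.
have M0 : 0 <= fine (mu setT) by exact: fine_ge0.
apply: (@le_trans _ _ (D * (\sum_i l i * mean_degree r l i) + (\sum_i err i) * fine (mu setT))).
  rewrite mulr_sumr mulr_suml -big_split/=; apply: ler_sum => i _.
  rewrite mulrDl -mulrA lerD2l ler_wpM2l ?mean_degree_le//.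
  exact: fine_ge0.
have tot : \sum_i l i * mean_degree r l i = edge_mean r l *+ 2.
  apply: EFin_inj; rewrite -block_mean (block_mass mu mc); congr EFin.
  rewrite -(pair_big_dep xpredT (fun i j => r i j) (fun i j => l i * l j))/=.
  by apply: eq_bigr => i _; rewrite mulr_sumr.
have tot' : edge_mean r l *+ 2 <= fine (rho G) + e.
  rewrite -lee_fin -block_mean EFinD fineK ?product_sq_fin//.
  apply: (le_trans _ (leeD2l _ (ltW G_block))).
  apply: (le_trans _ (measureU2 _ _ _)) => //.
  rewrite le_measure ?inE//; first exact: measurableU.
  by move=> p Bp; have [?|?] := pselect (G p); [left|right; right].
rewrite tot mulrDl addrA lerD//.
  by rewrite -mulrDr ler_wpM2l.
by rewrite mulrC ler_wpM2l// row_error_sum.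
Qed.

End block_error.

Lemma measurable_nat_event (R : realType) dO (Omega : measurableType dO)
    (f : Omega -> nat) : measurable_fun setT (fun w => (f w)%:R%:E : \bar R) ->
  forall A : set nat, measurable [set w | A (f w)].
Proof.
move=> mf A.
rewrite (_ : [set _ | _] = \bigcup_(n in A) [set w | (f w)%:R%:E = n%:R%:E :> \bar R]).
  apply: bigcup_measurable => n _; rewrite -[X in measurable X]setTI.
  by apply: (mf measurableT [set n%:R%:E]); exact: emeasurable_set1.
apply/seteqP; split => [w Aw|w [n An /= [/eqP]]]; first by exists (f w).
by rewrite eqr_nat => /eqP ->.
Qed.

(** * Poisson approximation for pairs of points, in the limit of fine partitions *)

Section poisson_pairs.
Context d (T : measurableType d) (R : realType) dO (Omega : measurableType dO).
Context (sep : nat -> set T).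
Hypothesis sep_measurable : forall k, measurable (sep k).
Hypothesis sep_separates : forall x y, (forall k, sep k x <-> sep k y) -> x = y.
Context (P : probability Omega R) (mu0 : {measure set T -> \bar R}) (eta : R.-ker Omega ~> T).
Hypothesis eta_poisson : poisson_process P mu0 eta.
Context (V : set T) (mV : measurable V) (Voo : (mu0 V < +oo)%E).
Context (mu : {finite_measure set T -> \bar R}).
Hypothesis muE : forall A, measurable A -> mu A = mu0 (A `&` V).
Hypothesis mu_atomless : forall x, mu [set x] = 0%E.
Context (G : set (T * T)) (mG : measurable G) (G_sym : forall x y, G (x, y) -> G (y, x)).
Context (D : R) (D_ge0 : 0 <= D).
Hypothesis G_section : forall x, (mu (xsection G x) <= D%:E)%E.
Local Notation rho := (product_sq mu).

Let eta_counting w A : measurable A ->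
  eta w A = +oo%E \/ exists n : nat, eta w A = n%:R%:E.
Proof.
by move=> mA; apply: (point_process_counting (poisson_process_point_process eta_poisson)).
Qed.

Let N w := distinct_count (atoms (eta w) V) G.

Let measurable_N (A : set nat) : measurable [set w | A (N w)].
Proof.
by apply: (@measurable_nat_event R); exact: measurable_distinct_count.
Qed.

Let measurable_npc H : measurable H ->
  forall A : set nat, measurable [set w | A (pair_count (atoms (eta w) V) H)].
Proof. by move=> mH; apply: (@measurable_nat_event R); exact: measurable_pair_count. Qed.

Let edge_mean0 : fine (rho G) = 0 -> P [set w | (0 < N w)%N] = 0%E.
Proof.
move=> G0; have mGd : measurable (G `\` diagonal).
  by apply: measurableD => //; exact: (measurable_diagonal sep_measurable sep_separates).
apply/eqP; rewrite -measure_le0.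
have -> : 0%E = rho G by rewrite -(fineK (product_sq_fin mu mG)) G0.
apply: (@le_trans _ _ (rho (G `\` diagonal))); last first.
  by rewrite le_measure ?inE//; exact: subDsetl.
apply: le_trans (pair_count_prob_le sep_measurable sep_separates eta_poisson mV Voo muE mGd _);
    last first.
  by apply/seteqP; split => // p [[]].
rewrite le_measure ?inE//.
- exact: (measurable_N (fun n => 0 < n)%N).
- exact: (measurable_npc mGd (fun n => 0 < n)%N).
move=> w /=; rewrite /N /distinct_count -has_count pair_count_gt0 => /hasP[p].
move=> /allpairsP[[x y] /= [xs ys ->]] /andP[/= xy xyG]; apply/hasP; exists (x, y).
  by apply: allpairs_f; rewrite -mem_undup.
by rewrite inE; split; [exact: set_mem|exact/eqP].
Qed.

Section comparison.
Context (m : nat) (c : T -> 'I_m) (mc : labelling c) (r : rel 'I_m).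
Hypotheses (r_sym : symmetric r) (r_irr : irreflexive r).
Context (e : R).
Local Notation l := (cell_mass mu c).
Local Notation Delta := (G `+` block c r).
Hypotheses (G_block : (rho Delta < e%:E)%E) (diag_block : (rho (block c eq_op) < e%:E)%E).

Let l0 : forall i, 0 <= l i. Proof. by move=> i; exact: cell_mass_ge0. Qed.

Let wtotal : vector_esum l (fun=> 1%E) = 1%E.
Proof. exact: (vector_weight_total eta_poisson mV Voo muE mc). Qed.

Lemma measurable_cell_events (S : set {ffun 'I_m -> nat}) :
  measurable (\bigcup_(v in S) cell_event eta V c v).
Proof.
rewrite bigcup_mkcond; apply: countable_bigcupT_measurable; first exact: countableP.
by move=> v; case: ifP => // _; exact: measurable_cell_event.
Qed.

Lemma cell_events_prob (S : set {ffun 'I_m -> nat}) :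
  P (\bigcup_(v in S) cell_event eta V c v) = vector_esum l (fun v => (\1_S v)%:E).
Proof.
have mU := measurable_cell_events S.
rewrite -[X in P X]setIT -integral_indic//.
apply: (integral_cells eta_poisson mV Voo muE mc).
- by apply: measurableT_comp => //; exact: measurable_indic.
- by move=> w; rewrite lee_fin.
- move=> v w vw; rewrite !indicE; congr (_%:R%:E).
  have [vS|vS] := pselect (S v).
    by rewrite !mem_set//; exists v.
  rewrite !memNset// => -[u uS uw]; apply: vS; suff -> : v = u by [].
  apply: contrapT => /eqP vu; have /trivIsetP := @trivIset_cell_event _ _ _ _ _ eta V _ c.
  by move=> /(_ _ _ I I vu) E0; have : set0 w by rewrite -E0.
Qed.

(** The indicator of v_i >= 2 is at most v_i (v_i - 1), with mean l_i^2; the sum of these is the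
    mass of the diagonal block. *)
Lemma multiple_points_prob :
  (vector_esum l (fun v =>
      (\1_[set v : {ffun 'I_m -> nat} | exists i, (1 < v i)%N] v)%:E) <= e%:E)%E.
Proof.
apply: le_trans (_ : (\sum_i l i ^+ 2)%:E <= _)%E; last first.
  by rewrite lee_fin; exact: (sum_cell_mass_sq mc diag_block).
rewrite -sumEFin.
have -> : (\sum_i (l i ^+ 2)%:E)%E =
    vector_esum l (fun v => \sum_i ((v i)%:R%:E * (v i).-1%:R%:E)%E).
  rewrite vector_esum_sum//; apply: eq_bigr => i _.
  rewrite (vector_mecke l0 i (F := fun v => (v i).-1%:R%:E))//.
  under eq_vector_esum do rewrite vector_incrE /=.
  by rewrite (vector_esum_coord l0 wtotal) -EFinM expr2.
apply: le_vector_esum => // v; rewrite indicE.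
have [/set_mem [i vi]|_] := boolP (v \in _); last first.
  by apply: sume_ge0 => i _; rewrite mule_ge0.
rewrite (bigD1 i)//= -[leLHS]adde0 leeD//; last by apply: sume_ge0 => j _; rewrite mule_ge0.
by rewrite -EFinM lee_fin -natrM ler1n; case: (v i) vi => [|[]].
Qed.

(** Half the number of ordered pairs equals the edge count unless some cell holds two points or some
    pair of distinct points lies in the error set; each exception has probability at most e. *)
Lemma pairs_compare (A : set nat) :
  (P [set w | A (N w)./2] <=
   vector_esum l (fun v => (\1_A (edge_count r v))%:E) + (e *+ 2)%:E)%E.
Proof.
pose S := [set v : {ffun 'I_m -> nat} | A (edge_count r v)].
pose B := [set v : {ffun 'I_m -> nat} | exists i, (1 < v i)%N].
pose H := Delta `\` diagonal.
have mB : measurable (block c r) by exact: measurable_block.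
have mDelta : measurable Delta by apply: measurableU; exact: measurableD.
have mH : measurable H.
  by apply: measurableD => //; exact: (measurable_diagonal sep_measurable sep_separates).
pose U := \bigcup_v cell_event eta V c v.
have mU : measurable U.
  exact: (measurable_cell_events setT).
have mE : measurable [set w | A (N w)./2] by exact: (measurable_N (fun n => A n./2)).
pose EH := [set w | (0 < pair_count (atoms (eta w) V) H)%N].
have mEH : measurable EH by exact: (measurable_npc mH (fun n => 0 < n)%N).
have U1 : P (~` U) = 0%E.
  rewrite probability_setC// (cell_event_cover eta_poisson mV Voo muE mc) subee//.
have PEH : (P EH <= e%:E)%E.
  apply: (le_trans (pair_count_prob_le sep_measurable sep_separates eta_poisson mV Voo muE mH _)).
    by apply/seteqP; split => // p [[]].
  apply: le_trans (ltW G_block).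
  by rewrite le_measure ?inE//; exact: subDsetl.
pose US := \bigcup_(v in S) cell_event eta V c v.
pose UB := \bigcup_(v in B) cell_event eta V c v.
have mUS : measurable US by exact: measurable_cell_events.
have mUB : measurable UB by exact: measurable_cell_events.
have sub : [set w | A (N w)./2] `<=` ((US `|` UB) `|` EH) `|` ~` U.
  move=> w AN; have [[v _ vw]|?] := pselect (U w); last by right.
  left; have [H0|Hgt] := posnP (pair_count (atoms (eta w) V) H); last by right.
  left; have [Bv|Bv] := pselect (B v); first by right; exists v.
  left; exists v => //; rewrite /S /=.
  suff NE : N w = (edge_count r v).*2 by move: AN; rewrite /= NE doubleK.
  apply: (distinct_count_edges r_sym r_irr) H0.
    by move=> i; exact: (cell_event_count sep_measurable sep_separates eta_poisson mV).
  by move=> i; rewrite leqNgt; apply/negP => vi; apply: Bv; exists i.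
apply: (@le_trans _ _ (P (((US `|` UB) `|` EH) `|` ~` U))).
  rewrite le_measure ?inE//.
  by do 3?[apply: measurableU => //]; exact: measurableC.
apply: (le_trans (measureU2 _ _ _)) => //; [by do 2?[apply: measurableU => //]|exact: measurableC|].
rewrite [X in (_ + X)%E]U1 adde0.
apply: (le_trans (measureU2 _ _ _)) => //; first exact: measurableU.
rewrite mulr2n EFinD addeA leeD//.
apply: (le_trans (measureU2 _ _ _)) => //.
apply: leeD.
  have -> : vector_esum l (fun v => (\1_A (edge_count r v))%:E) = P US.
    by rewrite cell_events_prob.
  exact: lexx.
apply: le_trans multiple_points_prob; rewrite -cell_events_prob; exact: lexx.
Qed.

End comparison.

Let L := fine (rho G) / 2.

Let L_ge0 : 0 <= L. Proof. by rewrite divr_ge0// fine_ge0. Qed.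

Let rhoE : fine (rho G) = 2 * L. Proof. by rewrite /L mulrCA divff ?mulr1. Qed.

Let M := fine (mu setT).

Let M_ge0 : 0 <= M. Proof. exact: fine_ge0. Qed.

Let prob_fin (A : set nat) : P [set w | A (N w)./2] \is a fin_num.
Proof. by rewrite fin_num_measure//; exact: (measurable_N (fun n => A n./2)). Qed.

Let approx (n : nat) := symmetric_block_approximation sep_measurable sep_separates mu_atomless
  mG G_sym (divr_gt0 ltr01 (ltr0Sn R n)).

Lemma pairs_stein (A : set nat) (f : nat -> R) (q c c' kappa : R) :
  (forall k, 0 <= f k <= c) -> 0 <= c' -> 0 <= kappa -> 0 <= q ->
  (forall k, \1_A k + k%:R * f k + c' * L = q + c' * k%:R + L * f k.+1) ->
  (forall k, f k.+1 <= f k.+2 + kappa) ->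
  (P [set w | A (N w)./2] <= (q + kappa * (2 * D * L))%:E)%E.
Proof.
move=> fc c'0 kappa0 q0 fS fs; rewrite -(fineK (prob_fin A)) lee_fin.
have c0 : 0 <= c by case/andP: (fc 0%N); exact: le_trans.
(* With cell error e = 1/(n + 1), the three summands come from the overlap, from the error in the
   mean and from the comparison of the counts. None depends on the partition. *)
apply: (@ler_harmonic _ _ _ (kappa * (D + M) + (c + c') + 2)) => n.
have [m [a [r [ma rs ri Gr dr]]]] := approx n; set e := 1 / n.+1%:R in Gr dr.
have l0 i : 0 <= cell_mass mu a i by exact: cell_mass_ge0.
have wt := vector_weight_total eta_poisson mV Voo muE ma.
rewrite -lee_fin fineK ?prob_fin//.
apply: (le_trans (pairs_compare ma rs ri Gr dr A)).
have st := edge_count_stein rs ri l0 wt fc c'0 kappa0 L_ge0 q0 fS fs.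
apply: (le_trans (leeD2r _ st)); rewrite -EFinD lee_fin.
have h1 := edge_overlap_le ma rs ri mG D_ge0 G_section Gr.
have h2 := edge_mean_error ma rs ri mG Gr.
rewrite -/L in h2; rewrite rhoE -/M in h1.
have -> : (kappa * (D + M) + (c + c') + 2) / n.+1%:R = kappa * (D + M) * e + (c + c') * e + 2 * e.
  by rewrite /e; ring.
have h3 : kappa * edge_overlap r (cell_mass mu a) <= kappa * (D * (2 * L) + (D + M) * e).
  by rewrite ler_wpM2l.
have h4 : (c + c') * `|edge_mean r (cell_mass mu a) - L| <= (c + c') * e.
  by rewrite ler_wpM2l// addr_ge0.
rewrite mulr2n; lra.
Qed.

Lemma pairs_void_le : (P [set w | (N w)./2 = 0%N] <= (expR (- L + 2 * D * L))%:E)%E.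
Proof.
rewrite -(fineK (prob_fin [set 0%N])) lee_fin.
(* The exponent is off by at most K e: e from the mean and (D + M) e from the overlap. *)
pose K := 1 + D + M.
have K0 : 0 <= K by rewrite /K !addr_ge0.
apply: (@ler_harmonic _ _ _ (expR (- L + 2 * D * L) * (K * expR K) + 2)) => n.
have [m [a [r [ma rs ri Gr dr]]]] := approx n; set e := 1 / n.+1%:R in Gr dr.
have e0 : 0 <= e by rewrite /e divr_ge0.
have e1 : e <= 1 by rewrite /e ler_pdivrMr ?ltr0n// mul1r ler1n.
have l0 i : 0 <= cell_mass mu a i by exact: cell_mass_ge0.
have wt := vector_weight_total eta_poisson mV Voo muE ma.
rewrite -lee_fin fineK ?prob_fin//.
apply: (le_trans (pairs_compare ma rs ri Gr dr [set 0%N])).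
have vd := edge_count_eq0_le rs ri l0 wt.
apply: (@le_trans _ _ ((expR (- (edge_mean r (cell_mass mu a) - edge_overlap r
    (cell_mass mu a))))%:E + (e *+ 2)%:E)%E).
  rewrite leeD2r//; apply: le_trans vd; apply: le_vector_esum => // v.
  rewrite indicE lee_fin ler_nat; have [->|h] := eqVneq; first exact: leq_b1.
  by rewrite memNset//; apply/eqP.
rewrite -EFinD lee_fin.
have h1 := edge_overlap_le ma rs ri mG D_ge0 G_section Gr.
have h2 := edge_mean_error ma rs ri mG Gr.
rewrite -/L in h2; rewrite rhoE -/M in h1.
have -> : (expR (- L + 2 * D * L) * (K * expR K) + 2) / n.+1%:R =
    expR (- L + 2 * D * L) * (K * e * expR K) + 2 * e.
  by rewrite /e; ring.
suff : expR (- (edge_mean r (cell_mass mu a) - edge_overlap r (cell_mass mu a))) <=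
    expR (- L + 2 * D * L) + expR (- L + 2 * D * L) * (K * e * expR K).
  by rewrite mulr2n; move: (expR _ * (_ * expR K)) => z; lra.
(* From exp(-y) >= 1 - y follows exp(y) <= 1 + y exp(y); as e <= 1, the multiplicative error becomes
   linear in e, the form needed by [ler_harmonic]. *)
have expK : expR (K * e) <= 1 + K * e * expR K.
  have h : expR (K * e) <= 1 + K * e * expR (K * e).
    have := expR_ge1Dx (- (K * e)); rewrite expRN => h3.
    rewrite -lerBlDr -[X in X - _]mul1r -mulrBl.
    by rewrite -ler_pdivlMr ?expR_gt0// mul1r; apply: le_trans h3; rewrite lexx.
  apply: (le_trans h); rewrite lerD2l ler_wpM2l ?mulr_ge0// ler_expR.
  by rewrite -[leRHS]mulr1 ler_wpM2l.
apply: (@le_trans _ _ (expR (- L + 2 * D * L) * expR (K * e))).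
  rewrite -expRD ler_expR; move: h2; rewrite ler_norml => /andP[h2 h2'].
  rewrite /K; lra.
apply: (@le_trans _ _ (expR (- L + 2 * D * L) * (1 + K * e * expR K))).
  by rewrite ler_wpM2l ?expR_ge0.
by rewrite mulrDr mulr1.
Qed.

Let pairs_null : L = 0 -> P [set w | (0 < (N w)./2)%N] = 0%E.
Proof.
move=> L0; apply/eqP; rewrite -measure_le0 -[leRHS](edge_mean0 _); last by rewrite rhoE L0 mulr0.
rewrite le_measure ?inE//.
- exact: (measurable_N (fun n => 0 < n./2)%N).
- exact: (measurable_N (fun n => 0 < n)%N).
- by move=> w /=; case: (N w).
Qed.

(** The Stein solution divides by the rate, so rate 0 is treated apart: there almost surely no pair
    exists and [poisson_prob] is the Dirac measure at 0. *)
Lemma pairs_poisson_le (A : set nat) :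
  (P [set w | A (N w)./2] <=
   poisson_prob L 0 A + (Num.min 1 L^-1 * (2 * D * L))%:E)%E.
Proof.
have := L_ge0; rewrite le_eqVlt => /orP[/eqP/esym L0|Lgt0].
  rewrite L0 !mulr0 adde0 /poisson_prob ltxx diracE.
  have [/set_mem A0|A0] := boolP (0%N \in A).
    by apply: probability_le1; exact: (measurable_N (fun n => A n./2)).
  have <- : P [set w | (0 < (N w)./2)%N] = 0%:E by exact: pairs_null.
  rewrite le_measure ?inE//.
  - exact: (measurable_N (fun n => A n./2)).
  - exact: (measurable_N (fun n => 0 < n./2)%N).
  - move=> w /= Aw; rewrite lt0n; apply/eqP => N0; move: A0; rewrite notin_setE; apply.
    by rewrite -N0.
have [f [c [c' [fc c'0 fS fs _]]]] := stein_solution Lgt0 A.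
have := pairs_stein fc c'0 _ _ fS fs; rewrite EFinD fineK; last exact: fin_num_measure.
apply; last exact: fine_ge0.
by rewrite le_min ler01 invr_ge0 L_ge0.
Qed.

(** [pairs_stein] for the complement of {0}, with [kappa] = 0 by monotonicity of that Stein
    solution. *)
Lemma pairs_void_ge : ((expR (- L))%:E <= P [set w | (N w)./2 = 0%N])%E.
Proof.
have mN0 : measurable [set w | (N w)./2 = 0%N] by exact: (measurable_N (fun n => n./2 = 0%N)).
have mNgt : measurable [set w | (0 < (N w)./2)%N] by exact: (measurable_N (fun n => 0 < n./2)%N).
have -> : [set w | (N w)./2 = 0%N] = ~` [set w | (0 < (N w)./2)%N].
  by apply/seteqP; split => w /=; [move=> ->|case: (N w)./2 => // n /(_ isT)].
rewrite probability_setC//.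
have := L_ge0; rewrite le_eqVlt => /orP[/eqP/esym L0|Lgt0].
  by rewrite pairs_null// L0 oppr0 expR0 sube0.
have [f [c [c' [fc c'0 fS _ fs]]]] := stein_solution Lgt0 (~` [set 0%N]).
have fs' k : f k.+1 <= f k.+2 + 0 by rewrite addr0 fs.
have q0 : 0 <= fine (poisson_prob L 0 (~` [set 0%N])) by exact: fine_ge0.
have := pairs_stein fc c'0 (lexx 0) q0 fS fs'; rewrite mul0r addr0 => h.
have qE : fine (poisson_prob L 0 (~` [set 0%N])) = 1 - expR (- L).
  have m0 : measurable [set 0%N] by [].
  have := probability_setC (poisson_prob L 0) m0.
  rewrite /= poisson_prob1 ?ltW// => ->; rewrite -EFinB /=.
  by rewrite /poisson_weight expr0 fact0 divr1 mul1r.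
rewrite qE in h.
have -> : (expR (- L))%:E = (1 - (1 - expR (- L))%:E)%E by rewrite -EFinB subKr.
apply: leeB => //; apply: le_trans h.
rewrite le_measure ?inE//; first exact: (measurable_N (fun n => (~` [set 0%N]) n./2)).
by move=> w /= h0 h1; rewrite h1 in h0.
Qed.

End poisson_pairs.

(** * Lebesgue measure under translation and scaling *)

Section lebesgue_affine.
Context (R : realType).
Local Notation leb := (@lebesgue_measure R).

Lemma measurable_affine (s b : R) :
  measurable_fun setT (fun x : measurableTypeR R => s * x + b : measurableTypeR R).
Proof. by apply: measurable_funD => //; apply: measurable_funM. Qed.

(** The rescaled image measure agrees with Lebesgue measure on half-open intervals, so uniqueness
    applies. *)
Lemma lebesgue_measure_affine (s b : R) (A : set R) : 0 < s -> measurable A ->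
  leb ((fun x => s * x + b) @^-1` A) = (s^-1%:E * leb A)%E.
Proof.
move=> s0 mA.
pose f (x : measurableTypeR R) : measurableTypeR R := s * x + b.
have -> : leb A = (s%:E * leb (f @^-1` A))%E.
  have /= := @lebesgue_measure_unique _ (mscale (NngNum (ltW s0)) (pushforward leb f)).
  apply => //; first exact: measurable_affine.
  move=> mf _ [[a c]] _ <-; rewrite /mscale /= /pushforward.
  rewrite (_ : f @^-1` _ = `](a - b) / s, (c - b) / s]%classic); last first.
    apply/seteqP; split => x /=; rewrite !in_itv/= /f ltr_pdivrMr// ler_pdivlMr// mulrC.
      by rewrite ltrBlDr lerBrDr.
    by rewrite ltrBlDr lerBrDr.
  rewrite !lebesgue_measure_itv/= !lte_fin ltr_pM2r ?invr_gt0// ltrD2r.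
  case: ifP => // _; last by rewrite mule0.
  rewrite -!EFinB -EFinM -mulrBl opprB addrA addrNK mulrCA divff ?mulr1//.
  exact: lt0r_neq0.
by rewrite muleA -EFinM mulVf ?mul1e// lt0r_neq0.
Qed.

Lemma integral_affine (s b : R) (f : R -> \bar R) : 0 < s ->
  measurable_fun setT f -> (forall x, 0 <= f x)%E ->
  (\int[leb]_x f (s * x + b)%R = s^-1%:E * \int[leb]_x f x)%E.
Proof.
move=> s0 mf f0.
have := @ge0_integral_pushforward _ _ _ _ R _ (@measurable_affine s b) leb setT f measurableT mf.
rewrite preimage_setT => <-; last by move=> x _.
have s0' : 0 <= s^-1 by rewrite invr_ge0 ltW.
rewrite -(@ge0_integral_mscale _ _ R leb setT measurableT (NngNum s0'))//.
apply: eq_measure_integral; first exact: measurable_affine.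
by move=> mf' A mA _; exact: lebesgue_measure_affine.
Qed.

End lebesgue_affine.

Section tuple_affine.
Context (R : realType).
Local Notation leb := (@lebesgue_measure R).

Definition affine_tuple d (s : R) (b x : d.-tuple R) : d.-tuple R :=
  [tuple s * tnth x i + tnth b i | i < d].

Lemma measurable_affine_tuple d (s : R) (b : d.-tuple R) :
  measurable_fun setT (affine_tuple s b).
Proof.
apply/measurable_fun_tnthP => i.
rewrite (_ : _ \o _ = (fun x => s * tnth x i + tnth b i)).
  apply: measurable_funD => //; apply: measurable_funM => //; exact: measurable_tnth.
by apply/funext => x /=; rewrite tnth_mktuple.
Qed.

Lemma measurable_lebesgue_section d (A : set (d.+1.-tuple R)) : measurable A ->
  measurable_fun setT (fun a : measurableTypeR R =>
    lebesgue_tuple d [set y : d.-tuple R | A (cons_pair (a, y))]).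
Proof.
move=> mA; have mA' : measurable (@cons_pair R d @^-1` A).
  by rewrite -[X in measurable X]setTI; exact: measurable_cons_pair.
have := measurable_fun_xsection (lebesgue_tuple d) mA'.
congr (measurable_fun _ _); apply/funext => a /=; congr (lebesgue_tuple d _).
by apply/seteqP; split => y; rewrite /xsection /= inE.
Qed.

Lemma lebesgue_tupleS d (A : set (d.+1.-tuple R)) : lebesgue_tuple d.+1 A =
  (\int[leb]_a lebesgue_tuple d [set y : d.-tuple R | A (cons_pair (a, y))])%E.
Proof.
rewrite /= /lebesgue_step /pushforward /product_measure1.
apply: eq_integral => a _ /=; congr (lebesgue_tuple d _).
by apply/seteqP; split => y; rewrite /xsection /cons_pair /= inE.
Qed.

(** Induction on d: Fubini splits off the head coordinate, the tail scales by the induction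
    hypothesis, and [integral_affine] contributes the last factor of 1/s. *)
Lemma lebesgue_tuple_affine d (s : R) (b : d.-tuple R) (A : set (d.-tuple R)) :
  0 < s -> measurable A ->
  lebesgue_tuple d (affine_tuple s b @^-1` A) = ((s^-1 ^+ d)%:E * lebesgue_tuple d A)%E.
Proof.
move=> s0; elim: d b A => [|d ih] b A mA.
  rewrite expr0 mul1e (_ : _ @^-1` _ = A)//.
  by apply/seteqP; split => x /=; rewrite (tuple0 (affine_tuple s b x)) (tuple0 x).
rewrite !lebesgue_tupleS.
pose phi a := lebesgue_tuple d [set y : d.-tuple R | A (cons_pair (a, y))].
have phi0 a : (0 <= phi a)%E by exact: measure_ge0.
have mcons a : measurable_fun setT (fun y : d.-tuple R => cons_pair (a : measurableTypeR R, y)).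
  by apply: measurable_cons; [exact: measurable_cst|exact: measurable_id].
have affineS a y : affine_tuple s b (cons_pair (a, y)) =
    cons_pair (s * a + thead b, affine_tuple s [tuple of behead b] y).
  apply/eq_from_tnth => i; rewrite tnth_mktuple /cons_pair.
  case: (unliftP ord0 i) => [j ->|->]; last by rewrite !tnth0.
  by rewrite !tnthS tnth_mktuple [in LHS](tuple_eta b) tnthS.
have sect a : lebesgue_tuple d
      [set y : d.-tuple R | (affine_tuple s b @^-1` A) (cons_pair (a, y))] =
    ((s^-1 ^+ d)%:E * phi (s * a + thead b)%R)%E.
  rewrite /phi -(ih [tuple of behead b]).
    by congr (lebesgue_tuple d _); apply/seteqP; split => y /=; rewrite affineS.
  by rewrite -[X in measurable X]setTI; exact: mcons.
rewrite (eq_integral _ _ (fun a _ => sect a)).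
rewrite ge0_integralZl//.
- rewrite (@integral_affine _ s (thead b) phi)//; last exact: measurable_lebesgue_section.
  by rewrite muleA -EFinM -exprSr.
- by apply: (measurableT_comp (measurable_lebesgue_section mA)); exact: measurable_affine.
- by rewrite lee_fin exprn_ge0// invr_ge0 ltW.
Qed.

Lemma lebesgue_tuple_set1 d (x : d.-tuple R) : (0 < d)%N -> lebesgue_tuple d [set x] = 0%E.
Proof.
move=> d0; rewrite (_ : [set x] = [set y | forall i, [set tnth x i] (tnth y i)]).
  rewrite (lebesgue_tuple_box (A := fun i => [set tnth x i])); last first.
    by move=> i; exact: measurable_set1.
  case: d d0 x => // d _ x; rewrite big_ord_recl lebesgue_measure_set1.
  by rewrite mul0e.
apply/seteqP; split => y; first by move=> ->.
by move=> h; apply/eq_from_tnth => i; exact: h.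
Qed.

Lemma lebesgue_tuple_cube d (a b : R) : a <= b ->
  lebesgue_tuple d [set y : d.-tuple R | forall i, a <= tnth y i <= b] = ((b - a) ^+ d)%:E.
Proof.
move=> ab; rewrite (_ : [set y | _] = [set y : d.-tuple R | forall i, `[a, b]%classic (tnth y i)]).
  rewrite (lebesgue_tuple_box (A := fun=> `[a, b]%classic))//.
  rewrite (eq_bigr (fun=> (b - a)%:E)); last first.
    move=> i _; rewrite lebesgue_measure_itv/= lte_fin; case: ltP => [_|ba].
      by rewrite EFinB.
    by rewrite (@le_anti _ _ a b) ?subrr// ab.
  by rewrite prodEFin prodr_const card_ord.
by apply/seteqP; split => y h i; have := h i; rewrite /= in_itv.
Qed.

End tuple_affine.

(** * Volume of balls and the law of the scaled norm *)

Section euclidean_geometry.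
Context (R : realType) (d : nat).
Implicit Types (x y z : d.-tuple R).
Local Notation lam := (@lebesgue_tuple R d).

Lemma eucl_norm_ge0 x : 0 <= eucl_norm x.
Proof. exact: sqrtr_ge0. Qed.

Lemma eucl_norm_le x (r : R) : 0 <= r -> (eucl_norm x <= r) =
    (\sum_(i < d) tnth x i ^+ 2 <= r ^+ 2).
Proof.
by move=> r0; rewrite -[in LHS](ger0_norm r0) -sqrtr_sqr ler_sqrt// sqr_ge0.
Qed.

Lemma coord_le_eucl_norm x i : `|tnth x i| <= eucl_norm x.
Proof.
rewrite -sqrtr_sqr ler_wsqrtr// (bigD1 i)//= lerDl sumr_ge0// => j _.
exact: sqr_ge0.
Qed.

Lemma measurable_eucl_norm : measurable_fun setT (@eucl_norm R d).
Proof.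
apply: measurableT_comp; first exact: continuous_measurable_fun (@sqrt_continuous R).
apply: measurable_sum => i; apply: measurable_funX; exact: measurable_tnth.
Qed.

Lemma eucl_norm_scale (s : R) x : 0 <= s ->
  eucl_norm [tuple s * tnth x i | i < d] = s * eucl_norm x.
Proof.
move=> s0; rewrite /eucl_norm (eq_bigr (fun i => s ^+ 2 * tnth x i ^+ 2)); last first.
  by move=> i _; rewrite tnth_mktuple exprMn.
by rewrite -mulr_sumr sqrtrM ?sqr_ge0// sqrtr_sqr ger0_norm.
Qed.

Lemma eucl_norm_sub_tupleC x y : eucl_norm (sub_tuple x y) = eucl_norm (sub_tuple y x).
Proof.
by rewrite /eucl_norm; congr Num.sqrt; apply: eq_bigr => i _; rewrite !tnth_mktuple -sqrrN opprB.
Qed.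

Lemma eucl_norm_eq0 x : eucl_norm x <= 0 -> x = [tuple 0 | i < d].
Proof.
move=> x0; apply/eq_from_tnth => i; rewrite tnth_mktuple; apply/eqP.
by rewrite -normr_le0; apply: le_trans x0; exact: coord_le_eucl_norm.
Qed.

Let ball (r : R) := [set x : d.-tuple R | eucl_norm x <= r].

Lemma measurable_eucl_ball r : measurable (ball r).
Proof.
rewrite -[X in measurable X]setTI (_ : ball r = @eucl_norm R d @^-1` `]-oo, r]); last first.
  by apply/seteqP; split => x; rewrite /= in_itv.
exact: measurable_eucl_norm.
Qed.

Lemma measurable_cube (a b : R) : measurable [set y : d.-tuple R | forall i, a <= tnth y i <= b].
Proof.
rewrite (_ : [set y | _] = \bigcap_(i in [set: 'I_d]) (@tnth d R ^~ i @^-1` `[a, b])).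
  apply: fin_bigcap_measurable => // i _; rewrite -[X in measurable X]setTI.
  exact: measurable_tnth.
by apply/seteqP; split => y h i; [move=> _|have := h i I]; rewrite /= in_itv//=; exact: h.
Qed.

Lemma unit_ball_volumeE : lam (ball 1) = (unit_ball_volume R d)%:E.
Proof.
rewrite fineK// ge0_fin_numE//.
apply: (@le_lt_trans _ _ (lam [set y : d.-tuple R | forall i, -1 <= tnth y i <= 1])).
  rewrite le_measure ?inE//; [exact: measurable_eucl_ball|exact: measurable_cube|].
  move=> x xb i; rewrite -ler_norml; apply: le_trans xb; exact: coord_le_eucl_norm.
rewrite lebesgue_tuple_cube ?ltry//; lra.
Qed.

Lemma unit_ball_volume_gt0 : (0 < d)%N -> 0 < unit_ball_volume R d.
Proof.
move=> d0; have dR : 0 < d%:R :> R by rewrite ltr0n.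
rewrite -lte_fin -unit_ball_volumeE.
(* The cube of side 1/d lies in the unit ball, because x_i^2 <= x_i <= 1/d and the d bounds sum to
   1. *)
apply: (@lt_le_trans _ _ (lam [set y : d.-tuple R | forall i, 0 <= tnth y i <= d%:R^-1])).
  by rewrite lebesgue_tuple_cube ?invr_ge0 ?ltW// subr0 lte_fin exprn_gt0// invr_gt0.
rewrite le_measure ?inE//; [exact: measurable_cube|exact: measurable_eucl_ball|].
move=> x xb; rewrite /ball /= eucl_norm_le// expr1n.
apply: (@le_trans _ _ (\sum_(i < d) d%:R^-1 :> R)).
  apply: ler_sum => i _; have /andP[h1 h2] := xb i.
  apply: (@le_trans _ _ (tnth x i * 1)); last by rewrite mulr1.
  rewrite expr2 ler_wpM2l//; apply: (le_trans h2).
  by rewrite invf_le1// ler1n.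
by rewrite sumr_const card_ord -[_ *+ _]mulr_natr mulVf// lt0r_neq0.
Qed.

Lemma eucl_ball_volume (r : R) : 0 < r -> lam (ball r) = (r ^+ d * unit_ball_volume R d)%:E.
Proof.
move=> r0; rewrite EFinM -unit_ball_volumeE -[r in RHS]invrK.
rewrite -(@lebesgue_tuple_affine _ _ _ [tuple 0 | i < d]) ?invr_gt0//;
    last exact: measurable_eucl_ball.
have normE x : eucl_norm (affine_tuple r^-1 [tuple 0 | i < d] x) = r^-1 * eucl_norm x.
  rewrite -eucl_norm_scale ?invr_ge0 ?ltW//; congr eucl_norm.
  by apply/eq_from_tnth => i; rewrite !tnth_mktuple addr0.
congr (lam _); apply/seteqP; split => x; rewrite /ball /=.
  by rewrite normE mulrC ler_pdivrMr// mul1r.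
by rewrite normE mulrC ler_pdivrMr// mul1r.
Qed.

Lemma eucl_ball0_volume : (0 < d)%N -> lam (ball 0) = 0%E.
Proof.
move=> d0; rewrite -(lebesgue_tuple_set1 [tuple 0 | i < d] d0); congr (lam _).
apply/seteqP; split => x /=; first exact: eucl_norm_eq0.
move=> ->; rewrite /ball /= eucl_norm_le// expr0n /= big1// => i _.
by rewrite tnth_mktuple expr0n.
Qed.

Section scaled_distance_law.
Context (t : R) (t_gt0 : 0 < t) (d_gt0 : (0 < d)%N).

Definition scaled_norm z : R := 2^-1 * t ^+ 2 * unit_ball_volume R d * eucl_norm z ^+ d.

Lemma scaled_distanceE x y : scaled_distance t x y = scaled_norm (sub_tuple x y).
Proof. by []. Qed.

Let scale := 2^-1 * t ^+ 2 * unit_ball_volume R d.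

Let scale_gt0 : 0 < scale.
Proof. by rewrite !mulr_gt0// ?exprn_gt0// ?unit_ball_volume_gt0. Qed.

Lemma scaled_norm_ge0 z : 0 <= scaled_norm z.
Proof. by rewrite mulr_ge0 ?exprn_ge0 ?eucl_norm_ge0// ltW. Qed.

Lemma measurable_scaled_norm : measurable_fun setT scaled_norm.
Proof. by apply: measurable_funM => //; apply: measurable_funX; exact: measurable_eucl_norm. Qed.

Let root_exists (x : R) : 0 < x -> exists2 r : R, 0 < r & r ^+ d = x.
Proof.
move=> x0; exists (x `^ d%:R^-1); first exact: powR_gt0.
rewrite -powR_mulrn ?powR_ge0// -powRrM mulVf ?powRr1 ?ltW//.
by rewrite pnatr_eq0 -lt0n.
Qed.

(** The set is a ball whose radius has d-th power b / (t^2 k_d / 2); multiplying by k_d cancels the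
    dimension. This is the purpose of the normalization in [scaled_distance]. *)
Lemma scaled_norm_le_volume (b : R) : 0 <= b ->
  lam [set z | scaled_norm z <= b] = (2 / t ^+ 2 * b)%:E.
Proof.
rewrite le_eqVlt => /orP[/eqP <-|b0].
  rewrite mulr0; transitivity (lam (ball 0)); last exact: eucl_ball0_volume.
  congr (lam _).
  apply/seteqP; split => z /=; rewrite /scaled_norm pmulr_rle0// /ball /=.
    by move=> h; rewrite leNgt; apply/negP => z0; move: h; rewrite leNgt exprn_gt0.
  move=> h; have -> : eucl_norm z = 0 by apply/le_anti; rewrite h eucl_norm_ge0.
  by rewrite expr0n gtn_eqF.
have [r r0 rE] := root_exists (divr_gt0 b0 scale_gt0).
have -> : [set z | scaled_norm z <= b] = ball r.
  apply/seteqP; split => z; rewrite /ball /= /scaled_norm -/scale mulrC -ler_pdivlMr// -rE;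
    by rewrite ler_pXn2r ?nnegrE ?eucl_norm_ge0// ltW.
rewrite eucl_ball_volume// rE; congr EFin; rewrite /scale; field.
by rewrite !lt0r_neq0 ?unit_ball_volume_gt0.
Qed.

Let phi (z : d.-tuple R) : measurableTypeR R := scaled_norm z.

Let mphi : measurable_fun setT phi. Proof. exact: measurable_scaled_norm. Qed.

Let mpre (B : set R) : measurable B -> measurable (phi @^-1` B).
Proof. by move=> mB; rewrite -[X in measurable X]setTI; exact: mphi. Qed.

Lemma scaled_norm_itv_volume (a b : R) : 0 <= a -> a <= b ->
  lam (phi @^-1` `]a, b]) = (2 / t ^+ 2 * (b - a))%:E.
Proof.
move=> a0 ab.
have E (x : R) : [set z | scaled_norm z <= x] = phi @^-1` `]-oo, x].
  by apply/seteqP; split => z; rewrite /= in_itv.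
have -> : phi @^-1` `]a, b] = phi @^-1` `]-oo, b] `\` phi @^-1` `]-oo, a].
  apply/seteqP; split => z; rewrite /= !in_itv/=.
    by move=> /andP[h ->]; split => //; rewrite leNgt h.
  by move=> [-> /negP]; rewrite -ltNge => ->.
have F (x : R) : 0 <= x -> lam (phi @^-1` `]-oo, x]) = (2 / t ^+ 2 * x)%:E.
  by rewrite -E; exact: scaled_norm_le_volume.
have b0 : 0 <= b by exact: le_trans ab.
have boo : (lam (phi @^-1` `]-oo, b]) < +oo)%E by rewrite F ?ltry.
have I : phi @^-1` `]-oo, b] `&` phi @^-1` `]-oo, a] = phi @^-1` `]-oo, a].
  by apply/setIidPr => z; rewrite /= !in_itv/= => /le_trans; exact.
have mh (x : R) : measurable (phi @^-1` `]-oo, x]) by exact: mpre.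
apply: (etrans (measureD (mh b) (mh a) boo)); rewrite I.
transitivity ((2 / t ^+ 2 * b)%:E - (2 / t ^+ 2 * a)%:E)%E.
  by congr (_ - _)%E; exact: F.
by rewrite -EFinB mulrBr.
Qed.

(* Lebesgue measure on the half-line is compared with the law of [scaled_norm]
   after gluing in Lebesgue measure on the negative half-line, which makes the
   uniqueness theorem on the whole line applicable. *)
Lemma scaled_norm_volume (B : set R) (u : R) : measurable B -> B `<=` `[0, u] ->
  lam (scaled_norm @^-1` B) = ((2 / t ^+ 2)%:E * lebesgue_measure B)%E.
Proof.
move=> mB Bu.
have k0 : 0 <= t ^+ 2 / 2 by rewrite divr_ge0 ?exprn_ge0 ?ltW.
have mneg : measurable (`]-oo, 0[%classic : set (measurableTypeR R)) by [].
suff -> : lebesgue_measure B = ((t ^+ 2 / 2)%:E * lam (scaled_norm @^-1` B))%E.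
  rewrite muleA -EFinM (_ : _ * _ = 1) ?mul1e//.
  by field; rewrite lt0r_neq0.
pose glued (A : set R) := ((t ^+ 2 / 2)%:E * lam (phi @^-1` A) +
  lebesgue_measure (A `&` `]-oo, 0%R[))%E.
have uniq : (forall X, ocitv X -> lebesgue_measure X = glued X) ->
    forall A, measurable A -> lebesgue_measure A = glued A.
  move=> h A mA.
  have := @lebesgue_measure_unique _ (measure_add (mscale (NngNum k0) (pushforward lam phi))
    (mrestr (@lebesgue_measure R) mneg)).
  move=> /(_ mphi) uniq; apply: etrans (uniq _ _ mA) _; last exact: measure_addE.
  move=> X oX; apply: etrans (h X oX) _; apply/esym; exact: measure_addE.
rewrite uniq//.
  rewrite /glued (_ : B `&` _ = set0) ?measure0 ?adde0//.
  apply/seteqP; split => // x [/Bu]; rewrite /= !in_itv/= => /andP[h _].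
  by rewrite ltNge h.
move=> _ [[a b]] _ <-; rewrite /glued /=.
have [ba|ab] := leP b a.
  by rewrite set_itv_ge ?bnd_simp -?leNgt// preimage_set0 set0I !measure0 mule0 adde0.
have [b0|b0] := ltP b 0.
  rewrite (_ : phi @^-1` _ = set0); last first.
    apply/seteqP; split => // z; rewrite /= in_itv/= => /andP[_ h].
    by have := le_lt_trans h b0; rewrite ltNge scaled_norm_ge0.
  rewrite measure0 mule0 add0e; congr lebesgue_measure; apply/esym/setIidPl.
  by move=> x; rewrite /= !in_itv/= => /andP[_ h]; exact: le_lt_trans b0.
have kK (x : R) : t ^+ 2 / 2 * (2 / t ^+ 2 * x) = x by field; rewrite lt0r_neq0.
have [a0|a0] := ltP a 0.
  rewrite (_ : phi @^-1` _ = [set z | scaled_norm z <= b]); last first.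
    apply/seteqP; split => z; rewrite /= in_itv/=; first by move=> /andP[].
    by move=> ->; rewrite andbT; apply: lt_le_trans (scaled_norm_ge0 _).
  rewrite scaled_norm_le_volume// -EFinM kK.
  rewrite (_ : `]a, b] `&` _ = `]a, 0[%classic); last first.
    apply/seteqP; split => x; rewrite /= !in_itv/=; first by move=> [/andP[-> _]].
    by move=> /andP[-> h]; rewrite h (le_trans (ltW h) b0).
  by rewrite !lebesgue_measure_itv/= !lte_fin ab a0 -!EFinB -EFinD sub0r.
rewrite (scaled_norm_itv_volume a0 (ltW ab)) -EFinM kK.
rewrite (_ : `]a, b] `&` _ = set0) ?measure0 ?adde0.
  by rewrite lebesgue_measure_itv/= lte_fin ab -EFinB.
apply/seteqP; split => // x [] /=; rewrite !in_itv/= => /andP[h _].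
by rewrite ltNge (le_trans a0 (ltW h)).
Qed.

End scaled_distance_law.

End euclidean_geometry.

Lemma product_sq_restr d (T : measurableType d) (R : realType)
    (lam : {sigma_finite_measure set T -> \bar R}) (V : set T) (t : R)
    (mu : {finite_measure set T -> \bar R}) :
  measurable V -> (lam V < +oo)%E -> 0 <= t ->
  (forall A, measurable A -> mu A = (t%:E * lam (A `&` V))%E) ->
  forall S, measurable S ->
  product_sq mu S = ((t ^+ 2)%:E * (lam \x lam) (S `&` V `*` V))%E.
Proof.
move=> mV Voo t0 muE.
pose nu (S : set (T * T)) := ((t ^+ 2)%:E * (lam \x lam) (S `&` V `*` V))%E.
have mVV : measurable (V `*` V) by exact: measurableX.
have mS' (S : set (T * T)) : measurable S -> measurable (S `&` V `*` V).
  by move=> mS; exact: measurableI.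
have VVoo : ((lam \x lam)%E (V `*` V) < +oo)%E.
  by rewrite product_measure1E// lte_mul_pinfty// ge0_fin_numE.
have t20 : 0 <= t ^+ 2 by rewrite exprn_ge0.
have nuX A B : measurable A -> measurable B -> product_sq mu (A `*` B) = nu (A `*` B).
  move=> mA mB; rewrite product_sqE// /nu (_ : _ `&` _ = (A `&` V) `*` (B `&` V)).
    rewrite product_measure1E; [|exact: measurableI|exact: measurableI].
    by rewrite !muE// expr2 EFinM muleACA.
  by apply/seteqP; split => -[x y] /=; [move=> [[? ?] [? ?]]|move=> [[? ?] [? ?]]].
have nuU S S' : measurable S -> measurable S' -> S `&` S' = set0 ->
    nu (S `|` S') = (nu S + nu S')%E.
  move=> mS mS'' SS; rewrite /nu -ge0_muleDr// -measureU ?setIUl//; try exact: mS'.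
  by rewrite setIACA SS set0I.
apply: rectangle_induction => //.
- move=> S mS ES.
  have finS : nu S \is a fin_num by rewrite /nu -ES product_sq_fin.
  have : (nu (~` S) + nu S = product_sq mu (~` S) + product_sq mu S)%E.
    rewrite -nuU ?setICl//; last exact: measurableC.
    rewrite setvU -setXTT -nuX// setXTT.
    rewrite -(measureU (product_sq mu))//; [|exact: measurableC|exact: setICl].
    by rewrite setvU.
  rewrite [X in (_ = _ + X)%E]ES -/(nu S) -/(nu (~` S)) => e.
  have := congr1 (fun z => z - nu S)%E e.
  by rewrite !addeK.
- move=> F mF tF EF.
  have rhoU := @measure_bigcup _ R _ (product_sq mu) setT F (fun n _ => mF n) tF.
  apply: (etrans rhoU); rewrite setI_bigcupl.
  have tF' : trivIset setT (fun n => F n `&` V `*` V).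
    apply/trivIsetP => i j _ _ ij; rewrite setIACA.
    by move/trivIsetP : tF => /(_ _ _ I I ij) ->; rewrite set0I.
  rewrite measure_bigcup//; last by move=> n _; exact: mS'.
  rewrite -nneseriesZl//.
  by apply: eq_eseriesr => n _; rewrite EF.
Qed.

(** * Pairs with midpoint in W and prescribed scaled distance *)

Section close_pairs.
Context (R : realType) (d : nat) (d_gt0 : (0 < d)%N) (t : R) (t_gt0 : 0 < t).
Context (W : set (d.-tuple R)) (mW : measurable W).
Local Notation lam := (@lebesgue_tuple R d).
Implicit Types (x y z : d.-tuple R) (B : set R).

Definition close_pairs B : set (d.-tuple R * d.-tuple R) :=
  [set p | W (midpoint p.1 p.2) /\ B (scaled_distance t p.1 p.2)].

Lemma midpointC x y : midpoint x y = midpoint y x.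
Proof. by apply/eq_from_tnth => i; rewrite !tnth_mktuple addrC. Qed.

Lemma scaled_distanceC x y : scaled_distance t x y = scaled_distance t y x.
Proof. by rewrite /scaled_distance eucl_norm_sub_tupleC. Qed.

Lemma close_pairsC B x y : close_pairs B (x, y) -> close_pairs B (y, x).
Proof. by rewrite /close_pairs /= midpointC scaled_distanceC. Qed.

Let mtnth1 (i : 'I_d) : measurable_fun setT (fun p : d.-tuple R * d.-tuple R => tnth p.1 i).
Proof. by apply: (measurableT_comp (measurable_tnth i)); exact: measurable_fst. Qed.

Let mtnth2 (i : 'I_d) : measurable_fun setT (fun p : d.-tuple R * d.-tuple R => tnth p.2 i).
Proof. by apply: (measurableT_comp (measurable_tnth i)); exact: measurable_snd. Qed.

Let measurable_mktuple (f : d.-tuple R * d.-tuple R -> 'I_d -> R) :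
  (forall i, measurable_fun setT (f ^~ i)) ->
  measurable_fun setT (fun p => [tuple f p i | i < d]).
Proof.
move=> mf; apply/measurable_fun_tnthP => i.
by rewrite (_ : _ \o _ = f ^~ i)//; apply/funext => p /=; rewrite tnth_mktuple.
Qed.

Lemma measurable_midpoint :
  measurable_fun setT (fun p : d.-tuple R * d.-tuple R => midpoint p.1 p.2).
Proof.
by apply: measurable_mktuple => i; apply: measurable_funM => //; exact: measurable_funD.
Qed.

Lemma measurable_scaled_distance :
  measurable_fun setT (fun p : d.-tuple R * d.-tuple R => scaled_distance t p.1 p.2).
Proof.
apply: (measurableT_comp (measurable_scaled_norm t)).
by apply: measurable_mktuple => i; exact: measurable_funB.
Qed.

Lemma measurable_close_pairs B : measurable B -> measurable (close_pairs B).
Proof.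
move=> mB; apply: measurableI; rewrite -[X in measurable X]setTI.
  exact: measurable_midpoint.
exact: measurable_scaled_distance.
Qed.

Let translate_volume x A : measurable A ->
  lam [set z | A (affine_tuple 1 x z)] = lam A.
Proof.
by move=> mA; have := lebesgue_tuple_affine x ltr01 mA; rewrite invr1 expr1n mul1e.
Qed.

Lemma scaled_norm_translate x z : scaled_distance t x (affine_tuple 1 x z) = scaled_norm t z.
Proof.
rewrite /scaled_distance /scaled_norm; congr (_ * _ ^+ _); rewrite /eucl_norm.
congr Num.sqrt; apply: eq_bigr => i _; rewrite !tnth_mktuple mul1r.
by rewrite opprD addrCA subrr addr0 sqrrN.
Qed.

Lemma close_pairs_section B (u : R) x : 0 <= u -> measurable B -> B `<=` `[0, u] ->
  (lam (xsection (close_pairs B) x) <= (2 / t ^+ 2 * u)%:E)%E.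
Proof.
move=> u0 mB Bu; have mC := measurable_xsection x (measurable_close_pairs mB).
rewrite -(scaled_norm_le_volume t_gt0 d_gt0 u0) -(translate_volume x mC).
have mball : measurable [set z : d.-tuple R | scaled_norm t z <= u].
  rewrite (_ : [set z | _] = scaled_norm t @^-1` `]-oo, u]); last first.
    by apply/seteqP; split => z; rewrite /= in_itv.
  by rewrite -[X in measurable X]setTI; exact: measurable_scaled_norm.
rewrite le_measure ?inE//.
  by rewrite -[X in measurable X]setTI; exact: measurable_affine_tuple.
move=> z; rewrite /xsection /= inE => -[_ /Bu] /=.
by rewrite scaled_norm_translate in_itv/= => /andP[].
Qed.

(** The shear (x, z) -> (x, x + z) preserves volume and turns the condition on the distance into one
    on z alone. *)
Lemma close_pairs_volume B : measurable B ->
  ((lam \x lam) (close_pairs B) = lam (scaled_norm t @^-1` B) * lam W)%E.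
Proof.
move=> mB; have mC := measurable_close_pairs mB.
pose shear (p : d.-tuple R * d.-tuple R) := (p.1, affine_tuple 1 p.1 p.2).
have mshear : measurable_fun setT shear.
  apply: measurable_fun_pair; first exact: measurable_fst.
  by apply: measurable_mktuple => i; apply: measurable_funD => //; exact: measurable_funM.
have mC' : measurable (shear @^-1` close_pairs B).
  by rewrite -[X in measurable X]setTI; exact: mshear.
have -> : ((lam \x lam) (close_pairs B) = (lam \x lam) (shear @^-1` close_pairs B))%E.
  apply: eq_integral => x _ /=.
  by rewrite -(translate_volume x (measurable_xsection x mC)); congr (lam _).
(* Exchange the order of integration, to fix z before x. *)
rewrite (product_measure_unique (m' := (lam \x^ lam)%E))//; last first.
  by move=> A A' mA mA'; exact: product_measure2E.
rewrite /product_measure2.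
have mphiB : measurable (scaled_norm t @^-1` B : set (d.-tuple R)).
  by rewrite -[X in measurable X]setTI; exact: measurable_scaled_norm.
transitivity (\int[lam]_z ((\1_(scaled_norm t @^-1` B) z)%:E * lam W))%E.
  apply: eq_integral => z _ /=; rewrite indicE.
  have [/set_mem zB|/negP zB] := boolP (z \in _).
    (* The midpoint of x and x + z is x + z/2, so the section at z is a translate of W. *)
    rewrite mul1e -(translate_volume [tuple tnth z i / 2 | i < d] mW); congr (lam _).
    apply/seteqP; split => x; rewrite /ysection /= inE /close_pairs /=.
      move=> [Wx _]; congr (W _) : Wx; apply/eq_from_tnth => i; rewrite !tnth_mktuple.
      by field.
    rewrite scaled_norm_translate => Wx; split => //.
    congr (W _) : Wx; apply/eq_from_tnth => i; rewrite !tnth_mktuple.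
    by field.
  rewrite mul0e (_ : ysection _ _ = set0) ?measure0//.
  apply/seteqP; split => // x; rewrite /ysection /= inE /close_pairs /= => -[_].
  by rewrite scaled_norm_translate => Bz; apply: zB; rewrite inE.
rewrite ge0_integralZr//.
- by rewrite integral_indic// setIT.
- by apply: measurableT_comp => //; exact: measurable_indic.
Qed.

Lemma close_pairs_bounded B (u : R) : eucl_bounded W -> 0 <= u -> B `<=` `[0, u] ->
  exists2 K : R, 0 <= K & close_pairs B `<=`
    [set y | forall i, - K <= tnth y i <= K] `*` [set y | forall i, - K <= tnth y i <= K].
Proof.
move=> [M WM] u0 Bu.
pose k := 2^-1 * t ^+ 2 * unit_ball_volume R d.
have k0 : 0 < k by rewrite !mulr_gt0// ?exprn_gt0// ?unit_ball_volume_gt0.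
have uk0 : 0 <= u / k by rewrite divr_ge0// ltW.
(* Avoids a d-th root: a norm n >= 1 satisfies n <= n^d <= u/k, and otherwise n < 1. *)
pose r := 1 + u / k.
have coord x y i : close_pairs B (x, y) -> `|tnth x i| <= `|M| + r.
  move=> [/= Wm /Bu]; rewrite /= in_itv/= => /andP[_ su].
  have mM : `|tnth (midpoint x y) i| <= `|M|.
    apply: le_trans (coord_le_eucl_norm _ _) _; apply: le_trans (WM _ Wm) (ler_norm _).
  have nr : eucl_norm (sub_tuple x y) <= r.
    rewrite leNgt; apply/negP => rn.
    have n1 : 1 <= eucl_norm (sub_tuple x y).
      by apply: le_trans (ltW rn); rewrite /r lerDl.
    have : eucl_norm (sub_tuple x y) <= u / k.
      rewrite ler_pdivlMr// mulrC; apply: le_trans su; rewrite /scaled_distance -/k ler_pM2l//.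
      by rewrite -[leLHS]expr1 ler_weXn2l.
    by move=> /(lt_le_trans rn); rewrite /r; move: (u / k) => z; lra.
  have xy : `|tnth x i - tnth y i| <= r.
    apply: le_trans nr; apply: le_trans (coord_le_eucl_norm _ i).
    by rewrite tnth_mktuple.
  move: mM xy; rewrite tnth_mktuple !ler_norml => /andP[h1 h2] /andP[h3 h4].
  have r0 : 0 <= r by rewrite addr_ge0.
  by apply/andP; split; lra.
exists (`|M| + r); first by rewrite !addr_ge0.
move=> [x y] xy; split => i /=; rewrite -ler_norml; first exact: coord xy.
exact: coord (close_pairsC xy).
Qed.

End close_pairs.

Section half_spaces.
Context (R : realType) (d : nat).

(** A countable family of measurable sets separating points; indices that decode to nothing give
    [setT], which separates no points. *)
Definition half_space (k : nat) : set (d.-tuple R) :=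
  if @unpickle ('I_d * rat)%type k is Some (i, q) then [set x | tnth x i < ratr q] else setT.

Lemma measurable_half_space k : measurable (half_space k).
Proof.
rewrite /half_space; case: unpickle => [[i q]|//].
rewrite (_ : [set x | _] = @tnth d R ^~ i @^-1` `]-oo, ratr q[); last first.
  by apply/seteqP; split => x; rewrite /= in_itv.
by rewrite -[X in measurable X]setTI; exact: measurable_tnth.
Qed.

Lemma half_space_separates x y :
  (forall k, half_space k x <-> half_space k y) -> x = y.
Proof.
move=> h; apply/eq_from_tnth => i.
have hq (q : rat) : (tnth x i < ratr q) <-> (tnth y i < ratr q).
  by have := h (pickle (i, q)); rewrite /half_space pickleK.
apply/eqP; rewrite eq_le !leNgt; apply/andP; split; apply/negP => /rat_in_itvoo[q];
  rewrite in_itv/= => /andP[h1 h2].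
  by have /hq h3 := h1; have := lt_trans h2 h3; rewrite ltxx.
by have /hq h3 := h1; have := lt_trans h2 h3; rewrite ltxx.
Qed.

End half_spaces.

(** Ensures that halving the number of ordered pairs with [./2] loses nothing. *)
Lemma odd_symmetric_sum (T : Type) (s : seq T) (f : T -> T -> nat) :
  (forall x y, f x y = f y x) -> (forall x, f x x = 0%N) ->
  odd (\sum_(x <- s) \sum_(y <- s) f x y) = false.
Proof.
move=> fC f0; elim: s => [|a s ih]; first by rewrite big_nil.
rewrite big_cons big_cons f0 add0n; under [X in (_ + X)%N]eq_bigr do rewrite big_cons.
rewrite big_split/= addnA oddD ih addbF.
under [X in (_ + X)%N]eq_bigr do rewrite fC.
by rewrite addnn odd_double.
Qed.

Lemma odd_distinct_count d (T : measurableType d) (s : seq T) (G : set (T * T)) :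
  (forall x y, G (x, y) -> G (y, x)) -> odd (distinct_count s G) = false.
Proof.
move=> Gsym; rewrite /distinct_count -sum1_count big_mkcond/= big_allpairs.
apply: odd_symmetric_sum => [x y|x]; last by rewrite eqxx.
rewrite eq_sym (_ : ((x, y) \in G) = ((y, x) \in G))//.
by apply/idP/idP => /set_mem h; apply/mem_set; exact: Gsym.
Qed.

(** * The law of xi_t on a bounded set *)

Section xi_law.
Context (R : realType) (d : nat) (d_gt0 : (0 < d)%N) (t : R) (t_gt0 : 0 < t).
Context (W : set (d.-tuple R)) (mW : measurable W) (W_bounded : eucl_bounded W).
Hypothesis W_volume : lebesgue_tuple d W = 1%E.
Context dO (Omega : measurableType dO) (P : probability Omega R)
  (eta : R.-ker Omega ~> d.-tuple R).
Hypothesis eta_poisson :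
  poisson_process P (mscale (NngNum (ltW t_gt0)) (lebesgue_tuple d)) eta.
Local Notation lam := (@lebesgue_tuple R d).

Let eta_counting w A : measurable A ->
  eta w A = +oo%E \/ exists n : nat, eta w A = n%:R%:E.
Proof.
by move=> mA; apply: (point_process_counting (poisson_process_point_process eta_poisson)).
Qed.

Lemma xiE (m : {measure set (d.-tuple R) -> \bar R}) B :
  xi t W m B = (2^-1%:E * \esum_(p in distinct_pairs m `&` close_pairs t W B) 1)%E.
Proof.
rewrite /xi esum_mkcondr; congr (_ * _)%E; apply: eq_esum => p _.
rewrite diracE indicE -EFinM -natrM mulnb.
rewrite (_ : (p \in close_pairs t W B) = (midpoint p.1 p.2 \in W) &&
    (scaled_distance t p.1 p.2 \in B)).
  by case: (_ && _).
apply/idP/andP => [/set_mem[? ?]|[/set_mem ? /set_mem ?]]; last exact: mem_set.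
by split; exact: mem_set.
Qed.

Lemma measurable_xi B : measurable B -> measurable_fun setT (fun w => xi t W (eta w) B).
Proof.
move=> mB; have [F [mF FT Foo]] :=
  point_process_sigma_finite (poisson_process_point_process eta_poisson).
under eq_fun do rewrite xiE.
apply: measurable_funeM.
apply: (measurable_esum_distinct_pairs (@measurable_half_space R d) (@half_space_separates R d)
  eta_counting mF FT Foo).
exact: measurable_close_pairs.
Qed.

Lemma xi_eq0 (m : {measure set (d.-tuple R) -> \bar R}) B :
  xi t W m B = 0%E <-> distinct_pairs m `&` close_pairs t W B = set0.
Proof.
rewrite xiE; split => [/eqP|->]; last by rewrite esum_set0 mule0.
rewrite mule_eq0 eqe invr_eq0 pnatr_eq0/= => /eqP E0.
apply/seteqP; split => // p Ip.
suff : (1 <= (0 : \bar R))%E by rewrite lee_fin ler10.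
rewrite -E0; apply: esum_ge; exists [set p]; last by rewrite fsbig_set1.
by split; [exact: finite_set1|move=> _ ->].
Qed.

Section bounded_set.
Context (B : set R) (mB : measurable B) (q : R) (q_ge0 : 0 <= q) (Bq : B `<=` `[0, q]).

Let b := fine (lebesgue_measure B).

Let bE : lebesgue_measure B = b%:E.
Proof.
rewrite fineK// ge0_fin_numE//; apply: (@le_lt_trans _ _ (lebesgue_measure `[0, q]%classic)).
  by rewrite le_measure ?inE.
by rewrite lebesgue_measure_itv/=; case: ifP => // _; rewrite ltry.
Qed.

Lemma lebesgue_bounded_le : b <= q.
Proof.
rewrite -lee_fin -bE; apply: (@le_trans _ _ (lebesgue_measure `[0, q]%classic)).
  by rewrite le_measure ?inE.
by rewrite lebesgue_measure_itv/=; case: ifP => // _; rewrite ?oppr0 ?adde0 ?sube0.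
Qed.

Let G := close_pairs t W B.
Let mG : measurable G. Proof. exact: measurable_close_pairs. Qed.

(** Z is the event that the bounding cube holds finitely many points. Off Z the list of atoms is
    empty and N carries no information, so the identity with [xi] is only almost sure. The error is
    2 D b with D = 2q/t. *)
Lemma xi_law : exists (Z : set Omega) (N : Omega -> nat),
  [/\ [/\ measurable Z, P Z = 1%E &
          forall w, Z w -> xi t W (eta w) B = (N w)%:R%:E],
      forall A : set nat, measurable [set w | A (N w)],
      forall A : set nat, (P [set w | A (N w)] <= poisson_prob b 0 A +
        (Num.min 1 b^-1 * (4 * q / t * b))%:E)%E,
      ((expR (- b))%:E <= P [set w | N w = 0%N])%E &
      (P [set w | N w = 0%N] <= (expR (- b + 4 * q / t * b))%:E)%E].
Proof.
have [K K0 GK] := close_pairs_bounded d_gt0 t_gt0 W_bounded q_ge0 Bq.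
pose V := [set y : d.-tuple R | forall i, - K <= tnth y i <= K].
have mV : measurable V by exact: measurable_cube.
have Voo' : (lam V < +oo)%E by rewrite lebesgue_tuple_cube ?ltry//; lra.
pose mu0 : {measure set (d.-tuple R) -> \bar R} := mscale (NngNum (ltW t_gt0)) lam.
have Voo : (mu0 V < +oo)%E by rewrite /mu0/= /mscale lte_mul_pinfty ?lee_fin ?(ltW t_gt0)//.
pose mu : {finite_measure set (d.-tuple R) -> \bar R} := mfrestr mV Voo.
have muE A : measurable A -> mu A = mu0 (A `&` V) by [].
have muE' A : measurable A -> mu A = (t%:E * lam (A `&` V))%E by [].
have mVI A : measurable A -> measurable (A `&` V) by move=> ?; exact: measurableI.
have le_mu A : measurable A -> (mu A <= t%:E * lam A)%E.
  move=> mA; rewrite muE'// lee_wpmul2l ?lee_fin ?(ltW t_gt0)//.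
  by apply: le_measure; rewrite ?inE//; exact: mVI.
have sm := @measurable_half_space R d; have ss := @half_space_separates R d.
have mu1 x : mu [set x] = 0%E.
  apply/eqP; rewrite -measure_le0; apply: le_trans (le_mu _ _) _.
    exact: (measurable_set1_of_sep sm ss).
  by rewrite lebesgue_tuple_set1// mule0.
(* A section of G has Lebesgue measure at most 2q/t^2, and [mu] has density at most t. *)
pose D := 2 * q / t.
have D0 : 0 <= D by rewrite divr_ge0 ?mulr_ge0// ltW.
have Gsec x : (mu (xsection G x) <= D%:E)%E.
  have mx := measurable_xsection x mG.
  apply: (le_trans (le_mu _ mx)).
  apply: (@le_trans _ _ (t%:E * (2 / t ^+ 2 * q)%:E)%E).
    by rewrite lee_wpmul2l ?lee_fin ?(ltW t_gt0)//; exact: close_pairs_section.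
  rewrite -EFinM lee_fin le_eqVlt; apply/orP; left; apply/eqP; rewrite /D.
  by field; rewrite lt0r_neq0.
have Gsym : forall x y, G (x, y) -> G (y, x) by exact: close_pairsC.
(* The intensity contributes t^2, the law of the scaled norm (2/t^2) b and W the factor 1; half of
   the resulting 2b counts unordered pairs. *)
have rhoG : fine (product_sq mu G) / 2 = b.
  have := product_sq_restr mV Voo' (ltW t_gt0) muE' mG.
  rewrite (_ : G `&` _ = G); last by apply/setIidPl.
  move=> ->; rewrite close_pairs_volume// W_volume mule1.
  rewrite (scaled_norm_volume t_gt0 d_gt0 mB Bq) bE -!EFinM /=.
  by field; rewrite lt0r_neq0.
pose N w := (distinct_count (atoms (eta w) V) G)./2.
have mN (A : set nat) : measurable [set w | A (N w)].
  have := @measurable_nat_event R _ _ (fun w => distinct_count (atoms (eta w) V) G).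
  move=> /(_ _ (fun n => A n./2)); apply.
  exact: (measurable_distinct_count sm ss eta_counting mV mG).
exists [set w | (eta w V < +oo)%E], N; split => //.
- split.
  + exact: (measurable_eta_fin eta mV).
  + have := poisson_process_cell_fin eta_poisson mV Voo muE measurableT.
    by rewrite setTI.
  + move=> w Zw; rewrite xiE (esum_distinct_pairs sm ss (@eta_counting w) mV Zw GK).
    rewrite -EFinM /N; congr EFin.
    rewrite -[X in 2^-1 * X%:R](odd_double_half (distinct_count _ _)) odd_distinct_count//.
    by rewrite add0n -muln2 natrM; field.
- move=> A; have := pairs_poisson_le sm ss eta_poisson mV Voo muE mu1 mG Gsym D0 Gsec A.
  by rewrite rhoG (_ : 2 * D * b = 4 * q / t * b)//; rewrite /D; ring.
- by have := pairs_void_ge sm ss eta_poisson mV Voo muE mu1 mG Gsym D0 Gsec; rewrite rhoG.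
- have := pairs_void_le sm ss eta_poisson mV Voo muE mu1 mG Gsym D0 Gsec.
  by rewrite rhoG (_ : 2 * D * b = 4 * q / t * b)//; rewrite /D; ring.
Qed.

End bounded_set.

End xi_law.

(** * Total variation distance and the minimal scaled distance *)

Section total_variation.
Context (R : realType).

Lemma probability_eq_on1 d (T : measurableType d) (P : probability T R)
    (Z A B : set T) : measurable Z -> P Z = 1%E -> measurable A -> measurable B ->
  A `&` Z = B `&` Z -> P A = P B.
Proof.
move=> mZ Z1 mA mB AB.
have ZC0 : P (~` Z) = 0%E by rewrite probability_setC// Z1 subee.
have h C : measurable C -> P C = P (C `&` Z).
  move=> mC; rewrite -[in LHS](setDUK (@subIsetl _ C Z)) measureU//; last 3 first.
  - exact: measurableI.
  - by apply: measurableD => //; exact: measurableI.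
  - by rewrite setDIK.
  apply: (etrans _ (adde0 _)); congr (_ + _)%E; apply/eqP; rewrite -measure_le0.
  apply: (@le_trans _ _ (P (~` Z))); last by rewrite ZC0.
  apply: le_measure; rewrite ?inE; [|exact: measurableC|].
  - by apply: measurableD => //; exact: measurableI.
  - by move=> w [Cw nCZ] Zw; apply: nCZ.
by rewrite (h _ mA) (h _ mB) AB.
Qed.

Lemma measurable_nat_values d (T : measurableType d) (X : T -> \bar R) (A : set nat) :
  measurable_fun setT X -> measurable [set w | exists2 n : nat, A n & X w = n%:R%:E].
Proof.
move=> mX; rewrite (_ : [set _ | _] = \bigcup_(n in A) [set w | X w = n%:R%:E]).
  apply: bigcup_measurable => n _; rewrite -[X in measurable X]setTI.
  by apply: (mX measurableT [set n%:R%:E]); exact: emeasurable_set1.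
by apply/seteqP; split => w [n]; exists n.
Qed.

Lemma poisson_nat_values d (T : measurableType d) (P : probability T R)
    (X : T -> \bar R) (b : R) (A : set nat) :
  measurable_fun setT X ->
  (forall n : nat, P [set w | X w = n%:R%:E] = poisson_prob b 0%N [set n]) ->
  P [set w | exists2 n : nat, A n & X w = n%:R%:E] = poisson_prob b 0%N A.
Proof.
move=> mX Xn.
have mXn n : measurable [set w | X w = n%:R%:E].
  rewrite -[X in measurable X]setTI.
  by apply: (mX measurableT [set n%:R%:E]); exact: emeasurable_set1.
rewrite (_ : [set _ | _] = \bigcup_(n in A) [set w | X w = n%:R%:E]); last first.
  by apply/seteqP; split => w [n]; exists n.
have -> : poisson_prob b 0%N A = poisson_prob b 0%N (\bigcup_(n in A) [set n]).
  by congr (poisson_prob _ _ _); apply/seteqP; split => [n An|n [k Ak ->]//]; exists n.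
rewrite measure_bigcup//=; last first.
  apply/trivIsetP => i j _ _ ij; apply/seteqP; split => // w [/= -> [] /eqP].
  by rewrite eqr_nat (negbTE ij).
rewrite measure_bigcup//=; last first.
  by apply/trivIsetP => i j _ _ ij; apply/seteqP; split => // w [/= -> /eqP]; rewrite (negbTE ij).
by apply: eq_eseriesr => n _; exact: Xn.
Qed.

(** Turns upper bounds into a distance: the bound for the complements is the missing lower bound. *)
Lemma probability_dist d (T : measurableType d) (P : probability T R)
    d' (T' : measurableType d') (P' : probability T' R)
    (E : set T) (F : set T') (k : R) :
  measurable E -> measurable F ->
  (P E <= P' F + k%:E)%E -> (P (~` E) <= P' (~` F) + k%:E)%E ->
  (`|P E - P' F| <= k%:E)%E.
Proof.
move=> mE mF; rewrite !probability_setC//.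
rewrite -(fineK (fin_num_measure P _ mE)) -(fineK (fin_num_measure P' _ mF)).
move: (fine _) (fine _) => p p'.
rewrite -!EFinB -!EFinD !lee_fin => h1 h2.
by rewrite ler_norml; apply/andP; split; lra.
Qed.

End total_variation.

Lemma poisson_process_nat_values d (T : measurableType d) (R : realType)
    dO (Omega : measurableType dO) (P : probability Omega R)
    (mu : {measure set T -> \bar R}) (eta : R.-ker Omega ~> T) (B : set T) (b : R)
    (A : set nat) :
  poisson_process P mu eta -> measurable B -> mu B = b%:E ->
  P [set w | exists2 n : nat, A n & eta w B = n%:R%:E] = poisson_prob b 0%N A.
Proof.
move=> eta_poisson mB mub; apply: (poisson_nat_values (X := fun w => eta w B)).
  exact: measurable_kernel.
by move=> n; rewrite (poisson_process_fin eta_poisson) ?mub ?ltry.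
Qed.

Section min_pair_bound.
Context (R : realType).
Implicit Types q t u : R.

(** With s = 4q^2/t <= q/2, the inequality exp(s) <= 1 + s exp(s) gives an error of at most s
    exp(-q/2). Since exp(q/2) >= 1 + q^2/8, one has q^2 exp(-q/2) <= 8, so the error is at most
    32/t. *)
Lemma expRN_error q t : 0 < t -> 0 <= q -> q <= t / 8 ->
  expR (- q + 4 * q / t * q) <= expR (- q) + 81 / t.
Proof.
move=> t0 q0 qt; set s := 4 * q / t * q.
have s0 : 0 <= s by rewrite !mulr_ge0// invr_ge0 ltW.
have sq : s <= q / 2.
  by rewrite /s mulrC ler_wpM2l// ler_pdivrMr//; lra.
have e1 : expR (- q / 2) * q ^+ 2 <= 8.
  have h : 1 + (q / 2) ^+ 2 / 2 <= expR (q / 2).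
    by have := @expR_ge1Dxn R (q / 2) 1; rewrite !factS fact0 muln1; apply; lra.
  have : expR (- q / 2) * expR (q / 2) = 1.
    by rewrite -expRD (_ : _ + _ = 0) ?expR0//; field.
  have := expR_gt0 (- q / 2).
  move: (expR (- q / 2)) (expR (q / 2)) h => x y h x0 xy; nra.
have e2 : expR (- q + s) <= expR (- q) + s * expR (- q / 2).
  have h : expR s <= 1 + s * expR s.
    have h : 1 - s <= expR (- s) by exact: expR_ge1Dx.
    have : expR (- s) * expR s = 1 by rewrite -expRD addNr expR0.
    have := expR_gt0 s; move: (expR s) (expR (- s)) h => x y h x0 yx; nra.
  rewrite expRD; apply: (@le_trans _ _ (expR (- q) * (1 + s * expR s))).
    by rewrite ler_wpM2l// expR_ge0.
  rewrite mulrDr mulr1 lerD2l mulrCA ler_wpM2l// -expRD ler_expR; lra.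
apply: (le_trans e2); rewrite lerD2l /s.
have -> : 4 * q / t * q * expR (- q / 2) = (4 * (expR (- q / 2) * q ^+ 2)) / t by ring.
by rewrite ler_wpM2r ?invr_ge0 ?(ltW t0)//; lra.
Qed.

(** At q = t/8 the exponent is -t/16, and exp(-t/16) <= 1/(1 + t/16) <= 16/t. No exponential remains
    on the right, so by monotonicity the bound serves all larger q. *)
Lemma expRN_error_end t : 0 < t ->
  expR (- (t / 8) + 4 * (t / 8) / t * (t / 8)) <= 81 / t.
Proof.
move=> t0; have -> : - (t / 8) + 4 * (t / 8) / t * (t / 8) = - (t / 16).
  by field; rewrite lt0r_neq0.
have h := @expR_ge1Dx R (t / 16).
rewrite expRN ler_pdivlMr// mulrC ler_pdivrMr ?expR_gt0//; lra.
Qed.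

(** The point is min(1, 1/b) b <= min(1, q). At b = 0 the inverse is 0 by convention and the left
    side vanishes. *)
Lemma min_inv_le b q t : 0 < t -> 0 <= b -> b <= q ->
  Num.min 1 b^-1 * (4 * q / t * b) <= Num.min 1 q * (8 * q / t).
Proof.
move=> t0 b0 bq; have q0 := le_trans b0 bq.
have h0 : 0 <= 4 * q / t by rewrite !mulr_ge0// invr_ge0 ltW.
have h : Num.min 1 b^-1 * b <= Num.min 1 q.
  move: b0; rewrite le_eqVlt => /orP[/eqP <-|b0].
    by rewrite mulr0 le_min q0 ler01.
  rewrite le_min; apply/andP; split.
    by rewrite -(@mulVf _ b) ?lt0r_neq0// ler_wpM2r ?(ltW b0)// ge_min lexx orbT.
  by apply: le_trans bq; rewrite -[leRHS]mul1r ler_wpM2r ?(ltW b0)// ge_min lexx.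
have -> : Num.min 1 b^-1 * (4 * q / t * b) = (Num.min 1 b^-1 * b) * (4 * q / t) by ring.
apply: (@le_trans _ _ (Num.min 1 q * (4 * q / t))); first exact: ler_wpM2r.
apply: ler_wpM2l; first by rewrite le_min q0 ler01.
by rewrite -!mulrA ler_wpM2r ?mulr_ge0 ?invr_ge0 ?(ltW t0)//; lra.
Qed.

End min_pair_bound.

Section min_scaled_distance.
Context (R : realType) (d : nat) (d_gt0 : (0 < d)%N) (t : R) (t_gt0 : 0 < t).
Context (W : set (d.-tuple R)) (mW : measurable W) (W_bounded : eucl_bounded W).
Hypothesis W_volume : lebesgue_tuple d W = 1%E.
Context dO (Omega : measurableType dO) (P : probability Omega R)
  (eta : R.-ker Omega ~> d.-tuple R).
Hypothesis eta_poisson :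
  poisson_process P (mscale (NngNum (ltW t_gt0)) (lebesgue_tuple d)) eta.

Lemma xi_poisson_dist (B : set R) (u : R) (A : set nat) :
  measurable B -> 0 <= u -> B `<=` `[0, u] ->
  (`|P [set w | exists2 n : nat, A n & xi t W (eta w) B = n%:R%:E]
     - poisson_prob (fine (lebesgue_measure B)) 0%N A|
   <= (Num.min 1 u * (8 * u / t))%:E)%E.
Proof.
move=> mB u0 Bu; set b := fine _.
have [Z [N [[mZ Z1 ZN] mN NA _ _]]] :=
  xi_law d_gt0 mW W_bounded W_volume eta_poisson mB u0 Bu.
have mX := measurable_xi mW eta_poisson mB.
pose E (C : set nat) := [set w | exists2 n : nat, C n & xi t W (eta w) B = n%:R%:E].
have mE C : measurable (E C) by exact: measurable_nat_values.
have EN (C : set nat) : P (E C) = P [set w | C (N w)].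
  apply: (probability_eq_on1 mZ Z1 (mE C) (mN C)).
  apply/seteqP; split => [w [[n Cn] h Zw]|w [/= Cw Zw]]; split => //.
    by move: h; rewrite ZN// => -[/eqP]; rewrite /= eqr_nat => /eqP ->.
  by exists (N w) => //; exact: ZN.
have ENC (C : set nat) : P (~` E C) = P [set w | (~` C) (N w)].
  by rewrite probability_setC// EN -probability_setC.
have b0 : 0 <= b by rewrite fine_ge0.
have bu := lebesgue_bounded_le mB u0 Bu.
have kb := min_inv_le t_gt0 b0 bu.
have NA' C : (P [set w | C (N w)] <= poisson_prob b 0%N C + (Num.min 1 u * (8 * u / t))%:E)%E.
  by apply: le_trans (NA C) _; rewrite leeD2l// lee_fin.
rewrite -/(E A); apply: probability_dist => //; first by rewrite EN.
by rewrite ENC; exact: NA'.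
Qed.

Let void (q : R) := [set w | xi t W (eta w) `[0, q]%classic = 0%E].

Let measurable_void (q : R) : measurable (void q).
Proof.
rewrite /void -[X in measurable X]setTI.
have mX := measurable_xi mW eta_poisson (measurable_itv `[0, q]).
by apply: (mX measurableT [set 0%E]); exact: emeasurable_set1.
Qed.

Let void_le (q q' : R) : q <= q' -> void q' `<=` void q.
Proof.
move=> qq' w /xi_eq0 h; apply/xi_eq0/seteqP; split => // p [dp [Wp /= qp]].
suff : (set0 : set _) p by [].
rewrite -h; split => //; split => //=.
by move: qp; rewrite !in_itv/= => /andP[-> /le_trans]; exact.
Qed.

Let void_bounds_of_law (q : R) : 0 <= q ->
  ((expR (- q))%:E <= P (void q) <= (expR (- q + 4 * q / t * q))%:E)%E.
Proof.
move=> q0; have [Z [N [[mZ Z1 ZN] mN _]]] :=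
  xi_law d_gt0 mW W_bounded W_volume eta_poisson (measurable_itv `[0, q]) q0 (@subset_refl _ _).
rewrite lebesgue_measure_itv/= lte_fin.
rewrite (_ : fine _ = q); last first.
  by case: ltP => [_|q0']; rewrite /= ?oppr0 ?addr0//; apply/le_anti/andP; split.
rewrite (_ : P [set w | N w = 0%N] = P (void q)) => [-> -> //|].
apply: (probability_eq_on1 mZ Z1 (mN [set 0%N]) (measurable_void q)).
apply/seteqP; split => w [/= h Zw]; split => //; rewrite /void/=.
  by rewrite ZN// h.
by move: h; rewrite /void /= ZN// => -[/eqP]; rewrite pnatr_eq0 => /eqP.
Qed.

Let void_bounds (q : R) : 0 <= q ->
  ((expR (- q))%:E <= P (void q) <= (expR (- q) + 81 / t)%:E)%E.
Proof.
move=> q0; have /andP[-> /= hq] := void_bounds_of_law q0.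
have [qt|qt] := lerP q (t / 8).
  by apply: (le_trans hq); rewrite lee_fin; exact: expRN_error.
have t8 : 0 <= t / 8 by rewrite divr_ge0// ltW.
have /andP[_ h8] := void_bounds_of_law t8.
apply: (@le_trans _ _ (P (void (t / 8)))).
  by rewrite le_measure ?inE//; exact/void_le/ltW.
apply: (le_trans h8); rewrite lee_fin; apply: (le_trans (expRN_error_end t_gt0)).
by rewrite lerDr expR_ge0.
Qed.

(** An infimum equal to u need not be attained, so absence of pairs at distance at most u does not
    imply Y > u; a margin 1/(n + 1) is required. *)
Lemma Ymin_void (u : R) : 0 <= u -> [set w | (u%:E < Ymin t W (eta w))%E] =
  \bigcup_n void (u + n.+1%:R^-1).
Proof.
move=> u0; apply/seteqP; split => [w /= uY|w [n _ /xi_eq0 h] /=].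
  have [n hn] : exists n, ((u + n.+1%:R^-1)%:E < Ymin t W (eta w))%E.
    move: uY; case: (Ymin _ _ _) => [y| |//]; last by exists 0%N; exact: ltry.
    rewrite lte_fin => uy; have : 0 < y - u by rewrite subr_gt0.
    move=> /ltr_add_invr[n]; rewrite add0r => hn; exists n.
    by rewrite lte_fin -ltrBrDl.
  exists n => //; apply/xi_eq0/seteqP; split => // p [dp [Wp /= qp]].
  have : (Ymin t W (eta w) <= (scaled_distance t p.1 p.2)%:E)%E.
    by apply: ereal_inf_lbound; exists p.
  move=> /(lt_le_trans hn); rewrite lte_fin ltNge.
  by move: qp; rewrite in_itv/= => /andP[_ ->].
apply: (@lt_le_trans _ _ (u + n.+1%:R^-1)%:E).
  by rewrite lte_fin ltrDl invr_gt0.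
apply: le_ereal_inf_tmp => _ [p [dp Wp] <-]; rewrite lee_fin leNgt; apply/negP => lp.
suff : (set0 : set _) p by [].
rewrite -h; split => //; split => //=.
by rewrite in_itv/= (ltW lp) andbT scaled_distanceE scaled_norm_ge0.
Qed.

Lemma Ymin_bounds (u : R) : 0 <= u ->
  (0 <= P [set w | u%:E < Ymin t W (eta w)] - (expR (- u))%:E <= (81 / t)%:E)%E.
Proof.
move=> u0; rewrite Ymin_void//.
pose q n : R := u + n.+1%:R^-1.
have q0 n : 0 <= q n by rewrite addr_ge0.
have mU : measurable (\bigcup_n void (q n)) by exact: bigcup_measurable.
have nd : nondecreasing_seq (fun n => void (q n)).
  move=> m n mn; apply/subsetPset; apply: void_le.
  by rewrite lerD2l lef_pV2 ?posrE// ler_nat.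
have hi : (P (\bigcup_n void (q n)) <= (expR (- u) + 81 / t)%:E)%E.
  have cv := nondecreasing_cvg_mu (mu := P) (fun n => measurable_void (q n)) mU nd.
  apply: (cvge_to_le cv); apply: nearW => n /=.
  have /andP[_ h] := void_bounds (q0 n); apply: (le_trans h); rewrite lee_fin lerD2r.
  by rewrite ler_expR lerN2 lerDl.
have [x Ex] : exists x : R, P (\bigcup_n void (q n)) = x%:E.
  by exists (fine (P (\bigcup_n void (q n)))); rewrite fineK// fin_num_measure.
have lo : expR (- u) <= x.
  (* One void event suffices for the lower bound: exp(-u - h) >= exp(-u) (1 - h) with h = 1/(n +
     1). *)
  apply: (@ler_harmonic _ _ _ (expR (- u))) => n.
  have /andP[h _] := void_bounds (q0 n).
  have : ((expR (- q n))%:E <= P (\bigcup_n void (q n)))%E.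
    apply: (le_trans h); rewrite le_measure ?inE//.
    exact: (bigcup_sup (i := n)).
  rewrite Ex lee_fin /q opprD expRD => h'.
  rewrite -lerBlDr; apply: le_trans h'.
  by rewrite -[X in X - _]mulr1 -mulrBr ler_wpM2l ?expR_ge0// expR_ge1Dx.
move: hi; rewrite Ex -EFinB !lee_fin => hi; apply/andP; split; lra.
Qed.

End min_scaled_distance.

Theorem theorem3p4 (R : realType) (d : nat) (d_gt0 : (0 < d)%N)
    (W : set (d.-tuple R)) (W_measurable : measurable W)
    (W_bounded : eucl_bounded W) (W_volume : lebesgue_tuple d W = 1%E)
    (t : R) (t_gt0 : 0 < t)
    (dO : measure_display) (Omega : measurableType dO)
    (P : probability Omega R) (eta : R.-ker Omega ~> d.-tuple R)
    (eta_poisson :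
      poisson_process P (mscale (NngNum (ltW t_gt0)) (lebesgue_tuple d)) eta)
    (dO' : measure_display) (Omega' : measurableType dO')
    (P' : probability Omega' R) (gamma : R.-ker Omega' ~> measurableTypeR R)
    (gamma_poisson :
      poisson_process P'
        (mrestr lebesgue_measure (measurable_itv `[(0 : R), +oo[)) gamma)
    (u : R) (u_ge0 : 0 <= u) :
  (forall B : set R, measurable B -> B `<=` `[0, u] ->
     (dTV P (fun w => xi t W (eta w) B) P' (fun w => gamma w B)
      <= (Num.min 1 u * (8 * u / t))%:E)%E) /\
  (0 <= P [set w | u%:E < Ymin t W (eta w)] - (expR (- u))%:E <= (81 / t)%:E)%E.
Proof.
split; last exact: (Ymin_bounds d_gt0 W_measurable W_bounded W_volume eta_poisson).
move=> B mB Bu; apply: ub_ereal_sup => _ [A _ <-].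
have Boo : (lebesgue_measure B < +oo)%E.
  apply: (@le_lt_trans _ _ (lebesgue_measure `[0, u]%classic)).
    by rewrite le_measure ?inE.
  by rewrite lebesgue_measure_itv/=; case: ifP => // _; rewrite ltry.
have BE : mrestr lebesgue_measure (measurable_itv `[(0 : R), +oo[) B =
    (fine (lebesgue_measure B))%:E.
  rewrite fineK ?ge0_fin_numE// /mrestr; congr lebesgue_measure; apply/setIidPl => x /Bu /=.
  by rewrite !in_itv/= andbT => /andP[].
rewrite (poisson_process_nat_values A gamma_poisson mB BE).
exact: (xi_poisson_dist d_gt0 W_measurable W_bounded W_volume eta_poisson).
Qed.
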